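(* Let $\mathbb{K}$ be a field of characteristic $0$, let $s_\bullet$ be a gauge, and let $\mathfrak{g}$ be a nilpotent $L_\infty$-algebra over $\mathbb{K}$. Then the simplicial set $\gamma_\bullet(\mathfrak{g})$, together with its sets of thin simplices, is an $\infty$-groupoid. If moreover $\mathfrak{g}$ is concentrated in degrees $(-\ell,\infty)$ (that is, $\mathfrak g^i=0$ for $i\le-\ell$), then $\gamma_\bullet(\mathfrak{g})$ is an $\ell$-groupoid; if $\mathfrak{g}$ is concentrated in degrees $(-\ell,0]$, then $\gamma_\bullet(\mathfrak{g})$ is an $\ell$-group.
   Context: $L_\infty$-algebras. An $L_\infty$-algebra is a graded $\mathbb{K}$-vector space $\mathfrak{g}$ with multilinear operations $[x_1,\dots,x_k]$, $k\ge1$, of degree $2-k$, graded antisymmetric, i.e. $[x_1,\dots,x_i,x_{i+1},\dots,x_k]+(-1)^{|x_i||x_{i+1}|}[x_1,\dots,x_{i+1},x_i,\dots,x_k]=0$, such that for each $n\ge1$ $$\sum_{k=1}^n(-1)^k\sum(-1)^{\varepsilon}[[x_{i_1},\dots,x_{i_k}],x_{j_1},\dots,x_{j_{n-k}}]=0,$$ the inner sum being over $i_1<\dots<i_k$, $j_1<\dots<j_{n-k}$ with $\{i_1,\dots,i_k\}\cup\{j_1,\dots,j_{n-k}\}=\{1,\dots,n\}$, and $(-1)^\varepsilon$ being the product of the sign of the permutation $(1,\dots,n)\mapsto(i_1,\dots,i_k,j_1,\dots,j_{n-k})$ with the Koszul sign of its action on $(x_1,\dots,x_n)$. Write $\delta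 x=[x]$. Put $F^1\mathfrak g=\mathfrak g$ and, for $i>1$, $F^i\mathfrak g=\sum_{k\ge2}\sum_{i_1+\dots+i_k=i}[F^{i_1}\mathfrak g,\dots,F^{i_k}\mathfrak g]$; $\mathfrak g$ is nilpotent if $F^i\mathfrak g=0$ for all sufficiently large $i$. For nilpotent $\mathfrak g$, $\mathrm{MC}(\mathfrak g)$ is the set of $\alpha\in\mathfrak g^1$ with $\delta\alpha+\sum_{\ell\ge2}\frac1{\ell!}[\alpha,\dots,\alpha]=0$ ($\ell$ entries $\alpha$). Forms. $\Omega_n=\mathbb K[t_0,\dots,t_n,dt_0,\dots,dt_n]/(t_0+\dots+t_n-1,\,dt_0+\dots+dt_n)$ is the differential graded (dg) commutative algebra of polynomial forms on the $n$-simplex ($|t_i|=0$, $|dt_i|=1$); these form a simplicial dg algebra $\Omega_\bullet$, where $f:[k]\to[n]$ acts by $f^*t_i=\sum_{f(j)=i}t_j$. For an $L_\infty$-algebra $\mathfrak g$, $\mathfrak g\otimes\Omega_n$ is an $L_\infty$-algebra with $[x\otimes a]=[x]\otimes a+(-1)^{|x|}x\otimes da$ and, for $k\ge2$, $[x_1\otimes a_1,\dots,x_k\otimes a_k]=(-1)^{\sum_{i<j}|a_i||x_j|}[x_1,\dots,x_k]\otimes a_1\cdots a_k$. Set $\mathrm{MC}_\bullet(\mathfrak g)=\mathrm{MC}(\mathfrak g\otimes\Omega_\bullet)$, a simplicial set. Gauges. For $i_0,\dots,i_k\in\{0,\dots,n\}$, $I_{i_0\dots i_k}:\Omega_n\to\mathbb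 K$ is integration over the $k$-chain spanned by the vertices $(e_{i_0},\dots,e_{i_k})$: pull back to $\Omega_k$ along the affine map sending the $p$-th vertex to $e_{i_p}$, then apply $t_1^{a_1}\cdots t_k^{a_k}dt_1\cdots dt_k\mapsto a_1!\cdots a_k!/(a_1+\dots+a_k+k)!$ (zero on forms of degree $\ne k$). Put $\omega_{i_0\dots i_k}=k!\sum_{j=0}^k(-1)^jt_{i_j}dt_{i_0}\cdots\widehat{dt_{i_j}}\cdots dt_{i_k}$ and $P_n\omega=\sum_{k=0}^n\sum_{i_0<\dots<i_k}\omega_{i_0\dots i_k}I_{i_0\dots i_k}(\omega)$. A contraction is a family of $\mathbb K$-linear maps $s_n:\Omega_n^*\to\Omega_n^{*-1}$, compatible with all simplicial operators, with $\mathrm{id}-P_n=ds_n+s_nd$. A gauge is a contraction with $s_n^2=0$ for all $n$. The maps $s_n$ and $I_{i_0\dots i_k}$ are extended to $\mathfrak g\otimes\Omega_n$ by acting on the second factor. Definition of $\gamma_\bullet$. $\gamma_n(\mathfrak g)=\{\alpha\in\mathrm{MC}_n(\mathfrak g)\mid s_n\alpha=0\}$, a simplicial subset of $\mathrm{MC}_\bullet(\mathfrak g)$. For $n>0$, an $n$-simplex $\alpha\in\gamma_n(\mathfrak g)$ is thin if $I_{0\dots n}(\alpha)=0$. Higher groupoids. A horn in a simplicial set $X_\bullet$ is a simplicial map $\Lambda^n_i\to X_\bullet$ ($n>0$, $0\le i\le n$), where $\Lambda^n_i\subset\Delta^n$ is the union of all faces except the $i$-th. An $\infty$-groupoid is a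 simplicial set $X_\bullet$ with subsets $T_n\subset X_n$ of thin simplices, $n>0$, such that (1) every degenerate simplex is thin; (2) every horn has a unique thin filler. It is an $\ell$-groupoid if moreover (3) every $n$-simplex with $n>\ell$ is thin, and an $\ell$-group if in addition it is reduced (has exactly one $0$-simplex). *)

(* Defs.v *)
From HB Require Import structures.
From mathcomp Require Import all_boot all_order all_fingroup all_algebra.
From mathcomp Require Import finmap.
From mathcomp Require Import -(notations) monalg.
From mathcomp Require Import mpoly.

Set Implicit Arguments.
Unset Strict Implicit.
Unset Printing Implicit Defensive.

Import GRing.Theory.
Local Open Scope ring_scope.

(* [finsum B V] is the type of finitely supported functions from [B] to [V]. The
   notations of [monalg] for it clash with those of [mpoly] for polynomials. *)
Notation finsum B V := (monalg.malg B V).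
Notation fsingle b x := (monalg.mkmalgU b x).
Notation fcoef u b := (monalg.mcoeff b u).
Notation fsupp u := (monalg.msupp u).

(** * L-infinity algebras *)

(* A graded vector space is given by its total space and the map [hcomp]
   sending a vector to the family of its homogeneous components. [br s] is the
   bracket of the nonempty list of arguments [s]; [br [::]] is never used. *)
Record linfData (K : fieldType) := LinfData {
  lcar :> lmodType K;
  hcomp : lcar -> finsum int lcar;
  br : seq lcar -> lcar
}.
Arguments hcomp {K l} _.
Arguments br {K l} _.

Section LInfinity.
Variable K : fieldType.
Implicit Type g : linfData K.

Definition hasdeg g (i : int) (x : g) : Prop := fcoef (hcomp x) i = x.

(* [s] is increasing on the first [k] indices and on the remaining ones. *)
Definition unshuffle n (k : nat) (s : 'S_n) : bool :=
  [forall i : 'I_n, forall j : 'I_n,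
     (i < j)%N && ((j < k)%N || (k <= i)%N) ==> (s i < s j)%N].

(* Koszul sign of (x_0, ..., x_(n-1)) |-> (x_(s 0), ..., x_(s (n-1))) for
   elements [x_i] of degree [d i]. *)
Definition koszul n (d : 'I_n -> int) (s : 'S_n) : K :=
  \prod_(i < n) \prod_(j < n | (i < j)%N && (s j < s i)%N)
    (-1) ^ (d (s i) * d (s j)).

Record isLinf g : Prop := IsLinf {
  linf_hcomp_linear : forall i (a : K) (x y : g),
    fcoef (hcomp (a *: x + y)) i = a *: fcoef (hcomp x) i + fcoef (hcomp y) i;
  linf_hcompK : forall i j (x : g),
    fcoef (hcomp (fcoef (hcomp x) i)) j =
      if i == j then fcoef (hcomp x) i else 0;
  linf_hcomp_sum : forall x : g,
    \sum_(i <- fsupp (hcomp x)) fcoef (hcomp x) i = x;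
  linf_multilinear : forall (s1 s2 : seq g) (a : K) (x y : g),
    br (s1 ++ (a *: x + y) :: s2) =
      a *: br (s1 ++ x :: s2) + br (s1 ++ y :: s2);
  linf_degree : forall n (d : 'I_n -> int) (x : 'I_n -> g), (0 < n)%N ->
    (forall i, hasdeg (d i) (x i)) ->
    hasdeg (\sum_(i < n) d i + 2 - n%:Z) (br [seq x i | i <- enum 'I_n]);
  linf_antisym : forall (s1 s2 : seq g) (p q : int) (x y : g),
    hasdeg p x -> hasdeg q y ->
    br (s1 ++ x :: y :: s2) + (-1) ^ (p * q) *: br (s1 ++ y :: x :: s2) = 0;
  linf_jacobi : forall n (d : 'I_n -> int) (x : 'I_n -> g), (0 < n)%N ->
    (forall i, hasdeg (d i) (x i)) ->
    \sum_(1 <= k < n.+1) (-1) ^+ k *: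
      \sum_(s : 'S_n | unshuffle k s) ((-1) ^+ s * koszul d s) *:
        br (br [seq x (s i) | i <- take k (enum 'I_n)]
              :: [seq x (s i) | i <- drop k (enum 'I_n)]) = 0
}.

(* [lcf i x] means that [x] lies in the i-th term of the lower central
   filtration, for i > 0. *)
Inductive lcf g : nat -> g -> Prop :=
| lcf1 x : lcf 1 x
| lcf_br k (i : 'I_k -> nat) (x : 'I_k -> g) :
    (1 < k)%N -> (forall j, 0 < i j)%N -> (forall j, lcf (i j) (x j)) ->
    lcf (\sum_(j < k) i j)%N (br [seq x j | j <- enum 'I_k])
| lcf0 i : (1 < i)%N -> lcf i 0
| lcf_lin i (a : K) x y : (1 < i)%N -> lcf i x -> lcf i y -> lcf i (a *: x + y).

Definition nilpotent g : Prop :=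
  exists N, forall i (x : g), (N <= i)%N -> lcf i x -> x = 0.

(* For nilpotent [g] the terms of the Maurer-Cartan series vanish from some
   index [N] on, and its value is the sum of the terms before [N]. *)
Definition MC g (x : g) : Prop :=
  hasdeg 1 x /\
  exists N, (forall l, (N <= l)%N -> br (nseq l x) = 0) /\
    \sum_(1 <= l < N) (l`!%:R : K)^-1 *: br (nseq l x) = 0.

End LInfinity.

(** * Polynomial forms on simplices *)

(* Forms on the n-simplex are written in the coordinates t_1, ..., t_n, using
   the relations to eliminate t_0 = 1 - t_1 - ... - t_n and
   dt_0 = - dt_1 - ... - dt_n. The coefficient of dt_(i_1) ... dt_(i_k) in [a],
   for i_1 < ... < i_k, is [a S] with S = {i_1, ..., i_k}; the index [j : 'I_n]
   stands for the vertex [lift ord0 j]. *)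
Notation Omega K n := {ffun {set 'I_n} -> {mpoly K[n]}}.

Section Forms.
Variable K : fieldType.

Definition fmon n (S : {set 'I_n}) (p : {mpoly K[n]}) : Omega K n :=
  [ffun U : {set _} => if U == S then p else 0].

Definition fscal n (p : {mpoly K[n]}) : Omega K n := fmon set0 p.

(* dt_S dt_T is [shsign S T] times the monomial of the union of [S] and [T],
   for disjoint [S] and [T]. *)
Definition shsign n (S T : {set 'I_n}) : K :=
  (-1) ^+ #|[set p : 'I_n * 'I_n | [&& p.1 \in S, p.2 \in T & (p.2 < p.1)%N]]|.

Definition fmul n (a b : Omega K n) : Omega K n :=
  [ffun U : {set _} => \sum_(S : {set 'I_n} | S \subset U)
               shsign S (U :\: S) *: (a S * b (U :\: S))].

Definition fprod n (s : seq (Omega K n)) : Omega K n :=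
  foldr (@fmul n) (fscal 1) s.

Definition fdiff n (a : Omega K n) : Omega K n :=
  \sum_(i < n) fmul (fmon [set i] 1) [ffun S : {set _} => mderiv i (a S)].

Definition fdeg n (k : int) (a : Omega K n) : Prop :=
  forall S : {set 'I_n}, a S != 0 -> #|S|%:Z = k.

Definition tpoly n (i : 'I_n.+1) : {mpoly K[n]} :=
  if unlift ord0 i is Some j then 'X_j else 1 - \sum_(j < n) 'X_j.

Lemma tpoly_sum n : \sum_i @tpoly n i = 1.
Proof.
rewrite big_ord_recl {1}/tpoly unlift_none.
rewrite [X in _ + X](eq_bigr (fun j => 'X_j)) ?subrK // => j _.
by rewrite /tpoly liftK.
Qed.

Definition tform n (i : 'I_n.+1) : Omega K n := fscal (tpoly i).
Definition dtform n (i : 'I_n.+1) : Omega K n := fdiff (tform i).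

Lemma dtform_sum n : \sum_i @dtform n i = 0.
Proof.
have E (i : 'I_n.+1) U : dtform i U =
    \sum_(k < n) if k \in U then
      shsign [set k] (U :\: [set k]) *: (if U :\: [set k] == set0 then
                                            mderiv k (tpoly i) else 0) else 0.
  rewrite /dtform /fdiff sum_ffunE; apply: eq_bigr => k _; rewrite ffunE.
  case: ifP => kU.
    rewrite (bigD1 [set k]) ?sub1set //= big1 ?addr0 => [|S /andP[_ nS]].
      by rewrite !ffunE eqxx mul1r; case: ifP => //; rewrite mderiv0.
    by rewrite ffunE (negPf nS) mul0r scaler0.
  rewrite big1 // => S SU; rewrite !ffunE; case: eqP => [eS|_].
    by rewrite eS sub1set kU in SU.
  by rewrite mul0r scaler0.
apply/ffunP => U; rewrite sum_ffunE ffunE.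
under eq_bigr => i _ do rewrite E.
rewrite exchange_big; apply: big1 => k _; case: (k \in U); last exact: big1_eq.
rewrite -scaler_sumr; case: (_ == set0); last by rewrite big1_eq scaler0.
by rewrite -raddf_sum tpoly_sum -mpolyC1 /= mderivC scaler0.
Qed.

Definition tpull k n (f : 'I_k.+1 -> 'I_n.+1) (i : 'I_n.+1) : {mpoly K[k]} :=
  \sum_(j < k.+1 | f j == i) tpoly j.

(* Pullback along the affine map sending the vertex [j] to the vertex [f j],
   for an arbitrary map [f]: the morphism of dg algebras with
   t_i |-> [tpull f i]. *)
Definition fpull k n (f : 'I_k.+1 -> 'I_n.+1) (a : Omega K n) : Omega K k :=
  \sum_(S : {set 'I_n})
    fmul (fscal (a S \mPo [tuple tpull f (lift ord0 j) | j < n]))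
         (fprod [seq fdiff (fscal (tpull f (lift ord0 j))) | j <- enum S]).

Definition fint k (a : Omega K k) : K :=
  \sum_(m <- msupp (a setT))
    (a setT)@_m * (\prod_(i < k) (m i)`!)%N%:R / ((mdeg m + k)`!)%:R.

Definition fI k n (i : 'I_k.+1 -> 'I_n.+1) (a : Omega K n) : K :=
  fint (fpull i a).

Definition whitney k n (i : 'I_k.+1 -> 'I_n.+1) : Omega K n :=
  (k`!)%:R *: \sum_(j < k.+1) (-1) ^+ j *:
    fmul (tform (i j)) (fprod [seq dtform (i p) | p <- enum 'I_k.+1 & p != j]).

Definition whitneyP n (a : Omega K n) : Omega K n :=
  \sum_(k < n.+1)
    \sum_(i : {ffun 'I_k.+1 -> 'I_n.+1} |
            [forall p : 'I_k.+1, forall q : 'I_k.+1, (p < q)%N ==> (i p < i q)%N])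
      fI i a *: whitney i.

End Forms.

(** * Gauges *)

Definition monotone k n (f : {ffun 'I_k.+1 -> 'I_n.+1}) : bool :=
  [forall i : 'I_k.+1, forall j : 'I_k.+1, (i <= j)%N ==> (f i <= f j)%N].

Record contraction (K : fieldType) (s : forall n, Omega K n -> Omega K n) :
  Prop := Contraction {
  contr_linear : forall n (c : K) (a b : Omega K n),
    s n (c *: a + b) = c *: s n a + s n b;
  contr_degree : forall n k (a : Omega K n), fdeg k a -> fdeg (k - 1) (s n a);
  contr_simplicial : forall k n (f : {ffun 'I_k.+1 -> 'I_n.+1}) (a : Omega K n),
    monotone f -> s k (fpull f a) = fpull f (s n a);
  contr_homotopy : forall n (a : Omega K n),
    a - whitneyP a = fdiff (s n a) + s n (fdiff a)
}.

Definition gauge (K : fieldType) (s : forall n, Omega K n -> Omega K n) : Prop :=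
  contraction s /\ forall n (a : Omega K n), s n (s n a) = 0.

(** * Forms with coefficients in an L-infinity algebra *)

(* The tensor product of [V] with the vector space with basis [B]: a finitely
   supported function [u] stands for the sum of the (u b) (x) b. *)
Definition btens (K : fieldType) (V : lmodType K) (B : choiceType) : Type :=
  finsum B V.

Section BasisTensor.
Variables (K : fieldType) (V : lmodType K) (B : choiceType).

HB.instance Definition _ := GRing.Zmodule.copy (btens V B) (finsum B V).

Implicit Types (u v : btens V B).

Definition bscale (c : K) u : btens V B :=
  \sum_(b <- fsupp u) fsingle b (c *: fcoef u b).

Lemma bscaleE c u b : fcoef (bscale c u) b = c *: fcoef u b.
Proof.
rewrite [in RHS](monalg.monalgE u) /bscale !raddf_sum /=.
by apply: eq_bigr => i _; rewrite !monalg.mcoeffU scalerMnr.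
Qed.

Lemma bscaleA c1 c2 u : bscale c1 (bscale c2 u) = bscale (c1 * c2) u.
Proof. by apply/monalg.malgP => b; rewrite !bscaleE scalerA. Qed.

Lemma bscale1 : left_id 1 bscale.
Proof. by move=> u; apply/monalg.malgP => b; rewrite bscaleE scale1r. Qed.

Lemma bscaleDr : right_distributive bscale +%R.
Proof.
by move=> c u v; apply/monalg.malgP => b; rewrite !(monalg.mcoeffD, bscaleE) scalerDr.
Qed.

Lemma bscaleDl u : {morph bscale^~ u : c1 c2 / c1 + c2}.
Proof.
by move=> c1 c2; apply/monalg.malgP => b; rewrite !(monalg.mcoeffD, bscaleE) scalerDl.
Qed.

HB.instance Definition _ := GRing.Zmodule_isLmodule.Build K (btens V B)
  bscaleA bscale1 bscaleDr bscaleDl.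

End BasisTensor.

(* The monomials t^m dt_S form a basis of the space of forms. *)
Definition formB n : choiceType := ('X_{1..n} * {set 'I_n})%type.

Definition fbase (K : fieldType) n (b : formB n) : Omega K n :=
  fmon b.2 'X_[b.1].

Section FormTensor.
Variables (K : fieldType) (g : linfData K).

Notation gforms n := (btens g (formB n)).

Definition tens n (x : g) (a : Omega K n) : gforms n :=
  \sum_(S : {set 'I_n}) \sum_(m <- msupp (a S)) fsingle (m, S) ((a S)@_m *: x).

(* The homogeneous components of the terms of [u], with their degrees. *)
Definition texpand n (u : gforms n) : seq (int * g * formB n) :=
  [seq (i, fcoef (hcomp (fcoef u b)) i, b)
     | b <- fsupp u, i <- fsupp (hcomp (fcoef u b))].

Definition tcomp n (u : gforms n) : finsum int (gforms n) :=
  \sum_(t <- texpand u)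
    fsingle (t.1.1 + #|t.2.2|%:Z) (fsingle t.2 t.1.2 : gforms n).

(* The sum over i < j of |a_i| |x_j|. *)
Fixpoint tsign n (c : seq (int * g * formB n)) : int :=
  if c is t :: c' then #|t.2.2|%:Z * (\sum_(t' <- c') t'.1.1) + tsign c' else 0.

(* The bracket of x_1 (x) a_1, ..., x_k (x) a_k for homogeneous [x_i] and
   monomial forms [a_i]. *)
Definition tbr1 n (c : seq (int * g * formB n)) : gforms n :=
  if c is [:: (i, x, b)] then
    tens (br [:: x]) (fbase K b) + (-1) ^ i *: tens x (fdiff (fbase K b))
  else
    (-1) ^ tsign c *:
      tens (br [seq t.1.2 | t <- c]) (fprod [seq fbase K t.2 | t <- c]).

Definition cartesian (A : Type) (ss : seq (seq A)) : seq (seq A) :=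
  foldr (fun s r => [seq x :: c | x <- s, c <- r]) [:: [::]] ss.

(* The multilinear extension of [tbr1]. *)
Definition tbr n (us : seq (gforms n)) : gforms n :=
  \sum_(c <- cartesian [seq texpand u | u <- us]) tbr1 c.

Definition tensLinf n : linfData K :=
  @LinfData K (gforms n) (@tcomp n) (@tbr n).

(* A linear map on forms, or a linear functional, acting on the second factor. *)
Definition tmap n k (f : Omega K n -> Omega K k) (u : gforms n) : gforms k :=
  \sum_(b <- fsupp u) tens (fcoef u b) (f (fbase K b)).

Definition teval n (I : Omega K n -> K) (u : gforms n) : g :=
  \sum_(b <- fsupp u) I (fbase K b) *: fcoef u b.

End FormTensor.

(** * Higher groupoids *)

(* A simplicial set presented as a family of subsets [smem] of ambient sets;
   only the action of monotone maps on the elements of [smem] matters. *)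
Record sdata := SData {
  sobj :> nat -> Type;
  sact : forall k n, {ffun 'I_k.+1 -> 'I_n.+1} -> sobj n -> sobj k;
  smem : forall n, sobj n -> Prop
}.
Arguments sact _ {k n} _ _.
Arguments smem _ {n} _.

Definition fcompose l k n (f : {ffun 'I_k.+1 -> 'I_n.+1})
    (h : {ffun 'I_l.+1 -> 'I_k.+1}) : {ffun 'I_l.+1 -> 'I_n.+1} :=
  [ffun i => f (h i)].

Record isSSet (X : sdata) : Prop := IsSSet {
  sset_act : forall k n (f : {ffun 'I_k.+1 -> 'I_n.+1}) (x : X n),
    monotone f -> smem X x -> smem X (sact X f x);
  sset_id : forall n (x : X n), smem X x -> sact X [ffun i : 'I_n.+1 => i] x = x;
  sset_comp : forall l k n (f : {ffun 'I_k.+1 -> 'I_n.+1})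
      (h : {ffun 'I_l.+1 -> 'I_k.+1}) (x : X n),
    monotone f -> monotone h -> smem X x ->
    sact X (fcompose f h) x = sact X h (sact X f x)
}.

Definition degenerate (X : sdata) n (x : X n) : Prop :=
  exists k (f : {ffun 'I_n.+1 -> 'I_k.+1}) (y : X k),
    [/\ (k < n)%N, monotone f, (forall j, exists i, f i = j),
        smem X y & x = sact X f y].

(* The k-simplices of the i-th horn of the n-simplex: those lying in the face
   opposite to some vertex [j] other than [i]. *)
Definition inHorn n (i : 'I_n.+1) k (f : {ffun 'I_k.+1 -> 'I_n.+1}) : bool :=
  monotone f && [exists j, (j != i) && (j \notin codom f)].

Record horn (X : sdata) n (i : 'I_n.+1) := Horn {
  hmap :> forall k (f : {ffun 'I_k.+1 -> 'I_n.+1}), inHorn i f -> X k;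
  horn_mem : forall k (f : {ffun 'I_k.+1 -> 'I_n.+1}) (hf : inHorn i f),
    smem X (hmap hf);
  horn_nat : forall l k (f : {ffun 'I_k.+1 -> 'I_n.+1})
      (h : {ffun 'I_l.+1 -> 'I_k.+1})
      (hf : inHorn i f) (hfh : inHorn i (fcompose f h)),
    monotone h -> hmap hfh = sact X h (hmap hf)
}.

Definition fills (X : sdata) n (i : 'I_n.+1) (phi : horn X i) (x : X n) : Prop :=
  forall k (f : {ffun 'I_k.+1 -> 'I_n.+1}) (hf : inHorn i f),
    sact X f x = phi k f hf.

(* Only the thin simplices of positive dimension are relevant. *)
Record isInftyGroupoid (X : sdata) (thin : forall n, X n -> Prop) : Prop :=
  IsInftyGroupoid {
  igpd_sset : isSSet X;
  igpd_thin : forall n (x : X n), (0 < n)%N -> thin n x -> smem X x;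
  igpd_degenerate : forall n (x : X n), (0 < n)%N -> degenerate x -> thin n x;
  igpd_horn : forall n (i : 'I_n.+1) (phi : horn X i), (0 < n)%N ->
    exists! x : X n, thin n x /\ fills phi x
}.

Definition isLGroupoid (l : nat) (X : sdata) (thin : forall n, X n -> Prop) : Prop :=
  isInftyGroupoid thin /\
  forall n (x : X n), (0 < n)%N -> (l < n)%N -> smem X x -> thin n x.

Definition isLGroup (l : nat) (X : sdata) (thin : forall n, X n -> Prop) : Prop :=
  isLGroupoid l thin /\ exists! x : X 0%N, smem X x.

(** * The simplicial set gamma *)

Section Gamma.
Variables (K : fieldType) (s : forall n, Omega K n -> Omega K n).
Variable (g : linfData K).

Definition gamma : sdata :=
  @SData (tensLinf g)
    (fun k n f => tmap (fpull f))
    (fun n u => @MC K (tensLinf g n) u /\ tmap (@s n) u = 0).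

Definition gammaThin n (u : gamma n) : Prop :=
  smem gamma u /\ teval (fI (fun i : 'I_n.+1 => i)) u = 0.

End Gamma.

(* Main.v *)
(* Let h be the homotopy on forms on the n-simplex obtained from s_n by adding the multiple of
   the Whitney form of the i-th face that is given by the integral over the n-simplex. A simplex
   of gamma is thin if and only if it is killed by h, and h is a contraction of the complex of
   forms vanishing on the horn of index i. Hence the Maurer-Cartan elements killed by h are
   fixed points of u = R u - h Q(u), where R = id - dh - hd only depends on the restriction of u
   to the horn and Q is the sum of the brackets with at least two entries. As g is nilpotent,
   such an equation has a unique solution, which gives uniqueness of thin fillers. Conversely,
   extend the horn to an arbitrary E and solve u = R E - h Q(u): the faces of u solve the
   corresponding equations for s_(n-1), so they are those of the horn, and the Bianchi identity
   shows that the curvature of u, which vanishes on the horn, is zero. *)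
From HB Require Import structures.
Require Import Defs.
From mathcomp Require Import all_boot all_order all_fingroup all_algebra.
From mathcomp Require Import finmap.
From mathcomp Require Import -(notations) monalg.
From mathcomp Require Import mpoly.
From mathcomp Require Import zify ring.

Set Implicit Arguments.
Unset Strict Implicit.
Unset Printing Implicit Defensive.

Import Defs Order.TTheory GRing.Theory Num.Theory.
Local Open Scope ring_scope.

(** The unary bracket of [g] need not be nilpotent, so no filtration argument absorbs it; it is
    therefore separated from the form differential ([tbr0] against [tdiff]). It acts on coefficients
    only, hence commutes with the action of any linear map on forms and drops out once h u = 0. What
    remains in Q raises the lower central filtration by one, which makes the fixed-point map
    contracting.

    The term added to s_n is forced. On forms vanishing on the horn, id - (ds + sd) is the Whitney
    projection, of which only two terms survive: that of the simplex and that of its i-th face.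
    Their Whitney forms W and w satisfy dw = (-1)^i W, so adding (-1)^i w times the integral
    produces one of these terms through d and the other through Stokes. The identities hh = 0 and
    hdh = h give hR = 0, so that solutions are automatically killed by h.

    Since the differential of a tensor of x and a carries the sign (-1)^|x|, homotopies act on
    tensors with a parity twist, [fsignop]. *)

Lemma lin_sum (K : fieldType) (U V : lmodType K) (f : U -> V) (I : Type) (r : seq I)
    (P : pred I) (F : I -> U) :
  linear f -> f (\sum_(i <- r | P i) F i) = \sum_(i <- r | P i) f (F i).
Proof.
move=> lf; have f0 : f 0 = 0.
  by have := lf (-1) 0 0; rewrite scaler0 add0r scaleN1r addNr.
elim: r => [|i r IH]; first by rewrite !big_nil.
rewrite !big_cons; case: (P i) => //.
by rewrite -{1}(scale1r (F i)) lf scale1r IH.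
Qed.

Section LinearPred.
Variables (K : fieldType) (U V : lmodType K) (f : U -> V).
Hypothesis lf : linear f.

Lemma lin0 : f 0 = 0.
Proof. by have := lf (-1) 0 0; rewrite scaler0 add0r scaleN1r addNr. Qed.

Lemma linZ c u : f (c *: u) = c *: f u.
Proof. by rewrite -[c *: u]addr0 lf lin0 addr0. Qed.

Lemma linD u v : f (u + v) = f u + f v.
Proof. by rewrite -{1}[u]scale1r lf scale1r. Qed.

Lemma linN u : f (- u) = - f u.
Proof. by rewrite -scaleN1r linZ scaleN1r. Qed.

Lemma linB u v : f (u - v) = f u - f v.
Proof. by rewrite linD linN. Qed.
End LinearPred.

Lemma lin_comp (K : fieldType) (U V W : lmodType K) (f : V -> W) (h : U -> V) :
  linear f -> linear h -> linear (f \o h).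
Proof. by move=> lf lh c u v /=; rewrite lh lf. Qed.

(** * The graded commutative algebra of forms *)

Section FormAlgebra.
Variables (K : fieldType) (n : nat).
Implicit Types (a b c : Omega K n) (S T U : {set 'I_n}) (p q : {mpoly K[n]}).

Lemma shsignE S T :
  @shsign K n S T = (-1) ^+ (\sum_(p in S) \sum_(q in T) (q < p)%N)%N.
Proof.
rewrite /shsign; congr (_ ^+ _).
rewrite pair_big_dep /= -sum1_card big_mkcond /=.
rewrite [RHS]big_mkcond /=; apply: eq_bigr => -[i j] _ /=.
by rewrite inE /=; case: (i \in S); case: (j \in T); case: (j < i)%N.
Qed.

Lemma shsignUl S T U : [disjoint S & T] ->
  shsign K (S :|: T) U = shsign K S U * shsign K T U.
Proof.
move=> dST; rewrite !shsignE -exprD; congr (_ ^+ _).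
rewrite (eq_bigl [predU S & T]) ?bigU // => i.
by rewrite !inE.
Qed.

Lemma shsignUr S T U : [disjoint T & U] ->
  shsign K S (T :|: U) = shsign K S T * shsign K S U.
Proof.
move=> dTU; rewrite !shsignE -exprD; congr (_ ^+ _).
rewrite -big_split /=; apply: eq_bigr => i _.
rewrite (eq_bigl [predU T & U]) ?bigU // => j.
by rewrite !inE.
Qed.

Lemma shsign0l S : shsign K set0 S = 1.
Proof. by rewrite shsignE big_set0. Qed.

Lemma shsign0r S : shsign K S set0 = 1.
Proof. by rewrite shsignE big1 // => i _; rewrite big_set0. Qed.

(** A pair made of an index of [S] and one of [T] is an inversion in exactly one of the two orders,
    so the two exponents add up to [#|S| * #|T|]. *)
Lemma shsignC S T : [disjoint S & T] ->
  shsign K S T = (-1) ^+ (#|S| * #|T|) * shsign K T S.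
Proof.
move=> dST; rewrite !shsignE.
have -> : (#|S| * #|T| = \sum_(p in S) \sum_(q in T) (q < p)%N
            + \sum_(p in T) \sum_(q in S) (q < p)%N)%N.
  rewrite [X in (_ + X)%N]exchange_big -big_split /= -sum_nat_const.
  apply: eq_bigr => i iS; rewrite -big_split /= -sum1_card; apply: eq_bigr => j jT.
  have : i != j by apply: contraTneq iS => ->; rewrite (disjointFl dST).
  by rewrite neq_ltn; case: ltngtP.
by rewrite exprD -mulrA -expr2 sqrr_sign mulr1.
Qed.

Lemma fmonE S p U : fmon S p U = if U == S then p else 0.
Proof. by rewrite ffunE. Qed.

Lemma form_fmon a : a = \sum_(S : {set 'I_n}) fmon S (a S).
Proof.
apply/ffunP => U; rewrite sum_ffunE (bigD1 U) //= fmonE eqxx big1 ?addr0 //.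
by move=> S /negPf nS; rewrite fmonE eq_sym nS.
Qed.

Lemma fmon_linear S : linear (@fmon K n S).
Proof.
move=> c p q; apply/ffunP => U; rewrite !ffunE.
by case: ifP; rewrite // scaler0 addr0.
Qed.

Lemma fmon0 S : fmon S 0 = 0 :> Omega K n.
Proof. exact: lin0 (@fmon_linear S). Qed.

Lemma fscal_linear : linear (@fscal K n).
Proof. exact: fmon_linear. Qed.

Lemma fscal0 : fscal 0 = 0 :> Omega K n.
Proof. exact: fmon0. Qed.

Lemma fmulE a b U : fmul a b U = \sum_(S : {set 'I_n} | S \subset U)
               shsign K S (U :\: S) *: (a S * b (U :\: S)).
Proof. by rewrite ffunE. Qed.

Lemma fmul_linearl b : linear (fun a => fmul a b).
Proof.
move=> c a a'; apply/ffunP => U; rewrite !(ffunE, fmulE) scaler_sumr -big_split.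
apply: eq_bigr => S _; rewrite !ffunE mulrDl scalerDr -scalerAl.
by rewrite [X in X + _]scalerA [in RHS]scalerA [c * _]mulrC.
Qed.

Lemma fmul_linearr a : linear (fun b => fmul a b).
Proof.
move=> c b b'; apply/ffunP => U; rewrite !(ffunE, fmulE) scaler_sumr -big_split.
apply: eq_bigr => S _; rewrite !ffunE mulrDr scalerDr -scalerAr.
by rewrite [X in X + _]scalerA [in RHS]scalerA [c * _]mulrC.
Qed.

Lemma fmul_fmon S T p q : fmul (fmon S p) (fmon T q) =
  if [disjoint S & T] then fmon (S :|: T) (shsign K S T *: (p * q)) else 0.
Proof.
apply/ffunP => U; rewrite fmulE.
case: (boolP (S \subset U)) => [sSU|nSU]; last first.
  rewrite big1 => [|V sVU]; last first.
    rewrite fmonE; case: eqP => [e|_]; first by rewrite -e sVU in nSU.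
    by rewrite mul0r scaler0.
  case: ifP => [_|]; rewrite ffunE //.
  by case: eqP => // e; rewrite e subsetUl in nSU.
rewrite (bigD1 S) //= big1 ?addr0 => [|V /andP[_ /negPf nV]]; last first.
  by rewrite fmonE nV mul0r scaler0.
rewrite !fmonE eqxx; case: (boolP [disjoint S & T]) => dST.
  rewrite fmonE; have <- : (U :\: S == T) = (U == S :|: T).
    apply/eqP/eqP => [<-|->]; first by rewrite setDE setUIr setUCr setIT; apply/esym/setUidPr.
    rewrite setDUl setDv set0U; apply/setDidPl; by rewrite disjoint_sym.
  case: eqP => [->//|]; by rewrite mulr0 scaler0.
rewrite ffunE; case: eqP => [e|]; last by rewrite mulr0 scaler0.
case/negP: dST; rewrite -e -setI_eq0; apply/eqP/setP => i; rewrite !inE.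
by case: (i \in S).
Qed.

Lemma fmul_sumr I (r : seq I) (P : pred I) (F : I -> Omega K n) a :
  fmul a (\sum_(i <- r | P i) F i) = \sum_(i <- r | P i) fmul a (F i).
Proof. exact: (lin_sum _ _ _ (@fmul_linearr a)). Qed.

Lemma fmul_suml I (r : seq I) (P : pred I) (F : I -> Omega K n) a :
  fmul (\sum_(i <- r | P i) F i) a = \sum_(i <- r | P i) fmul (F i) a.
Proof. exact: (lin_sum _ _ _ (@fmul_linearl a)). Qed.

Lemma fmul0r a : fmul a 0 = 0. Proof. exact: lin0 (@fmul_linearr a). Qed.
Lemma fmul0l a : fmul 0 a = 0. Proof. exact: lin0 (@fmul_linearl a). Qed.
Lemma fmulDr a b c : fmul a (b + c) = fmul a b + fmul a c.
Proof. exact: linD (@fmul_linearr a) b c. Qed.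
Lemma fmulDl a b c : fmul (b + c) a = fmul b a + fmul c a.
Proof. exact: linD (@fmul_linearl a) b c. Qed.
Lemma fmulZr x a b : fmul a (x *: b) = x *: fmul a b.
Proof. exact: linZ (@fmul_linearr a) x b. Qed.
Lemma fmulZl x a b : fmul (x *: a) b = x *: fmul a b.
Proof. exact: linZ (@fmul_linearl b) x a. Qed.
Lemma fmulNl a b : fmul (- a) b = - fmul a b.
Proof. exact: linN (@fmul_linearl b) a. Qed.

Lemma fmul_fmonA S T U p q r :
  fmul (fmul (fmon S p) (fmon T q)) (fmon U r) =
  fmul (fmon S p) (fmul (fmon T q) (fmon U r)) :> Omega K n.
Proof.
rewrite !fmul_fmon.
case dST : [disjoint S & T]; case dTU : [disjoint T & U]; rewrite ?fmul0l ?fmul0r // !fmul_fmon.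
- have -> : [disjoint S :|: T & U] = [disjoint S & U].
    by rewrite -!setI_eq0 setIUl; move: dTU; rewrite -setI_eq0 => /eqP->; rewrite setU0.
  have -> : [disjoint S & T :|: U] = [disjoint S & U].
    by rewrite -!setI_eq0 setIUr; move: dST; rewrite -setI_eq0 => /eqP->; rewrite set0U.
  case: ifP => // dSU; rewrite setUA shsignUl // shsignUr //.
  by rewrite -scalerAl -scalerAr !scalerA mulrA; congr fmon; congr (_ *: _); ring.
- rewrite ifF //; apply/negP => d.
  suff : false by []. rewrite -dTU; apply: disjointWl d; exact: subsetUr.
- rewrite ifF //; apply/negP => d.
  suff : false by []. rewrite -dST; apply: disjointWr d; exact: subsetUl.
Qed.

Lemma fmulA a b c : fmul a (fmul b c) = fmul (fmul a b) c.
Proof.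
rewrite (form_fmon a) !fmul_suml; apply: eq_bigr => S _.
rewrite (form_fmon b) fmul_suml !fmul_sumr fmul_suml; apply: eq_bigr => T _.
rewrite (form_fmon c) !fmul_sumr; apply: eq_bigr => U _.
by rewrite fmul_fmonA.
Qed.

Lemma fscal_fmon p S q : fmul (fscal p) (fmon S q) = fmon S (p * q).
Proof. by rewrite fmul_fmon -setI_eq0 set0I eqxx set0U shsign0l scale1r. Qed.

Lemma fmon_fscal p S q : fmul (fmon S q) (fscal p) = fmon S (p * q).
Proof. by rewrite fmul_fmon -setI_eq0 setI0 eqxx setU0 shsign0r scale1r mulrC. Qed.

Lemma fscalE p a : fmul (fscal p) a = [ffun S : {set 'I_n} => p * a S].
Proof.
rewrite (form_fmon a) fmul_sumr; apply/ffunP => U; rewrite !ffunE !sum_ffunE mulr_sumr.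
by apply: eq_bigr => S _; rewrite fscal_fmon !fmonE; case: ifP; rewrite ?mulr0.
Qed.

Lemma fscal_comm p a : fmul a (fscal p) = fmul (fscal p) a.
Proof.
rewrite (form_fmon a) fmul_suml fmul_sumr; apply: eq_bigr => S _.
by rewrite fmon_fscal fscal_fmon.
Qed.

Lemma fmul1l a : fmul (fscal 1) a = a.
Proof. by rewrite fscalE; apply/ffunP => S; rewrite ffunE mul1r. Qed.

Lemma fmul1r a : fmul a (fscal 1) = a.
Proof. by rewrite fscal_comm fmul1l. Qed.

Lemma fscalM p q : fscal (p * q) = fmul (fscal p) (fscal q) :> Omega K n.
Proof. by rewrite fscal_fmon. Qed.

Lemma fprod_cat (s t : seq (Omega K n)) : fprod (s ++ t) = fmul (fprod s) (fprod t).
Proof. by elim: s => [|a s IH] /=; rewrite ?fmul1l // -fmulA; congr fmul. Qed.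

Lemma fdegP k a : fdeg k a <-> forall S, #|S|%:Z != k -> a S = 0.
Proof.
split=> [h S nS|h S aS]; first by apply/eqP; apply: contraNT nS => /h ->.
by apply/eqP; apply: contraNT aS => /h ->.
Qed.

Lemma fdeg0 k : fdeg k (0 : Omega K n).
Proof. by move=> S; rewrite ffunE eqxx. Qed.

Lemma fdegD k a b : fdeg k a -> fdeg k b -> fdeg k (a + b).
Proof. by move=> /fdegP ha /fdegP hb; apply/fdegP => S nS; rewrite ffunE ha ?hb ?addr0. Qed.

Lemma fdegZ k x a : fdeg k a -> fdeg k (x *: a).
Proof. by move=> /fdegP ha; apply/fdegP => S nS; rewrite ffunE ha ?scaler0. Qed.

Lemma fdeg_sum k I (r : seq I) (P : pred I) (F : I -> Omega K n) :
  (forall i, P i -> fdeg k (F i)) -> fdeg k (\sum_(i <- r | P i) F i).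
Proof. by move=> h; apply: big_ind => //; [exact: fdeg0|exact: fdegD]. Qed.

Lemma fdeg_fmon S p : fdeg #|S|%:Z (fmon S p).
Proof. by move=> T; rewrite fmonE; have [->|_] := eqVneq T S; rewrite ?eqxx. Qed.

Lemma fdegM k l a b : fdeg k a -> fdeg l b -> fdeg (k + l) (fmul a b).
Proof.
move=> ha hb; rewrite (form_fmon a) fmul_suml; apply: fdeg_sum => S _.
rewrite (form_fmon b) fmul_sumr; apply: fdeg_sum => T _.
have [->|aS] := eqVneq (a S) 0; first by rewrite fmon0 fmul0l; exact: fdeg0.
have [->|bT] := eqVneq (b T) 0; first by rewrite fmon0 fmul0r; exact: fdeg0.
rewrite fmul_fmon; case: ifP => dST; last exact: fdeg0.
have -> : k + l = #|S :|: T|%:Z.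
  by rewrite cardsU; move: dST; rewrite -setI_eq0 => /eqP->; rewrite cards0 subn0 -(ha _ aS) -(hb _ bT).
exact: fdeg_fmon.
Qed.

Lemma fdeg_fscal p : fdeg 0 (fscal p : Omega K n).
Proof. have := @fdeg_fmon set0 p; by rewrite cards0. Qed.

Lemma fdeg_gt k a : (n%:Z < k) -> fdeg k a -> a = 0.
Proof.
move=> nk /fdegP h; apply/ffunP => S; rewrite h ?ffunE //.
apply: contraTneq nk => <-; by have := max_card (mem S); rewrite card_ord -leNgt lez_nat.
Qed.

Lemma fmulC k l a b : fdeg k a -> fdeg l b ->
  fmul a b = (-1 : K) ^ (k * l) *: fmul b a.
Proof.
move=> ha hb; rewrite (form_fmon a) fmul_suml fmul_sumr scaler_sumr; apply: eq_bigr => S _.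
rewrite (form_fmon b) fmul_suml fmul_sumr scaler_sumr; apply: eq_bigr => T _.
have [->|aS] := eqVneq (a S) 0; first by rewrite fmon0 fmul0l fmul0r scaler0.
have [->|bT] := eqVneq (b T) 0; first by rewrite fmon0 fmul0r fmul0l scaler0.
rewrite !fmul_fmon disjoint_sym; case: ifP => dST; last by rewrite scaler0.
rewrite -(linZ (@fmon_linear _)) scalerA setUC shsignC 1?disjoint_sym //.
by rewrite -(ha _ aS) -(hb _ bT) -PoszM -exprnP [a S * _]mulrC.
Qed.

End FormAlgebra.

(** * Signs acquired when sorting a list of indices *)

Section SignedSort.
Variables (K : fieldType) (n : nat) (c : 'I_n -> 'I_n -> K).

(** The product of [c x y] over all inversions of the list. The weight [c] is general because the
    same count yields the sign of a permutation, the signs of products of one-forms and the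
    antisymmetric Koszul sign. *)
Fixpoint sortsign (l : seq 'I_n) : K :=
  if l is x :: l' then (\prod_(y <- l' | (y < x)%N) c x y) * sortsign l' else 1.

Notation ltno := (fun x y : 'I_n => (x < y)%N).

Lemma ltno_trans : transitive ltno.
Proof. by move=> y x z; exact: ltn_trans. Qed.

Lemma sorted_enum_ord : sorted ltno (enum 'I_n).
Proof.
have := iota_ltn_sorted 0 n; rewrite -val_enum_ord sorted_map; exact: sub_sorted.
Qed.

Lemma sorted_enum_set (S : {set 'I_n}) : sorted ltno (enum S).
Proof.
rewrite {1}/enum_mem; apply: (sorted_filter ltno_trans); rewrite -enumT; exact: sorted_enum_ord.
Qed.

Variables (V : lmodType K) (f : seq 'I_n -> V).
Hypothesis fC : forall l1 (x y : 'I_n) l2, (y < x)%N ->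
  f (l1 ++ x :: y :: l2) = c x y *: f (l1 ++ y :: x :: l2).

Lemma sortsign_move (x : 'I_n) l1 p l2 : all (fun y : 'I_n => (y < x)%N) l1 ->
  f (p ++ x :: l1 ++ l2) = (\prod_(y <- l1) c x y) *: f (p ++ l1 ++ x :: l2).
Proof.
elim: l1 p => [|y l1 IH] p /=; first by rewrite big_nil scale1r.
move=> /andP[yx h]; rewrite fC // -cat_rcons IH // cat_rcons scalerA.
by rewrite big_cons.
Qed.

(** Insertion sort: in the sorted list the head [x] is preceded exactly by the smaller entries, and
    moving it past them costs the factor that [x] contributes. The arbitrary prefix [p] lets the
    induction act behind entries already treated. *)
Lemma sortsignP l l' p : perm_eq l l' -> sorted ltno l' ->
  f (p ++ l) = sortsign l *: f (p ++ l').
Proof.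
elim: l l' p => [|x l IH] l' p pl sl'.
  by move: pl; rewrite perm_sym => /perm_nilP->; rewrite scale1r.
have xl' : x \in l' by rewrite -(perm_mem pl) mem_head.
case/splitPr: l' / xl' pl sl' => l1 l2 pl sl'.
have pl2 : perm_eq l (l1 ++ l2).
  by rewrite -(perm_cons x) (permPl pl) -cat1s perm_catCA.
have sl2 : sorted ltno (l1 ++ l2).
  apply: (subseq_sorted ltno_trans _ sl'); apply: cat_subseq; first exact: subseq_refl.
  exact: subseq_cons.
have all1 : all (fun y : 'I_n => (y < x)%N) l1.
  have := sl'; rewrite sorted_pairwise; last exact: ltno_trans.
  rewrite pairwise_cat => /andP[/allrelP h _]; apply/allP => y yl1.
  by apply: h => //; exact: mem_head.
have all2 : all (fun y : 'I_n => (x < y)%N) l2.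
  have := sl'; rewrite sorted_pairwise; last exact: ltno_trans.
  by rewrite pairwise_cat pairwise_cons => /and3P[_ _ /andP[]].
rewrite -cat_rcons (IH (l1 ++ l2)) // cat_rcons sortsign_move // scalerA mulrC.
congr (_ * _ *: _); rewrite (perm_big _ pl2) big_cat /=.
rewrite [X in _ * X]big_seq_cond [X in _ * X]big1 ?mulr1; last first.
  by move=> y /andP[/(allP all2) xy yx]; move: (ltn_trans xy yx); rewrite ltnn.
rewrite big_seq [RHS]big_seq_cond; apply: eq_bigl => y.
by case: (boolP (y \in l1)) => // /(allP all1) ->.
Qed.

Lemma sortsign_map (h : 'I_n -> 'I_n) l : sorted ltno l ->
  sortsign [seq h i | i <- l] =
    \prod_(i <- l) \prod_(j <- l | (i < j)%N && (h j < h i)%N) c (h i) (h j).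
Proof.
rewrite sorted_pairwise; last exact: ltno_trans.
elim: l => [|x l IH] /=; first by rewrite big_nil.
move=> /andP[/allP ax sl]; rewrite big_cons big_map IH //; congr (_ * _).
  rewrite big_cons ltnn /= [RHS]big_seq_cond [LHS]big_seq_cond; apply: eq_bigl => j.
  by case: (boolP (j \in l)) => // /ax ->.
rewrite big_seq [RHS]big_seq; apply: eq_bigr => i il; rewrite big_cons ifF //.
by have := ax _ il; case: ltngtP.
Qed.

Lemma sortsign_perm (s : {perm 'I_n}) :
  f [seq s i | i <- enum 'I_n] =
    (\prod_(i < n) \prod_(j < n | (i < j)%N && (s j < s i)%N) c (s i) (s j))
      *: f (enum 'I_n).
Proof.
have pl : perm_eq [seq s i | i <- enum 'I_n] (enum 'I_n).
  have inj_s : injective (fun i => s i) by exact: perm_inj.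
  apply: uniq_perm; rewrite ?(map_inj_uniq inj_s) ?enum_uniq // => i.
  by rewrite [RHS]mem_enum; apply/mapP; exists (s^-1 i)%g; rewrite ?mem_enum ?permKV.
have := sortsignP [::] pl sorted_enum_ord; rewrite /= => ->.
rewrite sortsign_map ?sorted_enum_ord // big_enum /=; congr (_ *: _).
by apply: eq_bigr => i _; rewrite big_enum_cond.
Qed.

End SignedSort.

Section SortSignCat.
Variables (K : fieldType) (n : nat) (c : 'I_n -> 'I_n -> K).

Lemma sortsign_cat l t : sortsign c (l ++ t) =
  sortsign c l * (\prod_(x <- l) \prod_(y <- t | (y < x)%N) c x y) * sortsign c t.
Proof.
elim: l => [|x l IH] /=; first by rewrite big_nil !mul1r.
by rewrite IH big_cat big_cons /=; ring.
Qed.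

Lemma sortsign_sorted (l : seq 'I_n) :
  sorted (fun x y : 'I_n => (x < y)%N) l -> sortsign c l = 1.
Proof.
rewrite sorted_pairwise; last exact: ltno_trans.
elim: l => //= x l IH /andP[/allP ax /IH->]; rewrite mulr1.
by rewrite big_seq_cond big1 // => y /andP[/ax]; case: ltngtP.
Qed.

Lemma sortsign_cat_enum (S T : {set 'I_n}) : sortsign c (enum S ++ enum T) =
  \prod_(x in S) \prod_(y in T | (y < x)%N) c x y.
Proof.
rewrite sortsign_cat !sortsign_sorted ?sorted_enum_set // mul1r mulr1 big_enum /=.
by apply: eq_bigr => x _; rewrite big_enum_cond.
Qed.
End SortSignCat.

(* The sign of a permutation is computed from its inversions by letting adjacent
   transpositions act on the rows of a determinant. *)
Lemma odd_perm_inversions (K : fieldType) n (s : 'S_n) :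
  (-1) ^+ s = \prod_(i < n) \prod_(j < n | (i < j)%N && (s j < s i)%N) (-1) :> K.
Proof.
pose A (l : seq 'I_n) : 'M[K]_n := \matrix_(i, j) (onth l i == Some j)%:R.
pose f (l : seq 'I_n) : K^o := if size l == n then \det (A l) else 0.
have fC l1 (x y : 'I_n) l2 : (y < x)%N ->
    f (l1 ++ x :: y :: l2) = (fun _ _ => -1) x y *: f (l1 ++ y :: x :: l2).
  move=> _; rewrite /f !size_cat /=; case: eqP => [e|]; last by rewrite scaler0.
  have h1 : (size l1 < n)%N by lia.
  have h2 : ((size l1).+1 < n)%N by lia.
  pose i1 := Ordinal h1; pose i2 := Ordinal h2.
  have -> : A (l1 ++ x :: y :: l2) = xrow i1 i2 (A (l1 ++ y :: x :: l2)).
    apply/matrixP => i j; rewrite !mxE; congr (_ == _)%:R.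
    rewrite !onthE !map_cat /= !nth_cat !size_map.
    case: tpermP => [->|->|/eqP n1 /eqP n2] /=.
    - by rewrite ltnn subnn ltnNge leqnSn /= subSnn.
    - by rewrite ltnn subnn ltnNge leqnSn /= subSnn.
    case: ltnP => // le.
    have : (i != size l1 :> nat) by apply: contraNneq n1 => e1; apply/eqP/val_inj.
    have : (i != (size l1).+1 :> nat) by apply: contraNneq n2 => e1; apply/eqP/val_inj.
    case E : (i - size l1)%N => [|[|k]] //; lia.
  rewrite xrowE det_mulmx det_perm odd_tperm -val_eqE /= neq_ltn ltnSn /= expr1.
  by rewrite scaleN1r mulN1r.
have := sortsign_perm fC s; rewrite /f size_map -cardE card_ord eqxx.
have -> : A [seq s i | i <- enum 'I_n] = perm_mx s.
  apply/matrixP => i j; rewrite !mxE onthE -map_comp (nth_map i) ?nth_ord_enum //.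
  by rewrite size_enum_ord.
have -> : A (enum 'I_n) = 1%:M.
  apply/matrixP => i j; rewrite !mxE onthE (nth_map i) ?nth_ord_enum //.
  by rewrite size_enum_ord.
by rewrite det_perm det1 /GRing.scale /= mulr1.
Qed.

(** * Products of one-forms and the differential *)

Section Char0.
Variables (K : fieldType).
Hypothesis charK : [pchar K] =i pred0.

Lemma natK_neq0 m : (0 < m)%N -> m%:R != 0 :> K.
Proof. by move/pcharf0P: charK => ->; case: m. Qed.

(** Odd elements square to zero and d^2 = 0 because both expressions equal their own negatives;
    dividing by 2 uses characteristic 0. *)
Lemma opp_self_eq0 (V : lmodType K) (x : V) : x = - x -> x = 0.
Proof.
move=> e; have : (2%:R : K) *: x = 0 by rewrite scaler_nat mulr2n {2}e subrr.
by move/eqP; rewrite scaler_eq0 (negPf (natK_neq0 _)) //= => /eqP.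
Qed.

Section OddProducts.
Variables (n : nat).
Implicit Types (a b : Omega K n).

Lemma fmulC1 a b : fdeg 1 a -> fdeg 1 b -> fmul a b = - fmul b a.
Proof. by move=> ha hb; rewrite (fmulC ha hb) mulr1 expr1z scaleN1r. Qed.

Lemma fmul_odd_sqr a : fdeg 1 a -> fmul a a = 0.
Proof. by move=> ha; apply: opp_self_eq0; exact: fmulC1. Qed.

Lemma fdeg_fprod (T : Type) (v : T -> Omega K n) (p : T -> int) l :
  (forall x, fdeg (p x) (v x)) -> fdeg (\sum_(x <- l) p x) (fprod [seq v x | x <- l]).
Proof.
move=> hv; elim: l => [|x l IH] /=; first by rewrite big_nil; exact: fdeg_fscal.
by rewrite big_cons; apply: fdegM.
Qed.

Variables (m : nat) (v : 'I_m -> Omega K n).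
Hypothesis hv : forall i, fdeg 1 (v i).

Lemma fprod_odd_swap l1 x y l2 :
  fprod [seq v i | i <- l1 ++ x :: y :: l2] =
  (-1 : K) *: fprod [seq v i | i <- l1 ++ y :: x :: l2].
Proof.
rewrite !map_cat !fprod_cat /= -fmulZr; congr fmul.
by rewrite !fmulA -fmulZl scaleN1r -fmulC1.
Qed.

Lemma fmul_fprod_mem x l : x \in l -> fmul (v x) (fprod [seq v i | i <- l]) = 0.
Proof.
case/splitPr => l1 l2; rewrite map_cat fprod_cat /= fmulA.
rewrite (fmulC (@hv x) (@fdeg_fprod _ _ (fun=> 1) l1 (@hv))) fmulZl -fmulA.
by rewrite [X in fmul _ X]fmulA fmul_odd_sqr // fmul0l fmul0r scaler0.
Qed.

Lemma fprod_not_uniq l : ~~ uniq l -> fprod [seq v i | i <- l] = 0.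
Proof.
elim: l => //= x l IH; rewrite negb_and negbK => /orP[/fmul_fprod_mem//|/IH->].
by rewrite fmul0r.
Qed.

(** Arbitrary one-forms multiply like the generators dt_i: a common index repeats a one-form and
    kills the product, and otherwise merging the two increasing lists costs one sign per inversion.
    Applied to [dpull], this makes pullback multiplicative. *)
Lemma fprod_enumM (S T : {set 'I_m}) :
  fmul (fprod [seq v i | i <- enum S]) (fprod [seq v i | i <- enum T]) =
  if [disjoint S & T] then shsign K S T *: fprod [seq v i | i <- enum (S :|: T)] else 0.
Proof.
rewrite -fprod_cat -map_cat; case: ifPn => dST; last first.
  apply: fprod_not_uniq; rewrite cat_uniq !enum_uniq /= andbT negbK.
  move: dST; rewrite -setI_eq0 => /set0Pn[i]; rewrite inE => /andP[iS iT].
  by apply/hasP; exists i; rewrite mem_enum.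
have fC l1 (x y : 'I_m) l2 (_ : (y < x)%N) := fprod_odd_swap l1 x y l2.
pose F l := fprod [seq v i | i <- l].
have := @sortsignP K m (fun _ _ => -1) _ F fC (enum S ++ enum T) (enum (S :|: T)) [::].
rewrite /F /= => -> //; last exact: sorted_enum_set.
  rewrite sortsign_cat_enum shsignE; congr (_ *: _).
  rewrite (big_morph _ (exprD (-1)) (expr0 (-1))); apply: eq_bigr => i _.
  rewrite (big_morph _ (exprD (-1)) (expr0 (-1))) [LHS]big_mkcondr /=.
  by apply: eq_bigr => j _; case: (j < i)%N.
apply: uniq_perm; rewrite ?enum_uniq //.
  rewrite cat_uniq !enum_uniq /= andbT -all_predC; apply/allP => i.
  by rewrite /= !mem_enum => iT; rewrite (disjointFl dST).
by move=> i; rewrite mem_cat !mem_enum inE.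
Qed.

End OddProducts.

Section Differential.
Variables (n : nat).
Implicit Types (a b : Omega K n) (S T : {set 'I_n}) (p q : {mpoly K[n]}).

Definition fpartial (i : 'I_n) a : Omega K n := [ffun S : {set _} => mderiv i (a S)].

Lemma fpartial_linear i : linear (fpartial i).
Proof. by move=> c a b; apply/ffunP => S; rewrite !ffunE linearP. Qed.

Lemma fpartial_fmon i S p : fpartial i (fmon S p) = fmon S (mderiv i p).
Proof. by apply/ffunP => U; rewrite !ffunE; case: ifP; rewrite ?mderiv0. Qed.

Lemma fpartialM i a b :
  fpartial i (fmul a b) = fmul (fpartial i a) b + fmul a (fpartial i b).
Proof.
apply/ffunP => U; rewrite !ffunE raddf_sum -big_split /=; apply: eq_bigr => S _.
by rewrite !ffunE mderivZ mderivM scalerDr.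
Qed.

Lemma fdiffE a : fdiff a = \sum_(i < n) fmul (fmon [set i] 1) (fpartial i a).
Proof. by []. Qed.

Lemma fdiff_linear : linear (@fdiff K n).
Proof.
move=> c a b; rewrite !fdiffE scaler_sumr -big_split; apply: eq_bigr => i _.
by rewrite fpartial_linear fmulDr fmulZr.
Qed.

Lemma fdeg_dt (i : 'I_n) : fdeg 1 (fmon [set i] 1 : Omega K n).
Proof. by have := @fdeg_fmon K n [set i] 1; rewrite cards1. Qed.

Lemma fdeg_fpartial k i a : fdeg k a -> fdeg k (fpartial i a).
Proof. by move=> /fdegP h; apply/fdegP => S nS; rewrite ffunE h // mderiv0. Qed.

Lemma fdeg_fdiff k a : fdeg k a -> fdeg (k + 1) (fdiff a).
Proof.
move=> h; rewrite fdiffE; apply: fdeg_sum => i _; rewrite addrC.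
apply: fdegM; [exact: fdeg_dt|exact: fdeg_fpartial].
Qed.

Lemma fdiffM k a b : fdeg k a ->
  fdiff (fmul a b) = fmul (fdiff a) b + (-1 : K) ^ k *: fmul a (fdiff b).
Proof.
move=> ha; rewrite !fdiffE fmul_suml fmul_sumr scaler_sumr -big_split.
apply: eq_bigr => i _; rewrite fpartialM fmulDr fmulA; congr (_ + _).
by rewrite !fmulA (fmulC (@fdeg_dt i) ha) mul1r fmulZl.
Qed.

Lemma fdiff_fscal p : fdiff (fscal p) = \sum_(i < n) fmon [set i] (mderiv i p).
Proof.
rewrite fdiffE; apply: eq_bigr => i _.
by rewrite fpartial_fmon fmon_fscal mulr1.
Qed.

(** The double sum of dt_i dt_j times second partial derivatives is antisymmetric in the first
    factor and symmetric in the second. *)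
Lemma fdiff_sqr a : fdiff (fdiff a) = 0.
Proof.
have -> : fdiff (fdiff a) = \sum_(i < n) \sum_(j < n)
    fmul (fmul (fmon [set i] 1) (fmon [set j] 1)) (fpartial i (fpartial j a)).
  rewrite fdiffE; apply: eq_bigr => i _.
  rewrite fdiffE (lin_sum _ _ _ (fpartial_linear i)) fmul_sumr; apply: eq_bigr => j _.
  rewrite fpartialM fpartial_fmon -mpolyC1 mderivC fmon0 fmul0l add0r.
  by rewrite fmulA.
apply: opp_self_eq0; rewrite {1}exchange_big -sumrN; apply: eq_bigr => i _.
rewrite -sumrN; apply: eq_bigr => j _; rewrite (fmulC1 (@fdeg_dt j) (@fdeg_dt i)) fmulNl.
congr (- fmul _ _); apply/ffunP => S; rewrite !ffunE; exact: mderiv_comm.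
Qed.

Lemma fdiff_fprod (v : seq (Omega K n)) :
  (forall a, a \in v -> fdeg 1 a /\ fdiff a = 0) -> fdiff (fprod v) = 0.
Proof.
elim: v => [|a v IH] h /=; first by rewrite fdiff_fscal big1 // => i _; rewrite -mpolyC1 mderivC fmon0.
have [ha da] := h a (mem_head _ _).
rewrite (fdiffM _ ha) da fmul0l add0r IH ?fmul0r ?scaler0 // => b bv.
by apply: h; rewrite inE bv orbT.
Qed.

End Differential.
End Char0.

(** * Pullback of forms along maps of vertices *)

Section Pullback.
Variable K : fieldType.
Hypothesis charK : [pchar K] =i pred0.

Section OneMap.
Variables (k n : nat) (f : 'I_k.+1 -> 'I_n.+1).
Implicit Types (a b : Omega K n) (S T : {set 'I_n}) (p q : {mpoly K[n]}).

Definition polypull p : {mpoly K[k]} := p \mPo [tuple tpull K f (lift ord0 j) | j < n].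
Definition dpull (j : 'I_n) : Omega K k := fdiff (fscal (tpull K f (lift ord0 j))).

Lemma polypull_linear : linear polypull.
Proof. by move=> c p q; rewrite /polypull linearP. Qed.

Lemma fdeg_dpull j : fdeg 1 (dpull j).
Proof. by rewrite -[1]add0r; apply: fdeg_fdiff; exact: fdeg_fscal. Qed.

Lemma fpullE a : fpull f a =
  \sum_(S : {set 'I_n}) fmul (fscal (polypull (a S))) (fprod [seq dpull j | j <- enum S]).
Proof. by []. Qed.
Local Opaque fpull fdiff fmul.

Lemma fmul_fscal4 (p q : {mpoly K[k]}) (a b : Omega K k) :
  fmul (fmul (fscal p) a) (fmul (fscal q) b) = fmul (fscal (p * q)) (fmul a b).
Proof. by rewrite -fmulA [X in fmul _ X]fmulA fscal_comm fscalM -!fmulA. Qed.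

Lemma fpull_linear : linear (fpull f : Omega K n -> Omega K k).
Proof.
move=> c a b; rewrite !fpullE scaler_sumr -big_split; apply: eq_bigr => S _.
by rewrite !ffunE /polypull linearP -fmulZl /= -fmulDl -fscal_linear.
Qed.

Lemma fpull_fmon S p :
  fpull f (fmon S p) = fmul (fscal (polypull p)) (fprod [seq dpull j | j <- enum S]).
Proof.
rewrite fpullE (bigD1 S) //= fmonE eqxx big1 ?addr0 // => T /negPf nT.
by rewrite fmonE nT /polypull comp_mpoly0 fscal0 fmul0l.
Qed.

Lemma fpull_fscal p : fpull f (fscal p) = fscal (polypull p).
Proof. by rewrite fpull_fmon enum_set0 /= fmul1r. Qed.

Lemma fpull_dt j : fpull f (fmon [set j] 1) = dpull j.
Proof. by rewrite fpull_fmon enum_set1 /= fmul1r /polypull comp_mpoly1 fmul1l. Qed.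

Lemma fpullM a b : fpull f (fmul a b) = fmul (fpull f a) (fpull f b).
Proof.
rewrite (form_fmon a) fmul_suml !(lin_sum _ _ _ fpull_linear) fmul_suml.
apply: eq_bigr => S _.
rewrite (form_fmon b) fmul_sumr !(lin_sum _ _ _ fpull_linear) fmul_sumr.
apply: eq_bigr => T _.
rewrite !fpull_fmon fmul_fscal4.
rewrite (fprod_enumM charK fdeg_dpull) fmul_fmon; case: ifP => _; last first.
  by rewrite (lin0 fpull_linear) fmul0r.
rewrite (linZ (@fmon_linear K n _)) (linZ fpull_linear) fpull_fmon fmulZr.
by rewrite /polypull rmorphM.
Qed.

Lemma fpull1 : fpull f (fscal 1) = fscal 1 :> Omega K k.
Proof. by rewrite fpull_fscal /polypull comp_mpoly1. Qed.

Lemma fpull_fprod s : fpull f (fprod s) = fprod [seq fpull f a | a <- s].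
Proof. by elim: s => [|a s IH] /=; rewrite ?fpull1 // fpullM IH. Qed.

Lemma fdeg_fpull d a : fdeg d a -> fdeg d (fpull f a).
Proof.
move=> h; rewrite fpullE; apply: fdeg_sum => S _.
have [->|/h <-] := eqVneq (a S) 0.
  by rewrite /polypull comp_mpoly0 fscal0 fmul0l; exact: fdeg0.
rewrite -[_%:Z]add0r; apply: fdegM; first exact: fdeg_fscal.
have := @fdeg_fprod K k _ (dpull) (fun=> 1) (enum S) (@fdeg_dpull).
by rewrite big_const_seq count_predT -cardE iter_addr_0 natz.
Qed.

(** The chain rule. Both sides are additive and obey the same product rule, so constants and
    variables suffice. *)
Lemma fdiff_polypull p :
  fdiff (fscal (polypull p)) =
  \sum_(i < n) fmul (fscal (polypull (mderiv i p))) (dpull i).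
Proof.
pose E p := fdiff (fscal (polypull p)) =
  \sum_(i < n) fmul (fscal (polypull (mderiv i p))) (dpull i).
have sD (q q' : {mpoly K[k]}) : fscal (q + q') = fscal q + fscal q' :> Omega K k by exact: (linD (@fscal_linear K k)).
have EC c : E c%:MP.
  rewrite /E /polypull comp_mpolyC fdiff_fscal !big1 // => i _.
    by rewrite mderivC comp_mpoly0 fscal0 fmul0l.
  by rewrite mderivC fmon0.
have ED p1 p2 : E p1 -> E p2 -> E (p1 + p2).
  rewrite /E /polypull => e1 e2; rewrite comp_mpolyD sD (linD (@fdiff_linear K k)) e1 e2 -big_split.
  by apply: eq_bigr => i _; rewrite mderivD comp_mpolyD sD fmulDl.
have EM p1 p2 : E p1 -> E p2 -> E (p1 * p2).
  rewrite /E /polypull => e1 e2.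
  rewrite (rmorphM (comp_mpoly _)) fscalM (@fdiffM _ _ 0); last exact: fdeg_fscal.
  rewrite e1 e2.
  rewrite expr0z scale1r fmul_suml fmul_sumr -big_split; apply: eq_bigr => i _.
  rewrite mderivM comp_mpolyD 2!(rmorphM (comp_mpoly _)) sD fmulDl !fscalM; congr (_ + _).
    by rewrite -!fmulA (fscal_comm _ (dpull i)).
  by rewrite fmulA.
have EX i : E 'X_i.
  rewrite /E (bigD1 i) //= big1 ?addr0 => [|j /negPf ji].
    rewrite /polypull mderivX comp_mpolyXU -tnth_nth tnth_mktuple mnm1E eqxx scale1r.
    have -> : (U_(i) - U_(i) = 0)%MM by apply/mnmP => j; rewrite mnmBE subnn mnm0E.
    by rewrite mpolyX0 comp_mpoly1 fmul1l.
  by rewrite /polypull mderivX mnm1E eq_sym ji scale0r comp_mpoly0 fscal0 fmul0l.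
have E0 : E 0 by rewrite -mpolyC0; exact: EC.
have E1 : E 1 by rewrite -mpolyC1; exact: EC.
suff : E p by [].
clearbody E; rewrite (mpolyE p); apply: (big_ind E E0 ED) => m _.
rewrite -mul_mpolyC; apply: (EM); first exact: EC.
rewrite mpolyXE_id; apply: (big_ind E E1 EM) => i _.
by elim: (m i) => [|e IH]; rewrite ?expr0 // exprS; apply: (EM).
Qed.

Lemma fpull_fdiff a : fpull f (fdiff a) = fdiff (fpull f a).
Proof.
rewrite (form_fmon a) (lin_sum _ _ _ (@fdiff_linear K n)) 2!(lin_sum _ _ _ fpull_linear).
rewrite (lin_sum _ _ _ (@fdiff_linear K k)); apply: eq_bigr => S _.
rewrite fpull_fmon (@fdiffM _ _ 0); last exact: fdeg_fscal.
rewrite fdiff_fprod => [|b]; last first.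
  by case/mapP => j _ ->; split; [exact: fdeg_dpull|exact: fdiff_sqr].
rewrite fmul0r scaler0 addr0 fdiff_polypull fdiffE (lin_sum _ _ _ fpull_linear) fmul_suml.
apply: eq_bigr => i _; rewrite fpartial_fmon fpullM fpull_dt fpull_fmon fmulA.
by rewrite fscal_comm.
Qed.

(** The coordinate of vertex 0 is not a variable; its case follows from the others because the
    barycentric coordinates sum to 1 before and after pulling back. *)
Lemma polypull_tpoly i : polypull (tpoly K i) = tpull K f i.
Proof.
have sumE : \sum_i tpull K f i = 1.
  by rewrite -(tpoly_sum K k) [RHS](partition_big f xpredT) //=; apply: eq_bigr => j _.
have E j : polypull (tpoly K (lift ord0 j)) = tpull K f (lift ord0 j).
  by rewrite /polypull /tpoly liftK comp_mpolyXU -tnth_nth tnth_mktuple.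
case: (unliftP ord0 i) => [j ->|->]; first exact: E.
move: sumE; rewrite big_ord_recl => /(canRL (addrK _)) ->.
have := tpoly_sum K n; rewrite big_ord_recl => /(canRL (addrK _)) ->.
rewrite /polypull comp_mpolyB comp_mpoly1. congr (_ - _); rewrite raddf_sum.
by apply: eq_bigr => j _; exact: E.
Qed.

Lemma fpull_tform i : fpull f (tform K i) = fscal (tpull K f i).
Proof. by rewrite fpull_fscal polypull_tpoly. Qed.

Lemma fpull_dtform i : fpull f (dtform K i) = fdiff (fscal (tpull K f i)).
Proof. by rewrite fpull_fdiff fpull_tform. Qed.

End OneMap.

Lemma polypull_comp l k n (f : 'I_k.+1 -> 'I_n.+1) (h : 'I_l.+1 -> 'I_k.+1) p :
  polypull h (polypull f p) = polypull (fun i => f (h i)) p.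
Proof.
have E i : polypull h (tpull K f i) = tpull K (fun i => f (h i)) i.
  rewrite {1}/tpull (lin_sum _ _ _ (polypull_linear h)) /tpull [RHS](partition_big h (fun j => f j == i)) //=.
  apply: eq_bigr => j fj; rewrite polypull_tpoly; apply: eq_bigl => j'.
  by case: eqP => [->|]; rewrite ?fj ?andbF.
rewrite (mpolyE p) (lin_sum _ _ _ (polypull_linear f)) (lin_sum _ _ _ (polypull_linear h)).
rewrite (lin_sum _ _ _ (polypull_linear (fun i => f (h i)))); apply: eq_bigr => m _.
rewrite (linZ (polypull_linear f)) (linZ (polypull_linear h)).
rewrite (linZ (polypull_linear (fun i => f (h i)))); congr (_ *: _).
rewrite /polypull !comp_mpolyX rmorph_prod; apply: eq_bigr => j _.
by rewrite rmorphXn /= !tnth_mktuple; congr (_ ^+ _); exact: E.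
Qed.

Lemma fpull_dpull l k n (f : 'I_k.+1 -> 'I_n.+1) (h : 'I_l.+1 -> 'I_k.+1) j :
  fpull h (dpull f j) = dpull (fun i => f (h i)) j.
Proof.
by rewrite /dpull fpull_fdiff fpull_fscal -(polypull_tpoly f) polypull_comp polypull_tpoly.
Qed.

Lemma fpull_comp l k n (f : 'I_k.+1 -> 'I_n.+1) (h : 'I_l.+1 -> 'I_k.+1) (a : Omega K n) :
  fpull h (fpull f a) = fpull (fun i => f (h i)) a.
Proof.
rewrite (form_fmon a) (lin_sum _ _ _ (fpull_linear f)) (lin_sum _ _ _ (fpull_linear h)).
rewrite (lin_sum _ _ _ (fpull_linear (fun i => f (h i)))); apply: eq_bigr => S _.
rewrite [in RHS]fpull_fmon (fpull_fmon f) fpullM fpull_fscal polypull_comp fpull_fprod.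
by rewrite -map_comp (eq_map (fpull_dpull f h)).
Qed.

Lemma eq_fpull k n (f h : 'I_k.+1 -> 'I_n.+1) (a : Omega K n) :
  f =1 h -> fpull f a = fpull h a.
Proof.
move=> e; have et i : tpull K f i = tpull K h i by apply: eq_bigl => j; rewrite e.
have ed : dpull f =1 dpull h by move=> j; rewrite /dpull et.
have ep p : polypull f p = polypull h p.
  have -> : polypull f p = p \mPo [tuple tpull K h (lift ord0 j) | j < n] by
    rewrite /polypull; congr comp_mpoly; apply: eq_mktuple => j; exact: et.
  by [].
by rewrite !fpullE; apply: eq_bigr => S _; rewrite ep (eq_map ed).
Qed.

Lemma tpoly_lift0 n (j : 'I_n) : tpoly K (lift ord0 j) = 'X_j.
Proof. by rewrite /tpoly liftK. Qed.

Lemma dtform_lift0 n (j : 'I_n) : dtform K (lift ord0 j) = fmon [set j] 1.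
Proof.
rewrite /dtform /tform tpoly_lift0 fdiff_fscal (bigD1 j) //= big1 ?addr0 => [|i /negPf ij].
  have eU : (U_(j) - U_(j) = 0)%MM by apply/mnmP => i; rewrite mnmBE subnn mnm0E.
  by rewrite mderivX mnm1E eqxx scale1r eU mpolyX0.
by rewrite mderivX mnm1E eq_sym ij scale0r fmon0.
Qed.

Lemma fprod_dt n (s : seq 'I_n) : sorted (fun x y : 'I_n => (x < y)%N) s ->
  fprod [seq fmon [set j] 1 | j <- s] = fmon [set x in s] 1 :> Omega K n.
Proof.
rewrite sorted_pairwise; last exact: ltno_trans.
elim: s => [_|x s IH]; first by rewrite set_nil.
rewrite pairwise_cons => /andP[/allP ax /IH e]; rewrite /= e fmul_fmon.
have xs : x \notin s by apply/negP => /ax; rewrite ltnn.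
rewrite -setI_eq0 set_cons ifT; last first.
  by apply/eqP/setP => y; rewrite !inE; case: eqP => // ->; exact: negPf.
rewrite shsignE big_set1 big1 ?expr0 ?scale1r ?mulr1 // => y.
by rewrite inE => /ax; case: ltngtP.
Qed.

Lemma tpull_id n i : tpull K (fun i : 'I_n.+1 => i) i = tpoly K i.
Proof. by rewrite /tpull big_pred1_eq. Qed.

Lemma fpull_id n (a : Omega K n) : fpull (fun i : 'I_n.+1 => i) a = a.
Proof.
have pp p : polypull (fun i : 'I_n.+1 => i) p = p.
  rewrite -[RHS]comp_mpoly_id; congr (_ \mPo _); apply: eq_mktuple => j.
  by rewrite tpull_id tpoly_lift0.
have dp : dpull (fun i : 'I_n.+1 => i) =1 (fun j => fmon [set j] 1).
  by move=> j; rewrite /dpull tpull_id; exact: dtform_lift0.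
rewrite [RHS](form_fmon a) fpullE; apply: eq_bigr => S _.
rewrite pp (eq_map dp) fprod_dt ?sorted_enum_set // fscal_fmon mulr1; congr (fmon _ _).
by apply/setP => x; rewrite inE mem_enum.
Qed.

End Pullback.
Local Opaque fpull fdiff fmul.

(** * Whitney forms and integration *)

Lemma enum_neq n (i : 'I_n.+1) :
  [seq p <- enum 'I_n.+1 | p != i] = [seq lift i p | p <- enum 'I_n].
Proof.
apply: (irr_sorted_eq (@ltno_trans n.+1)); first by move=> x; exact: ltnn.
- apply: (sorted_filter (@ltno_trans n.+1)); exact: sorted_enum_ord.
- rewrite sorted_map; apply: sub_sorted (sorted_enum_ord n) => x y /=.
  by rewrite /bump; do 2!case: leqP => //=; lia.
move=> p; rewrite mem_filter mem_enum andbT; apply/idP/mapP => [|[q _ ->]].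
  by rewrite eq_sym => /unlift_some[q -> _]; exists q; rewrite ?mem_enum.
by rewrite eq_sym neq_lift.
Qed.

Section Whitney.
Variable K : fieldType.
Hypothesis charK : [pchar K] =i pred0.

Lemma shsign1C n (j : 'I_n) : shsign K [set j] [set~ j] = (-1) ^+ j.
Proof.
rewrite shsignE big_set1; congr (_ ^+ _).
rewrite -[RHS]card_ord -sum1_card (big_ord_widen _ (fun=> 1%N) (ltnW (ltn_ord j))).
rewrite big_mkcond [RHS]big_mkcond /=; apply: eq_bigr => q _.
by rewrite !inE; case: eqP => [->|_] /=; rewrite ?ltnn //; case: (q < j)%N.
Qed.

Lemma fdeg_tform n i : fdeg 0 (tform K i : Omega K n).
Proof. exact: fdeg_fscal. Qed.

Lemma fdeg_dtform n i : fdeg 1 (dtform K i : Omega K n).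
Proof. by rewrite -[1]add0r; apply: fdeg_fdiff; exact: fdeg_fscal. Qed.

Lemma fdiff_dtform n i : fdiff (dtform K i : Omega K n) = 0.
Proof. exact: fdiff_sqr. Qed.

(** For [j] = 0 the product is dt_1 ... dt_n itself. Otherwise dt_0 is replaced by minus the sum of
    the other differentials, of which only dt_j does not repeat a factor already present. *)
Lemma fprod_dtform_neq n (j : 'I_n.+1) :
  fprod [seq dtform K p | p <- enum 'I_n.+1 & p != j] = (-1 : K) ^+ j *: fmon setT 1.
Proof.
have eT (s : seq 'I_n) : sorted (fun x y : 'I_n => (x < y)%N) s ->
    fprod [seq dtform K (lift ord0 p) | p <- s] = fmon [set x in s] 1.
  by move=> ss; rewrite (eq_map (@dtform_lift0 K n)) fprod_dt.
case: (unliftP ord0 j) => [j0|] ->; last first.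
  rewrite enum_neq -map_comp eT ?sorted_enum_ord // expr0 scale1r.
  by congr (fmon _ _); apply/setP => x; rewrite !inE mem_enum.
have -> : [seq p <- enum 'I_n.+1 | p != lift ord0 j0] =
    ord0 :: [seq lift ord0 p | p <- enum 'I_n & p != j0].
  by rewrite enum_ordSl /= filter_map; congr (_ :: map _ _).
rewrite /= -map_comp eT; last first.
  by apply: (sorted_filter (@ltno_trans n)); exact: sorted_enum_ord.
have -> : [set x in [seq p <- enum 'I_n | p != j0]] = [set~ j0].
  by apply/setP => x; rewrite !inE mem_filter mem_enum andbT.
have := dtform_sum K n; rewrite big_ord_recl => /(canRL (addrK _)) ->; rewrite sub0r.
rewrite fmulNl fmul_suml (bigD1 j0) //= big1 ?addr0 => [|q qj].
  rewrite dtform_lift0 fmul_fmon ifT; last by rewrite disjoints1 !inE eqxx.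
  rewrite setUCr mulr1 shsign1C /bump /= add1n exprS mulN1r scaleNr.
  by rewrite (linZ (@fmon_linear K n _)).
by rewrite dtform_lift0 fmul_fmon ifF // disjoints1 !inE qj.
Qed.

Lemma fmul_dtform_neq n k (F : 'I_k.+1 -> 'I_n.+1) (j : 'I_k.+1) :
  fmul (dtform K (F j)) (fprod [seq dtform K (F p) | p <- enum 'I_k.+1 & p != j]) =
  (-1 : K) ^+ j *: fprod [seq dtform K (F p) | p <- enum 'I_k.+1].
Proof.
have := @fprod_enumM K charK n _ (fun p => dtform K (F p)) (fun p => @fdeg_dtform n (F p))
  [set j] [set~ j].
rewrite enum_set1 /= fmul1r ifT; last by rewrite disjoints1 !inE eqxx.
rewrite setUCr shsign1C.
have -> : enum [set~ j] = [seq p <- enum 'I_k.+1 | p != j].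
  by rewrite {1}/enum_mem -enumT; apply: eq_filter => p; rewrite !inE.
have -> : enum [set: 'I_k.+1] = enum 'I_k.+1 by apply: eq_enum => p; rewrite inE.
by [].
Qed.

Lemma whitneyE n k (F : 'I_k.+1 -> 'I_n.+1) : whitney K F =
  (k`!)%:R *: \sum_(j < k.+1) (-1) ^+ j *:
    fmul (tform K (F j)) (fprod [seq dtform K (F p) | p <- enum 'I_k.+1 & p != j]).
Proof. by []. Qed.

Lemma eq_whitney n k (F G : 'I_k.+1 -> 'I_n.+1) : F =1 G -> whitney K F = whitney K G.
Proof.
move=> e; have ed p : dtform K (F p) = dtform K (G p) by rewrite e.
rewrite !whitneyE; apply: (congr1 ( *:%R _)); apply: eq_bigr => j _.
by rewrite e (eq_map ed).
Qed.

(** Each summand is t_j times the volume form, the two signs (-1)^j cancelling, and the t_j sum to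
    1. *)
Lemma whitney_id n : whitney K (fun i : 'I_n.+1 => i) = (n`!)%:R *: fmon setT 1.
Proof.
rewrite whitneyE; congr (_ *: _).
transitivity (\sum_(j < n.+1) fmul (tform K j) (fmon setT 1)).
  apply: eq_bigr => j _; rewrite fprod_dtform_neq fmulZr scalerA -expr2 sqrr_sign.
  by rewrite scale1r.
by rewrite -fmul_suml -(lin_sum _ _ _ (@fscal_linear K n)) tpoly_sum fmul1l.
Qed.

(** Each of the k+1 summands contributes the same product of all differentials, which turns k! into
    (k+1)!. *)
Lemma fdiff_whitney n k (F : 'I_k.+1 -> 'I_n.+1) :
  fdiff (whitney K F) = (k.+1`!)%:R *: fprod [seq dtform K (F p) | p <- enum 'I_k.+1].
Proof.
rewrite whitneyE (linZ (@fdiff_linear K n)) (lin_sum _ _ _ (@fdiff_linear K n)).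
rewrite factS mulnC natrM -scalerA; congr (_ *: _).
have -> : k.+1%:R = \sum_(j < k.+1) 1 :> K by rewrite sumr_const card_ord.
rewrite scaler_suml; apply: eq_bigr => j _; rewrite scale1r.
rewrite (linZ (@fdiff_linear K n)) (fdiffM _ (@fdeg_tform n (F j))) fdiff_fprod.
  rewrite fmul0r scaler0 addr0 -/(dtform K (F j)) fmul_dtform_neq.
  by rewrite scalerA -expr2 sqrr_sign scale1r.
by move=> b /mapP[p _ ->]; split; [exact: fdeg_dtform|exact: fdiff_dtform].
Qed.

(** Omitting dt_i from the product costs (-1)^i, and the factorials agree because d turns n! into
    (n+1)!. This is the origin of the sign [c] in the horn contraction. *)
Lemma fdiff_whitney_face n (i : 'I_n.+2) :
  fdiff (whitney K (lift i)) = (-1) ^+ i *: whitney K (fun j : 'I_n.+2 => j).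
Proof.
rewrite fdiff_whitney whitney_id scalerA mulrC -scalerA; congr (_ *: _).
rewrite -(fprod_dtform_neq i) enum_neq -map_comp; by [].
Qed.

Lemma fdeg_whitney n k (F : 'I_k.+1 -> 'I_n.+1) : fdeg k%:Z (whitney K F).
Proof.
rewrite whitneyE; apply: fdegZ; apply: fdeg_sum => j _; apply: fdegZ.
rewrite -[k%:Z]add0r; apply: fdegM; first exact: fdeg_tform.
have := @fdeg_fprod K n _ (fun p => dtform K (F p)) (fun=> 1)
  [seq p <- enum 'I_k.+1 | p != j] (fun p => @fdeg_dtform n (F p)).
by rewrite enum_neq big_map big_const_seq count_predT size_enum_ord iter_addr_0 natz.
Qed.

Section PullWhitney.
Variables (l n k : nat) (f : 'I_l.+1 -> 'I_n.+1) (F : 'I_k.+1 -> 'I_n.+1).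

Lemma fpull_whitneyE : fpull f (whitney K F) =
  (k`!)%:R *: \sum_(j < k.+1) (-1) ^+ j *:
    fmul (fscal (tpull K f (F j)))
      (fprod [seq fdiff (fscal (tpull K f (F p))) | p <- enum 'I_k.+1 & p != j]).
Proof.
rewrite whitneyE (linZ (@fpull_linear K _ _ f)) (lin_sum _ _ _ (@fpull_linear K _ _ f)).
congr (_ *: _); apply: eq_bigr => j _; rewrite (linZ (@fpull_linear K _ _ f)); congr (_ *: _).
rewrite (fpullM charK) fpull_tform (fpull_fprod charK) -map_comp.
by rewrite (eq_map (fun p => fpull_dtform charK f (F p))).
Qed.

(** Every summand contains the coordinate of the missed vertex [F p] or its differential, and this
    coordinate pulls back to zero. *)
Lemma fpull_whitney_missing (p : 'I_k.+1) : (forall j, f j != F p) ->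
  fpull f (whitney K F) = 0.
Proof.
move=> nf; have t0 : tpull K f (F p) = 0 by rewrite /tpull big_pred0 // => j; exact: negPf.
rewrite fpull_whitneyE big1 ?scaler0 // => j _.
have [<-|pj] := eqVneq p j; first by rewrite t0 fscal0 fmul0l scaler0.
have : p \in [seq q <- enum 'I_k.+1 | q != j] by rewrite mem_filter pj mem_enum.
case/splitPr => l1 l2; rewrite map_cat fprod_cat /= t0 fscal0.
by rewrite (lin0 (@fdiff_linear K l)) fmul0l !fmul0r scaler0.
Qed.
End PullWhitney.

Lemma fpull_whitney_inj n k (F : 'I_k.+1 -> 'I_n.+1) : injective F ->
  fpull F (whitney K F) = whitney K (fun j : 'I_k.+1 => j).
Proof.
move=> injF; have et p : tpull K F (F p) = tpoly K p.
  by rewrite /tpull (big_pred1 p) // => q; rewrite (inj_eq injF).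
have ed p : fdiff (fscal (tpull K F (F p))) = dtform K p by rewrite et.
rewrite fpull_whitneyE whitneyE; apply: (congr1 ( *:%R _)); apply: eq_bigr => j _.
by rewrite et (eq_map ed).
Qed.

Lemma fint_linear n : linear (@fint K n : Omega K n -> K^o).
Proof.
pose G (s : seq 'X_{1..n}) (p : {mpoly K[n]}) : K :=
  \sum_(m <- s) p@_m * (\prod_(i < n) (m i)`!)%N%:R / ((mdeg m + n)`!)%:R.
have ext p s : uniq s -> {subset msupp p <= s} -> G (msupp p) p = G s p.
  move=> us sub; rewrite /G [RHS](bigID (mem (msupp p))) /= [X in _ + X]big1 ?addr0.
    rewrite -[RHS]big_filter; apply: perm_big; apply: uniq_perm.
    - exact: msupp_uniq.
    - exact: filter_uniq.
    by move=> m; rewrite mem_filter; case: (boolP (m \in msupp p)) => // /sub.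
  by move=> m /memN_msupp_eq0 ->; rewrite !mul0r.
move=> c a b; rewrite /fint -!/(G _ _).
pose s := undup (msupp (a setT) ++ msupp (b setT) ++ msupp ((c *: a + b) setT)).
have us : uniq s by exact: undup_uniq.
rewrite (ext _ s) // => [|m ms]; last by rewrite mem_undup !mem_cat ms !orbT.
rewrite (ext (a setT) s) // => [|m ms]; last by rewrite mem_undup !mem_cat ms.
rewrite (ext (b setT) s) // => [|m ms]; last by rewrite mem_undup !mem_cat ms orbT.
rewrite /G scaler_sumr -big_split; apply: eq_bigr => m _ /=.
by rewrite !ffunE mcoeffD mcoeffZ /GRing.scale /=; ring.
Qed.

Lemma fint_deg n k (a : Omega K n) : fdeg k a -> k != n -> fint a = 0.
Proof.
move=> /fdegP h nk; rewrite /fint h ?msupp0 ?big_nil //.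
by rewrite cardsT card_ord eq_sym.
Qed.

(** The standard n-simplex has volume 1/n!, which the factor n! of the Whitney form compensates. *)
Lemma fint_whitney n : fint (whitney K (fun i : 'I_n.+1 => i)) = 1.
Proof.
rewrite whitney_id (linZ (@fint_linear n)) /fint fmonE eqxx -mpolyC1 msuppC oner_eq0.
rewrite big_seq1 mcoeffC eqxx !mul1r mdeg0 add0n big1 => [|i _]; last by rewrite mnm0E.
by rewrite mul1r /GRing.scale /= divff // (natK_neq0 charK) ?fact_gt0.
Qed.

Lemma fIE k n (f : 'I_k.+1 -> 'I_n.+1) (a : Omega K n) : fI f a = fint (fpull f a).
Proof. by []. Qed.

Lemma whitneyPE n (a : Omega K n) : whitneyP a =
  \sum_(k < n.+1)
    \sum_(i : {ffun 'I_k.+1 -> 'I_n.+1} |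
            [forall p : 'I_k.+1, forall q : 'I_k.+1, (p < q)%N ==> (i p < i q)%N])
      fI i a *: whitney K i.
Proof. by []. Qed.

End Whitney.
Local Opaque fpull fdiff fmul whitney fint fI whitneyP.

(** * The homotopy adapted to a horn *)

Section HornContractionAlgebra.
Variables (K : fieldType) (V : lmodType K) (d s P : V -> V) (I J : V -> K^o).
Variables (W w : V) (c : K) (vanish : V -> Prop).
Hypotheses (d_lin : linear d) (s_lin : linear s) (I_lin : linear I).
Hypotheses (dd : forall a, d (d a) = 0) (ss : forall a, s (s a) = 0).
Hypothesis homotopy : forall a, a - P a = d (s a) + s (d a).
Hypotheses (Ps : forall a, P (s a) = 0) (Is : forall a, I (s a) = 0).
Hypothesis IP : forall a, I (P a) = I a.
Hypothesis P_vanish : forall a, vanish a -> P a = I a *: W + J a *: w.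
Hypothesis d_vanish : forall a, vanish a -> vanish (d a).
Hypotheses (W_vanish : vanish W) (w_vanish : vanish w).
Hypotheses (IW : I W = 1) (Iw : I w = 0) (JW : J W = 0) (Jw : J w = 1).
Hypotheses (dw : d w = c *: W) (dW : d W = 0) (cc : c * c = 1).

(** Evaluate the homotopy formula at [s a], where [P] and [s] vanish. In the application [I] and [J]
    are the integrals over the simplex and over its [i]-th face, [W] and [w] are their Whitney
    forms, [c] is (-1)^i, and [vanish] means vanishing on the horn. *)
Lemma contr_diff_contr a : s (d (s a)) = s a.
Proof. by have := homotopy (s a); rewrite Ps subr0 ss (lin0 d_lin) add0r. Qed.

Lemma contr_proj a : s (P a) = 0.
Proof.
have := congr1 s (homotopy a).
rewrite (linB s_lin) (linD s_lin) contr_diff_contr ss addr0.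
by move/eqP; rewrite subr_eq -subr_eq0 opprD addNKr oppr_eq0 => /eqP.
Qed.

Lemma diff_proj a : d (P a) = P (d a).
Proof.
have h1 := congr1 d (homotopy a); have h2 := homotopy (d a).
move: h1 h2; rewrite (linB d_lin) (linD d_lin) !dd (lin0 s_lin) addr0 add0r => <- /eqP.
by rewrite (inj_eq (addrI _)) eqr_opp => /eqP.
Qed.

(** [w] is fixed by [P], and [s] kills the image of [P]. *)
Lemma contr_face : s w = 0.
Proof. by rewrite -(contr_proj w) P_vanish // Iw Jw scale0r add0r scale1r. Qed.

Lemma contr_top : s W = 0.
Proof. by rewrite -(contr_proj W) P_vanish // IW JW scale0r addr0 scale1r. Qed.

(* Stokes' theorem for forms vanishing on the horn, obtained from the fact that
   the projection onto Whitney forms commutes with the differential. *)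
Lemma stokes_vanish a : vanish a -> I (d a) = c * J a.
Proof.
move=> va; have := congr1 I (diff_proj a); rewrite (P_vanish va) (P_vanish (d_vanish va)).
rewrite (linD d_lin) !(linZ d_lin) dW dw scaler0 add0r.
rewrite !(linD I_lin) !(linZ I_lin) IW Iw scaler0 addr0.
by rewrite /GRing.scale /= !mulr1 => <-; rewrite mulrC.
Qed.

(* The term added to [s] kills the last Whitney form of the homotopy [id - P = ds + sd], so
   that [hcontr] contracts the complex of elements satisfying [vanish]. *)
Definition hcontr a : V := s a + I a *: (c *: w).

Lemma hcontr_linear : linear hcontr.
Proof.
move=> x a b; rewrite /hcontr s_lin I_lin scalerDr scalerDl addrACA.
by rewrite -scalerA.
Qed.

Lemma I_hcontr a : I (hcontr a) = 0.
Proof. by rewrite /hcontr (linD I_lin) !(linZ I_lin) Iw Is !scaler0 addr0. Qed.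

Lemma hcontr_sqr a : hcontr (hcontr a) = 0.
Proof.
rewrite {1}/hcontr I_hcontr scale0r addr0 /hcontr.
by rewrite (linD s_lin) !(linZ s_lin) ss contr_face !scaler0 addr0.
Qed.

(** The added term contributes I(a) c dw = I(a) W through d and, by Stokes, I(da) c w = J(a) w.
    These are the two terms of [P a]. *)
Lemma hcontr_homotopy a : vanish a -> a = d (hcontr a) + hcontr (d a).
Proof.
move=> va; rewrite /hcontr (linD d_lin) !(linZ d_lin) dw stokes_vanish //.
rewrite !scalerA -mulrA cc mulr1 mulrAC cc mul1r.
by rewrite addrACA -homotopy (P_vanish va) subrK.
Qed.

(** This holds also off the elements that vanish on the horn: [s a] reproduces itself since I(d s a)
    = 0, and d(c w) = W is sent to c w because s W = 0 and I(W) = 1. *)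
Lemma hcontr_diff a : hcontr (d (hcontr a)) = hcontr a.
Proof.
have e0 : I (d (s a)) = 0.
  have /(canRL (addrK _)) -> := esym (homotopy a).
  by rewrite !(linB I_lin) Is IP subr0 subrr.
rewrite {2}/hcontr (linD d_lin) !(linZ d_lin) dw (scalerA c c) cc scale1r.
rewrite (linD hcontr_linear) !(linZ hcontr_linear).
by rewrite /hcontr contr_diff_contr e0 scale0r addr0 contr_top IW scale1r add0r.
Qed.

End HornContractionAlgebra.

Section HornContraction.
Variable K : fieldType.
Hypothesis charK : [pchar K] =i pred0.
Variable s : forall n, Omega K n -> Omega K n.
Hypothesis hs : gauge s.

Lemma gauge_linear n : linear (@s n).
Proof. by case: hs => h _ c a b; exact: contr_linear h _ _ _ _. Qed.

Lemma gauge_deg n k (a : Omega K n) : fdeg k a -> fdeg (k - 1) (s a).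
Proof. by case: hs => h _; exact: contr_degree h _ _ _. Qed.

Lemma gauge_sqr n (a : Omega K n) : s (s a) = 0.
Proof. by case: hs. Qed.

Lemma gauge_homotopy n (a : Omega K n) : a - whitneyP a = fdiff (s a) + s (fdiff a).
Proof. by case: hs => h _; exact: contr_homotopy h _ _. Qed.

Lemma gauge_fpull k n (f : 'I_k.+1 -> 'I_n.+1) (a : Omega K n) :
  {homo f : i j / (i <= j)%N} -> s (fpull f a) = fpull f (s a).
Proof.
move=> hf; case: hs => h _.
have e : [ffun i => f i] =1 f by move=> i; rewrite ffunE.
rewrite -!(eq_fpull _ e) (contr_simplicial h) //.
by apply/forallP => i; apply/forallP => j; apply/implyP; rewrite !ffunE; exact: hf.
Qed.

(** Lowering the degree by one, [s] leaves no component in the top degree n, the only one that is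
    integrated. *)
Lemma fint_gauge n (a : Omega K n) : fint (s a) = 0.
Proof.
rewrite (form_fmon a) (lin_sum _ _ _ (@gauge_linear n)) (lin_sum _ _ _ (@fint_linear K n)).
apply: big1 => S _; have h : fdeg (#|S|%:Z - 1) (s (fmon S (a S))).
  by apply: gauge_deg; exact: fdeg_fmon.
have le : (#|S| <= n)%N by have := max_card (mem S); rewrite card_ord.
by apply: (fint_deg h); move: #|S| le => x; lia.
Qed.

Lemma fI_linear k n (f : 'I_k.+1 -> 'I_n.+1) : linear (fI f : Omega K n -> K^o).
Proof. by move=> c a b; rewrite !fIE fpull_linear (fint_linear (n := k)). Qed.

Lemma fI_deg k n (f : 'I_k.+1 -> 'I_n.+1) d (a : Omega K n) :
  fdeg d a -> d != k -> fI f a = 0.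
Proof. by move=> h dk; apply: (fint_deg (fdeg_fpull h)). Qed.

(** Simpliciality moves [s] to the simplex over which one integrates. Hence the Whitney projection
    kills the image of [s]. *)
Lemma fI_gauge k n (f : 'I_k.+1 -> 'I_n.+1) (a : Omega K n) :
  {homo f : i j / (i <= j)%N} -> fI f (s a) = 0.
Proof. by move=> hf; rewrite fIE -gauge_fpull // fint_gauge. Qed.

Lemma strict_homo k n (f : 'I_k.+1 -> 'I_n.+1) :
  [forall p : 'I_k.+1, forall q : 'I_k.+1, (p < q)%N ==> (f p < f q)%N] ->
  {homo f : i j / (i <= j)%N}.
Proof.
move=> /forallP h p q; rewrite leq_eqVlt => /orP[/eqP/val_inj->//|pq].
by have /forallP/(_ q)/implyP/(_ pq)/ltnW := h p.
Qed.

Lemma strict_inj k n (f : 'I_k.+1 -> 'I_n.+1) :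
  [forall p : 'I_k.+1, forall q : 'I_k.+1, (p < q)%N ==> (f p < f q)%N] -> injective f.
Proof.
move=> /forallP h p q e.
have lt (x y : 'I_k.+1) : (x < y)%N -> (f x < f y)%N by have /forallP/(_ y)/implyP := h x.
case: (ltngtP p q) => [/lt|/lt|/val_inj //]; by rewrite e ltnn.
Qed.

Lemma whitneyP_gauge n (a : Omega K n) : whitneyP (s a) = 0.
Proof.
rewrite whitneyPE; apply: big1 => k _; apply: big1 => i /strict_homo hi.
by rewrite fI_gauge // scale0r.
Qed.

Variables (m : nat) (i : 'I_m.+2).

Let top := fun j : 'I_m.+2 => j.
Let face : 'I_m.+1 -> 'I_m.+2 := lift i.
Let W := whitney K top.
Let w := whitney K face.
Let c : K := (-1) ^+ i.

Definition horn_vanish (a : Omega K m.+1) := forall j, j != i -> fpull (lift j) a = 0.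

Lemma homo_lift (j : 'I_m.+2) : {homo lift j : p q / (p <= q)%N}.
Proof. by move=> p q; rewrite /= /bump; do 2!case: leqP => //=; lia. Qed.

(** A map that misses the vertex [j] factors through the face opposite [j], where the form is
    zero. *)
Lemma fI_horn_vanish k (f : 'I_k.+1 -> 'I_m.+2) (a : Omega K m.+1) (j : 'I_m.+2) :
  horn_vanish a -> j != i -> (forall p, f p != j) -> fI f a = 0.
Proof.
move=> ha ji fj.
have h p : exists q, f p == lift j q by case: (unliftP j (f p)) (fj p) => [q -> _|->]; [exists q|rewrite eqxx].
pose h' p := xchoose (h p).
have e : (fun p => lift j (h' p)) =1 f by move=> p; rewrite -(eqP (xchooseP (h p))).
by rewrite fIE -(eq_fpull _ e) -fpull_comp // ha // (lin0 (@fpull_linear K _ _ _)) (lin0 (@fint_linear K _)).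
Qed.

Lemma strict_eq k n (f g : 'I_k.+1 -> 'I_n.+1) :
  [forall p : 'I_k.+1, forall q : 'I_k.+1, (p < q)%N ==> (f p < f q)%N] ->
  [forall p : 'I_k.+1, forall q : 'I_k.+1, (p < q)%N ==> (g p < g q)%N] ->
  f @: setT =i g @: setT -> f =1 g.
Proof.
have srt (h : 'I_k.+1 -> 'I_n.+1) :
    [forall p : 'I_k.+1, forall q : 'I_k.+1, (p < q)%N ==> (h p < h q)%N] ->
    sorted (fun x y : 'I_n.+1 => (x < y)%N) [seq h p | p <- enum 'I_k.+1].
  move=> /forallP sh; rewrite sorted_map; apply: sub_sorted (sorted_enum_ord k.+1) => x y.
  by have /forallP/(_ y)/implyP := sh x.
move=> sf sg e p; have : [seq f p | p <- enum 'I_k.+1] = [seq g p | p <- enum 'I_k.+1].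
  apply: (irr_sorted_eq (@ltno_trans n.+1)); rewrite ?srt //; first by move=> x; exact: ltnn.
  move=> y; have := e y.
  have mem (h : 'I_k.+1 -> 'I_n.+1) : (y \in h @: setT) = (y \in [seq h p | p <- enum 'I_k.+1]).
    apply/imsetP/mapP => -[q]; rewrite ?mem_enum => _ ->; exists q; by rewrite ?mem_enum ?inE.
  by rewrite !mem.
by move/eq_in_map; apply; rewrite mem_enum.
Qed.

Lemma fI_vanish_codom k (f : 'I_k.+1 -> 'I_m.+2) (a : Omega K m.+1) :
  horn_vanish a -> fI f a != 0 -> [set~ i] \subset f @: setT.
Proof.
move=> ha; apply: contraNT => /subsetPn[j]; rewrite !inE => ji nj; apply/eqP.
apply: (fI_horn_vanish ha ji) => p; apply: contraNneq nj => <-.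
by apply/imsetP; exists p.
Qed.

Lemma whitneyP_top n (a : Omega K n) : whitneyP a =
  \sum_(k < n) \sum_(f : {ffun 'I_k.+1 -> 'I_n.+1} |
            [forall p : 'I_k.+1, forall q : 'I_k.+1, (p < q)%N ==> (f p < f q)%N])
      fI f a *: whitney K f + fI (fun j : 'I_n.+1 => j) a *: whitney K (fun j : 'I_n.+1 => j).
Proof.
rewrite whitneyPE big_ord_recr; apply: (congr1 (+%R _)).
have e0 : [ffun p : 'I_n.+1 => p] =1 id by move=> p; rewrite ffunE.
have s0 : [forall p : 'I_n.+1, forall q : 'I_n.+1, (p < q)%N ==>
    ([ffun p : 'I_n.+1 => p] p < [ffun p : 'I_n.+1 => p] q)%N].
  by apply/forallP => p; apply/forallP => q; rewrite !ffunE; apply/implyP.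
rewrite (bigD1 [ffun p : 'I_n.+1 => p]) //= big1 ?addr0 => [|f /andP[sf nf]].
  by rewrite !fIE (eq_fpull _ e0) (eq_whitney K e0).
case/eqP: nf; apply/ffunP; apply: strict_eq => //.
have full (g : 'I_n.+1 -> 'I_n.+1) : injective g -> g @: setT = setT.
  by move=> ig; apply/eqP; rewrite eqEcard subsetT card_imset ?leqnn.
by move=> y; rewrite (full _ (strict_inj sf)) (full _ (strict_inj s0)).
Qed.

(** A nonzero coefficient requires a chain through all vertices other than [i]; the only increasing
    ones are the simplex itself and its face opposite [i]. *)
Lemma whitneyP_horn (a : Omega K m.+1) : horn_vanish a ->
  whitneyP a = fI top a *: W + fI face a *: w.
Proof.
move=> ha; rewrite whitneyP_top big_ord_recr /= -/top -/W.
have cardi : #|[set~ i]| = m.+1 by rewrite cardsC1 card_ord.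
rewrite big1 ?add0r => [|k _]; last first.
  apply: big1 => f sf; apply/eqP; rewrite scaler_eq0; apply/orP; left.
  apply/negPn/negP => /(fI_vanish_codom ha)/subset_leq_card.
  rewrite card_imset; last exact: strict_inj.
  by rewrite cardi cardsT card_ord ltnNge ltn_ord.
rewrite addrC; apply: (congr1 (+%R _)).
have e0 : [ffun p => face p] =1 face by move=> p; rewrite ffunE.
have s0 : [forall p : 'I_m.+1, forall q : 'I_m.+1, (p < q)%N ==>
    ([ffun p => face p] p < [ffun p => face p] q)%N].
  apply/forallP => p; apply/forallP => q; rewrite !ffunE; apply/implyP.
  by rewrite /face /= /bump; do 2!case: leqP => //=; lia.
rewrite (bigD1 [ffun p => face p]) //= big1 ?addr0 => [|f /andP[sf nf]].
  by rewrite !fIE (eq_fpull _ e0) (eq_whitney K e0).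
apply/eqP; rewrite scaler_eq0; apply/orP; left; apply/negPn/negP => /(fI_vanish_codom ha) sub.
case/eqP: nf; apply/ffunP; apply: strict_eq => //.
have eqi (g : 'I_m.+1 -> 'I_m.+2) : injective g -> [set~ i] \subset g @: setT -> g @: setT = [set~ i].
  by move=> ig sg; apply/esym/eqP; rewrite eqEcard sg (card_imset _ ig) cardi cardsT card_ord leqnn.
have sub0 : [set~ i] \subset [ffun p => face p] @: setT.
  apply/subsetP => j; rewrite !inE eq_sym => /unlift_some[q -> _].
  by apply/imsetP; exists q; rewrite ?inE ?ffunE.
by move=> y; rewrite (eqi _ (strict_inj sf) sub) (eqi _ (strict_inj s0) sub0).
Qed.

Lemma whitney_face_vanish : horn_vanish w.
Proof.
move=> j; rewrite eq_sym => /unlift_some[p e _].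
by apply: (fpull_whitney_missing charK (p := p)) => q; rewrite /face -e eq_sym neq_lift.
Qed.

Lemma whitney_top_vanish : horn_vanish W.
Proof.
move=> j _; have h : fdeg m.+1%:Z (fpull (lift j) W) by apply: fdeg_fpull; exact: fdeg_whitney.
by apply: fdeg_gt h; rewrite ltz_nat.
Qed.

Lemma fI_top_top : fI top W = 1.
Proof. by rewrite fIE fpull_id (fint_whitney charK). Qed.

Lemma fI_top_face : fI top w = 0.
Proof. by apply: (fI_deg top (@fdeg_whitney K _ _ face)); rewrite eqz_nat ltn_eqF. Qed.

Lemma fI_face_face : fI face w = 1.
Proof. by rewrite fIE (fpull_whitney_inj charK) ?(fint_whitney charK) //; exact: lift_inj. Qed.

Lemma fI_face_top : fI face W = 0.
Proof. by apply: (fI_deg face (@fdeg_whitney K _ _ top)); rewrite eqz_nat gtn_eqF. Qed.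

Lemma fdiff_face : fdiff w = c *: W.
Proof. exact: (fdiff_whitney_face charK). Qed.

Lemma fdiff_top : fdiff W = 0.
Proof.
have h : fdeg (m.+1%:Z + 1) (fdiff W) by apply: fdeg_fdiff; exact: fdeg_whitney.
by apply: fdeg_gt h; lia.
Qed.

Lemma sign_sqr : c * c = 1.
Proof. by rewrite -expr2 sqrr_sign. Qed.

Lemma fI_whitneyP (a : Omega K m.+1) : fI top (whitneyP a) = fI top a.
Proof.
rewrite whitneyP_top (linD (@fI_linear _ _ top)) (linZ (@fI_linear _ _ top) _ W) fI_top_top.
rewrite (lin_sum _ _ _ (@fI_linear _ _ top)) big1 ?add0r => [|k _].
  by rewrite /GRing.scale /= mulr1.
rewrite (lin_sum _ _ _ (@fI_linear _ _ top)) big1 // => f _.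
rewrite (linZ (@fI_linear _ _ top) _ (whitney K f)).
rewrite (fI_deg top (@fdeg_whitney K _ _ f)) ?scaler0 //.
by rewrite eqz_nat ltn_eqF.
Qed.

Lemma fdiff_vanish (a : Omega K m.+1) : horn_vanish a -> horn_vanish (fdiff a).
Proof.
by move=> ha j ji; rewrite (fpull_fdiff charK) (ha _ ji) (lin0 (@fdiff_linear K _)).
Qed.

Definition horn_contr : Omega K m.+1 -> Omega K m.+1 := hcontr (@s _) (fI top) w c.

Lemma horn_contrE a : horn_contr a = s a + fI top a *: (c *: w).
Proof. by []. Qed.

Lemma horn_contr_linear : linear horn_contr.
Proof. exact: (hcontr_linear _ _ (@gauge_linear _) (@fI_linear _ _ top)). Qed.

Lemma horn_contr_deg k (a : Omega K m.+1) : fdeg k a -> fdeg (k - 1) (horn_contr a).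
Proof.
move=> ha; rewrite horn_contrE; apply: fdegD; first exact: gauge_deg.
have [->|km] := eqVneq k m.+1%:Z.
  do 2!apply: fdegZ; have -> : m.+1%:Z - 1 = m%:Z by lia.
  exact: fdeg_whitney.
by rewrite (fI_deg top ha) // scale0r; exact: fdeg0.
Qed.

(** [w] vanishes on the faces of the horn, so the correction is invisible there and only the
    simpliciality of [s] matters. Hence the faces of a solution solve the equation for [s] in one
    dimension less. *)
Lemma horn_contr_face j a : j != i -> fpull (lift j) (horn_contr a) = s (fpull (lift j) a).
Proof.
move=> ji; rewrite horn_contrE (linD (@fpull_linear K _ _ _)) (linZ (@fpull_linear K _ _ _)).
rewrite (linZ (@fpull_linear K _ _ _) _ w).
rewrite (whitney_face_vanish ji) !scaler0 addr0 gauge_fpull; [by []|exact: homo_lift].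
Qed.

Let fI_s a : fI top (s a) = 0. Proof. exact: fI_gauge. Qed.

Lemma horn_contr_sqr a : horn_contr (horn_contr a) = 0.
Proof.
exact: (hcontr_sqr c (@fdiff_linear K _) (@gauge_linear _) (@fI_linear _ _ top)
  (@gauge_sqr _) (@gauge_homotopy _) (@whitneyP_gauge _) fI_s whitneyP_horn
  whitney_face_vanish fI_top_face fI_face_face).
Qed.

Lemma horn_contr_homotopy a : horn_vanish a ->
  a = fdiff (horn_contr a) + horn_contr (fdiff a).
Proof.
exact: (hcontr_homotopy (@fdiff_linear K _) (@gauge_linear _) (@fI_linear _ _ top)
  (@fdiff_sqr K charK _) (@gauge_homotopy _) whitneyP_horn (@fdiff_vanish)
  fI_top_top fI_top_face fdiff_face fdiff_top sign_sqr).
Qed.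

Lemma horn_contr_diff a : horn_contr (fdiff (horn_contr a)) = horn_contr a.
Proof.
exact: (hcontr_diff (@fdiff_linear K _) (@gauge_linear _) (@fI_linear _ _ top)
  (@gauge_sqr _) (@gauge_homotopy _) (@whitneyP_gauge _) fI_s fI_whitneyP whitneyP_horn
  whitney_top_vanish fI_top_top fI_face_top fdiff_face sign_sqr).
Qed.

(** [s a] integrates to zero over the face and [w] to one. The integral of [a] can thus be recovered
    from [horn_contr a], which [horn_contr_kernel] exploits. *)
Lemma fI_face_horn_contr a : c * fI face (horn_contr a) = fI top a.
Proof.
rewrite horn_contrE (linD (@fI_linear _ _ face)) (linZ (@fI_linear _ _ face)).
rewrite (linZ (@fI_linear _ _ face) _ w) fI_face_face fI_gauge; last exact: homo_lift.
by rewrite /GRing.scale /= add0r mulr1 mulrCA sign_sqr mulr1.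
Qed.

End HornContraction.

(** * Tensors with forms and maps acting on one factor *)

Section LinearExtension.
Variables (K : fieldType) (B : choiceType) (V W : lmodType K).
Implicit Types (u v : btens V B) (F : B -> V -> W).

Lemma btensP u v : (forall b, fcoef u b = fcoef v b) -> u = v.
Proof. by move=> h; apply/monalg.malgP. Qed.

Lemma fcoef_linear b : linear (fun u : btens V B => fcoef u b).
Proof. by move=> c u v; rewrite monalg.mcoeffD bscaleE. Qed.

Lemma fcoef_lin b c u v : fcoef (c *: u + v) b = c *: fcoef u b + fcoef v b.
Proof. exact: fcoef_linear. Qed.

Lemma fcoef_fsingle b x b' :
  fcoef (fsingle b x : btens V B) b' = if b == b' then x else 0.
Proof. by rewrite monalg.mcoeffU; case: eqP. Qed.

Lemma fsingle_linear b : linear (fun x => fsingle b x : btens V B).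
Proof.
move=> c x y; apply: btensP => b'; rewrite (fcoef_linear b') !fcoef_fsingle.
by case: eqP; rewrite ?scaler0 ?addr0.
Qed.

(** The linear map induced by a family of linear maps; the actions [tmap] and [teval] and all sums
    over [texpand] are instances. *)
Definition lext F u : W := \sum_(b <- fsupp u) F b (fcoef u b).

(** Indices outside the support contribute [F b 0] = 0, so that elements with different supports can
    be summed over a common list. *)
Lemma lext_widen F u (s : seq B) : (forall b, linear (F b)) -> uniq s ->
  {subset (fsupp u : seq B) <= s} -> lext F u = \sum_(b <- s) F b (fcoef u b).
Proof.
move=> lF us sub; rewrite [RHS](bigID (mem (fsupp u))) /= [X in _ + X]big1 ?addr0.
  rewrite -[RHS]big_filter; apply: perm_big; apply: uniq_perm.
  - exact: fset_uniq.
  - exact: filter_uniq.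
  by move=> b; rewrite mem_filter; case: (boolP (b \in fsupp u)) => // /sub.
by move=> b nb; rewrite monalg.mcoeff_outdom // (lin0 (lF b)).
Qed.

Lemma lext_linear F : (forall b, linear (F b)) -> linear (lext F).
Proof.
move=> lF c u v.
pose s := undup (fsupp u ++ fsupp v ++ fsupp (c *: u + v)).
have us : uniq s by exact: undup_uniq.
rewrite (lext_widen (s := s) lF us) => [|b bs]; last by rewrite mem_undup !mem_cat bs !orbT.
rewrite (lext_widen (s := s) (u := u) lF us) => [|b bs]; last by rewrite mem_undup !mem_cat bs.
rewrite (lext_widen (s := s) (u := v) lF us) => [|b bs]; last by rewrite mem_undup !mem_cat bs orbT.
rewrite scaler_sumr -big_split; apply: eq_bigr => b _ /=.
by rewrite (fcoef_linear b) lF.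
Qed.

Lemma lext_fsingle F b x : (forall b, linear (F b)) -> lext F (fsingle b x) = F b x.
Proof.
move=> lF; rewrite (lext_widen (s := [:: b])) ?big_seq1 ?fcoef_fsingle ?eqxx // => b'.
by rewrite inE monalg.msuppU; case: ifP => _; rewrite !inE.
Qed.

Lemma eq_lext F F' u : (forall b x, F b x = F' b x) -> lext F u = lext F' u.
Proof. by move=> e; apply: eq_bigr => b _; rewrite e. Qed.
End LinearExtension.

Lemma btensE (K : fieldType) (B : choiceType) (V : lmodType K) (u : btens V B) :
  u = \sum_(b <- fsupp u) (fsingle b (fcoef u b) : btens V B).
Proof. exact: monalg.monalgE. Qed.

Lemma btens_lin_ext (K : fieldType) (B : choiceType) (V W : lmodType K)
    (f h : btens V B -> W) :
  linear f -> linear h -> (forall b x, f (fsingle b x) = h (fsingle b x)) -> f =1 h.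
Proof.
move=> lf lh e u; rewrite (btensE u) (lin_sum _ _ _ lf) (lin_sum _ _ _ lh).
by apply: eq_bigr => b _.
Qed.

(* Conversion tests between sums over forms are prohibitively slow, hence the
   sealed copies of [tens] and [tmap]. *)
HB.lock Definition ptens (K : fieldType) (g : linfData K) n (x : g) (a : Omega K n) :
  btens g (formB n) := tens x a.
HB.lock Definition formmap (K : fieldType) (g : linfData K) n k
  (f : Omega K n -> Omega K k) (u : btens g (formB n)) : btens g (formB k) := tmap f u.

Section Tensors.
Variables (K : fieldType) (g : linfData K).
Notation gforms n := (btens g (formB n)).

Lemma fbaseE n (b : formB n) (S : {set 'I_n}) m :
  (@fbase K n b S)@_m = if b == (m, S) then 1 else 0.
Proof.
case: b => m' S'; rewrite /fbase fmonE /= xpair_eqE [S == S']eq_sym andbC.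
by case: (S' == S) => /=; rewrite ?mcoeff0 // mcoeffX; case: eqP.
Qed.

Lemma form_fbase n (a : Omega K n) :
  a = \sum_(S : {set 'I_n}) \sum_(m <- msupp (a S)) (a S)@_m *: fbase K (m, S).
Proof.
rewrite {1}(form_fmon a); apply: eq_bigr => S _.
rewrite {1}(mpolyE (a S)) (lin_sum _ _ _ (@fmon_linear K n S)); apply: eq_bigr => m _.
by rewrite (linZ (@fmon_linear K n S)).
Qed.

Lemma fcoef_ptens n (x : g) (a : Omega K n) b : fcoef (ptens x a) b = (a b.2)@_b.1 *: x.
Proof.
rewrite ptens.unlock.
rewrite /tens (lin_sum _ _ _ (@fcoef_linear K _ g b)) (bigD1 b.2) //=.
rewrite [X in _ + X]big1 ?addr0 => [|S /negPf nS]; last first.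
  rewrite (lin_sum _ _ _ (@fcoef_linear K _ g b)); apply: big1 => m _.
  by rewrite fcoef_fsingle; case: eqP => // e; rewrite -e /= eqxx in nS.
rewrite (lin_sum _ _ _ (@fcoef_linear K _ g b)).
have [mb|mb] := boolP (b.1 \in msupp (a b.2)).
  rewrite (bigD1_seq b.1) ?msupp_uniq //= big1 ?addr0 => [|m /negPf nm].
    by rewrite fcoef_fsingle -surjective_pairing eqxx.
  by rewrite fcoef_fsingle; case: eqP => // e; rewrite -e /= eqxx in nm.
rewrite memN_msupp_eq0 // scale0r big_seq big1 // => m mm.
by rewrite fcoef_fsingle; case: eqP => // e; rewrite -e /= mm in mb.
Qed.

Lemma ptens_linearl n (a : Omega K n) : linear (fun x : g => ptens x a).
Proof.
move=> c x y; apply: btensP => b; rewrite [LHS]fcoef_ptens [RHS]fcoef_lin.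
rewrite (fcoef_ptens x) (fcoef_ptens y).
by rewrite scalerDr !scalerA mulrC.
Qed.

Lemma ptens_linearr n (x : g) : linear (@ptens K g n x).
Proof.
move=> c a a'; apply: btensP => b; rewrite [LHS]fcoef_ptens [RHS]fcoef_lin.
rewrite (fcoef_ptens x a) (fcoef_ptens x a').
by rewrite !ffunE mcoeffD mcoeffZ scalerDl scalerA.
Qed.

Lemma ptens_fbase n (x : g) (b : formB n) : ptens x (fbase K b) = fsingle b x.
Proof.
apply: btensP => b'; rewrite fcoef_ptens fcoef_fsingle fbaseE -surjective_pairing.
by case: ifP; rewrite ?scale1r ?scale0r.
Qed.

Lemma tens_lin_ext n (W : lmodType K) (f h : Omega K n -> W) :
  linear f -> linear h -> (forall b, f (fbase K b) = h (fbase K b)) -> f =1 h.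
Proof.
move=> lf lh e a; rewrite (form_fbase a) (lin_sum _ _ _ lf) (lin_sum _ _ _ lh).
apply: eq_bigr => S _; rewrite (lin_sum _ _ _ lf) (lin_sum _ _ _ lh).
by apply: eq_bigr => m _; rewrite (linZ lf) (linZ lh) e.
Qed.

Lemma formmapE n k (f : Omega K n -> Omega K k) (u : gforms n) :
  formmap f u = lext (fun b x => ptens x (f (fbase K b))) u.
Proof.
rewrite formmap.unlock; apply: eq_bigr => b _.
by rewrite ptens.unlock.
Qed.

Lemma formmap_linear n k (f : Omega K n -> Omega K k) : linear (formmap f : gforms n -> gforms k).
Proof.
move=> c u v; rewrite !formmapE; apply: lext_linear => b; exact: ptens_linearl.
Qed.

Lemma formmap_fsingle n k (f : Omega K n -> Omega K k) b x :
  formmap f (fsingle b x : gforms n) = ptens x (f (fbase K b)).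
Proof. by rewrite formmapE lext_fsingle // => b'; exact: ptens_linearl. Qed.

Lemma formmap_ptens n k (f : Omega K n -> Omega K k) x a : linear f ->
  formmap f (ptens x a : gforms n) = ptens x (f a) :> gforms k.
Proof.
move=> lf; apply: (tens_lin_ext (f := fun a => formmap f (ptens x a)) (h := fun a => ptens x (f a))).
- by move=> c a1 a2; rewrite (@ptens_linearr n x) (@formmap_linear n k f).
- by move=> c a1 a2; rewrite lf (@ptens_linearr k x).
by move=> b; rewrite ptens_fbase formmap_fsingle.
Qed.

Lemma formmap_comp n k l (f : Omega K k -> Omega K l) (h : Omega K n -> Omega K k)
    (u : gforms n) : linear f -> formmap f (formmap h u) = formmap (fun a => f (h a)) u.
Proof.
move=> lf; rewrite !(formmapE _ u) (lin_sum _ _ _ (@formmap_linear _ _ f)).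
by apply: eq_bigr => b _; rewrite formmap_ptens.
Qed.

Lemma eq_formmap n k (f h : Omega K n -> Omega K k) (u : gforms n) :
  f =1 h -> formmap f u = formmap h u.
Proof. by move=> e; rewrite !formmapE; apply: eq_lext => b x; rewrite e. Qed.

Lemma formmap_id n (u : gforms n) : formmap id u = u.
Proof.
rewrite [RHS]btensE formmapE; apply: eq_bigr => b _; exact: ptens_fbase.
Qed.

Lemma formmapD n k (f h : Omega K n -> Omega K k) (u : gforms n) :
  formmap (fun a => f a + h a) u = formmap f u + formmap h u.
Proof.
by rewrite !formmapE -big_split; apply: eq_bigr => b _; rewrite (linD (@ptens_linearr k _)).
Qed.

Lemma formmapZ n k c (f : Omega K n -> Omega K k) (u : gforms n) :
  formmap (fun a => c *: f a) u = c *: formmap f u.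
Proof.
by rewrite !formmapE scaler_sumr; apply: eq_bigr => b _; rewrite (linZ (@ptens_linearr k _)).
Qed.

Lemma formmap0 n k (u : gforms n) : formmap (fun=> 0 : Omega K k) u = 0.
Proof.
by rewrite formmapE; apply: big1 => b _; rewrite (lin0 (@ptens_linearr k _)).
Qed.

Lemma teval_linear n (I : Omega K n -> K) : linear (teval I : gforms n -> g).
Proof.
apply: (@lext_linear K _ g g (fun b x => I (fbase K b) *: x)) => b c x y.
by rewrite scalerDr !scalerA mulrC.
Qed.

Lemma teval_ptens n (I : Omega K n -> K^o) x a : linear I -> teval I (ptens x a : gforms n) = I a *: x.
Proof.
move=> lI; apply: (tens_lin_ext (f := fun a => teval I (ptens x a)) (h := fun a => I a *: x)).
- by move=> c a1 a2; rewrite (@ptens_linearr n x) (@teval_linear n I).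
- by move=> c a1 a2; rewrite lI scalerDl scalerA.
move=> b; rewrite ptens_fbase.
apply: (@lext_fsingle K _ g g (fun b x => I (fbase K b) *: x)) => b' c y z.
by rewrite scalerDr !scalerA mulrC.
Qed.

Lemma teval_formmap n k (I : Omega K k -> K^o) (f : Omega K n -> Omega K k) (u : gforms n) :
  linear I -> teval I (formmap f u) = teval (fun a => I (f a)) u.
Proof.
move=> lI; rewrite formmapE (lin_sum _ _ _ (@teval_linear _ I)).
by apply: eq_bigr => b _; rewrite teval_ptens.
Qed.

Lemma eq_teval n (I J : Omega K n -> K) (u : gforms n) : I =1 J -> teval I u = teval J u.
Proof. by move=> e; apply: eq_bigr => b _; rewrite e. Qed.

Lemma formmap_scale n k (I : Omega K n -> K) (a : Omega K k) (u : gforms n) :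
  formmap (fun a' => I a' *: a) u = ptens (teval I u) a.
Proof.
rewrite formmapE /teval (lin_sum _ _ _ (@ptens_linearl k a)); apply: eq_bigr => b _.
by rewrite (linZ (@ptens_linearr k _)) (linZ (@ptens_linearl k a)).
Qed.

End Tensors.

(** * The grading of the tensor product *)

Section Grading.
Variables (K : fieldType) (g : linfData K).
Hypothesis hg : isLinf g.
Notation gforms n := (btens g (formB n)).

Lemma hcomp_linear : linear (fun x : g => hcomp x : btens g int).
Proof. by move=> c x y; apply: btensP => i; rewrite (linf_hcomp_linear hg) fcoef_lin. Qed.

Lemma hcompi_linear i : linear (fun x : g => fcoef (hcomp x) i).
Proof. by move=> c x y; rewrite (linf_hcomp_linear hg). Qed.

Lemma hasdeg_hcomp i (x : g) : hasdeg i x -> hcomp x = fsingle i x.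
Proof.
rewrite /hasdeg => h; apply: btensP => j; rewrite fcoef_fsingle.
by rewrite -{1}h (linf_hcompK hg) h.
Qed.

Lemma hasdeg_component i (x : g) : hasdeg i (fcoef (hcomp x) i).
Proof. by rewrite /hasdeg (linf_hcompK hg) eqxx. Qed.

Lemma hasdeg0 i : hasdeg i (0 : g).
Proof. exact: lin0 (hcompi_linear i). Qed.

Lemma hasdeg_lin i c (x y : g) : hasdeg i x -> hasdeg i y -> hasdeg i (c *: x + y).
Proof. by rewrite /hasdeg => hx hy; rewrite (linf_hcomp_linear hg) hx hy. Qed.

Lemma hasdegZ i c (x : g) : hasdeg i x -> hasdeg i (c *: x).
Proof. by move=> hx; rewrite -[c *: x]addr0; apply: hasdeg_lin => //; exact: hasdeg0. Qed.

Lemma homog_lin_ext (W : lmodType K) (f h : g -> W) : linear f -> linear h ->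
  (forall i x, hasdeg i x -> f x = h x) -> f =1 h.
Proof.
move=> lf lh e x; rewrite -(linf_hcomp_sum hg x) (lin_sum _ _ _ lf) (lin_sum _ _ _ lh).
by apply: eq_bigr => i _; apply: (e i); exact: hasdeg_component.
Qed.

Section Expand.
Variable n : nat.
Implicit Types (u v : gforms n) (t : int * g * formB n).

Lemma texpand_sum (W : lmodType K) (Psi : int * g * formB n -> W) u :
  \sum_(t <- texpand u) Psi t =
  lext (fun b x => lext (fun i y => Psi (i, y, b)) (hcomp x : btens g int)) u.
Proof. by rewrite /texpand big_allpairs_dep. Qed.

Definition expand_lin (W : lmodType K) (Psi : int * g * formB n -> W) :=
  forall i b, linear (fun x => Psi (i, x, b)).

Lemma texpand_linear (W : lmodType K) (Psi : int * g * formB n -> W) : expand_lin Psi ->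
  linear (fun u => \sum_(t <- texpand u) Psi t).
Proof.
move=> lP c u v; rewrite !texpand_sum; apply: lext_linear => b {c u v} c x y.
by rewrite hcomp_linear; apply: lext_linear => i; exact: lP.
Qed.

Lemma texpand_fsingle (W : lmodType K) (Psi : int * g * formB n -> W) i b x :
  expand_lin Psi -> hasdeg i x -> \sum_(t <- texpand (fsingle b x)) Psi t = Psi (i, x, b).
Proof.
move=> lP hx; rewrite texpand_sum lext_fsingle => [|b' {hx x} c x y].
  by rewrite (hasdeg_hcomp hx) lext_fsingle // => j; exact: lP.
by rewrite hcomp_linear; apply: lext_linear => j; exact: lP.
Qed.

(** Signs make [Th] depend on the degrees in a non-linear way, so these are separate arguments.
    Linearity in the vector and in the form recombines the monomials of [a], all of degree [p]. *)
Lemma texpand_ptens (W : lmodType K) (Th : int -> int -> g -> Omega K n -> W) i p x a :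
  (forall j q y, linear (Th j q y)) -> (forall j q c, linear (fun y => Th j q y c)) ->
  hasdeg i x -> fdeg p a ->
  \sum_(t <- texpand (ptens x a)) Th t.1.1 #|t.2.2|%:Z t.1.2 (fbase K t.2) = Th i p x a.
Proof.
move=> l1 l2 hx ha.
pose Psi (t : int * g * formB n) := Th t.1.1 #|t.2.2|%:Z t.1.2 (fbase K t.2).
have lP : expand_lin Psi by move=> j b c y z; exact: l2.
rewrite {1}(form_fbase a) (lin_sum _ _ _ (@ptens_linearr K g n x)).
rewrite (lin_sum _ _ _ (texpand_linear lP)).
rewrite [in RHS](form_fbase a) (lin_sum _ _ _ (l1 i p x)); apply: eq_bigr => S _.
rewrite (lin_sum _ _ _ (@ptens_linearr K g n x)) (lin_sum _ _ _ (texpand_linear lP)).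
rewrite (lin_sum _ _ _ (l1 i p x)).
have [->|/ha <-] := eqVneq (a S) 0; first by rewrite msupp0 !big_nil.
apply: eq_bigr => m _.
rewrite (linZ (@ptens_linearr K g n x)) (linZ (texpand_linear lP)) (linZ (l1 i _ x)).
by rewrite ptens_fbase (texpand_fsingle _ lP hx).
Qed.

Lemma texpand_hasdeg u t : t \in texpand u -> hasdeg t.1.1 t.1.2.
Proof. by case/allpairsPdep => b [i [_ _ ->]]; exact: hasdeg_component. Qed.

(** Total degree tested on coefficients; [tdegP] identifies it with [hasdeg] for [tensLinf g n],
    whose components are defined through [texpand]. *)
Definition tdeg m u := forall b : formB n, hasdeg (m - #|b.2|%:Z) (fcoef u b).

Lemma texpand_tdeg m u t : tdeg m u -> t \in texpand u ->
  [/\ t.1.1 = m - #|t.2.2|%:Z, t.1.2 = fcoef u t.2 & t.2 \in fsupp u].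
Proof.
move=> hu /allpairsPdep[b [i [bu ix ->]]] /=.
have hb := hu b; rewrite (hasdeg_hcomp hb) in ix *.
move: ix; rewrite monalg.msuppU; case: ifP => [_|_]; rewrite ?inE // => /eqP ->.
by rewrite monalg.mcoeffUU.
Qed.

Lemma texpand_homog (W : lmodType K) (Psi : int * g * formB n -> W) m u :
  expand_lin Psi -> tdeg m u ->
  \sum_(t <- texpand u) Psi t = \sum_(b <- fsupp u) Psi (m - #|b.2|%:Z, fcoef u b, b).
Proof.
move=> lP hu; rewrite texpand_sum; apply: eq_bigr => b _.
by rewrite (hasdeg_hcomp (hu b)) lext_fsingle // => j; exact: lP.
Qed.

Lemma tensor_lin_ext (W : lmodType K) (f h : gforms n -> W) : linear f -> linear h ->
  (forall i b x, hasdeg i x -> f (fsingle b x) = h (fsingle b x)) -> f =1 h.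
Proof.
move=> lf lh e; apply: (btens_lin_ext lf lh) => b.
apply: (homog_lin_ext (f := fun x => f (fsingle b x)) (h := fun x => h (fsingle b x))).
- by move=> c x y; rewrite (@fsingle_linear K _ g b) lf.
- by move=> c x y; rewrite (@fsingle_linear K _ g b) lh.
by move=> i x hx; exact: (e i).
Qed.

Lemma fcoef_tcomp u m b :
  fcoef (fcoef (tcomp u) m) b = fcoef (hcomp (fcoef u b)) (m - #|b.2|%:Z).
Proof.
pose phi (i : int) (b' : formB n) (x : g) : g :=
  if i + #|b'.2|%:Z == m then fcoef (fsingle b' x : gforms n) b else 0.
have lphi i b' : linear (phi i b').
  move=> c x y; rewrite /phi; case: (_ == m); last by rewrite scaler0 addr0.
  exact: (lin_comp (@fcoef_linear K _ g b) (@fsingle_linear K _ g b')).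
pose Psi (t : int * g * formB n) : g := phi t.1.1 t.2 t.1.2.
have lP : expand_lin Psi by move=> i b' c x y; exact: lphi.
transitivity (\sum_(t <- texpand u) Psi t).
  rewrite /tcomp (raddf_sum (@monalg.mcoeff _ _ m)) (raddf_sum (@monalg.mcoeff _ _ b)).
  apply: eq_bigr => t _; rewrite /Psi /phi.
  apply: (etrans (congr1 (monalg.mcoeff b) (monalg.mcoeffU _ _ _))).
  by case: (_ == m) => //; exact: monalg.mcoeff0.
apply: (tensor_lin_ext (f := fun u => \sum_(t <- texpand u) Psi t)
   (h := fun u => fcoef (hcomp (fcoef u b)) (m - #|b.2|%:Z))).
- exact: texpand_linear.
- by move=> c v w; rewrite fcoef_lin (hcompi_linear _).
move=> i b' x hx; rewrite (texpand_fsingle _ lP hx) /Psi /phi.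
rewrite (fcoef_fsingle b' x b : fcoef (fsingle b' x : gforms n) b = _).
case: (eqVneq b' b) => [<-|_]; last by rewrite (lin0 (hcompi_linear _)); case: (_ == m).
by rewrite (hasdeg_hcomp hx) fcoef_fsingle eq_sym -subr_eq eq_sym.
Qed.

Lemma tdegP m u : @hasdeg K (tensLinf g n) m u <-> tdeg m u.
Proof.
split=> [h b|h]; first by rewrite /hasdeg -fcoef_tcomp; congr (fcoef _ b).
by apply: btensP => b; rewrite fcoef_tcomp; exact: h.
Qed.

End Expand.
End Grading.

(** * Brackets of pure tensors and their multilinear extension *)

Section Signs.
Variable K : fieldType.

Lemma signzD (a b : int) : (-1 : K) ^ (a + b) = (-1) ^ a * (-1) ^ b.
Proof. by rewrite expfzDr // oppr_eq0 oner_eq0. Qed.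

Lemma signz2 (a : int) : (-1 : K) ^ (a + a) = 1.
Proof. by rewrite signzD -expfzMl mulN1r opprK exp1rz. Qed.

(** Comparing two signs becomes a ring identity between exponents once half of their difference is
    supplied as [c]. *)
Lemma signz_eq (a b c : int) : a = b + (c + c) -> (-1 : K) ^ a = (-1) ^ b.
Proof. by move=> ->; rewrite signzD signz2 mulr1. Qed.

Lemma signzN1 (a : int) : - (-1 : K) ^ a = (-1) ^ (a + 1).
Proof. by rewrite signzD expr1z mulrN1. Qed.

End Signs.

Section Cartesian.
Variables (A : Type) (W : nmodType).

Lemma cartesian_cons (s : seq A) ss (Phi : seq A -> W) :
  \sum_(c <- cartesian (s :: ss)) Phi c =
  \sum_(x <- s) \sum_(c <- cartesian ss) Phi (x :: c).
Proof. by rewrite /= big_allpairs_dep. Qed.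

Lemma cartesian_nil (Phi : seq A -> W) : \sum_(c <- cartesian [::]) Phi c = Phi [::].
Proof. by rewrite big_seq1. Qed.

Lemma cartesian_cat (ss tt : seq (seq A)) (Phi : seq A -> W) :
  \sum_(c <- cartesian (ss ++ tt)) Phi c =
  \sum_(c <- cartesian ss) \sum_(d <- cartesian tt) Phi (c ++ d).
Proof.
elim: ss Phi => [|s ss IH] Phi; first by rewrite cartesian_nil.
rewrite cat_cons !cartesian_cons; apply: eq_bigr => x _.
exact: (IH (fun c => Phi (x :: c))).
Qed.
End Cartesian.

(* A tensor of [x] and [a] with their degrees, in the order (|x|, x, (|a|, a)). *)
Definition pure (K : fieldType) (g : linfData K) n := (int * g * (int * Omega K n))%type.

Fixpoint psign (K : fieldType) (g : linfData K) n (q : seq (pure g n)) : int :=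
  if q is y :: q' then y.2.1 * (\sum_(y' <- q') y'.1.1) + psign q' else 0.

HB.lock Definition pbr (K : fieldType) (g : linfData K) n (q : seq (pure g n)) :
    btens g (formB n) :=
  (-1 : K) ^ psign q *: ptens (br [seq y.1.2 | y <- q]) (fprod [seq y.2.2 | y <- q]).

Definition pure_of (K : fieldType) (g : linfData K) n (t : int * g * formB n) : pure g n :=
  (t.1, (#|t.2.2|%:Z, fbase K t.2)).

(* The bracket of [tbr] splits into [tbr0], the multilinear extension of the
   brackets of [g], and the differential [tdiff] of forms. *)
HB.lock Definition tbr0 (K : fieldType) (g : linfData K) n (us : seq (btens g (formB n))) :
    btens g (formB n) :=
  \sum_(c <- cartesian [seq texpand u | u <- us]) pbr [seq pure_of t | t <- c].

HB.lock Definition tdiff (K : fieldType) (g : linfData K) n (u : btens g (formB n)) :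
    btens g (formB n) :=
  \sum_(t <- texpand u) (-1 : K) ^ t.1.1 *: ptens t.1.2 (fdiff (fbase K t.2)).

Section PureBracket.
Variables (K : fieldType) (g : linfData K).
Hypothesis hg : isLinf g.
Variable n : nat.
Notation gforms := (btens g (formB n)).

Implicit Types (y : pure g n) (q : seq (pure g n)).

Definition pure_ok y := hasdeg y.1.1 y.1.2 /\ fdeg y.2.1 y.2.2.
Definition totdeg y : int := y.1.1 + y.2.1.
Definition ptens_of y : gforms := ptens y.1.2 y.2.2.

Lemma psign_cat q1 q2 : psign (q1 ++ q2) =
  psign q1 + psign q2 + (\sum_(y <- q1) y.2.1) * (\sum_(y <- q2) y.1.1).
Proof.
elim: q1 => [|y q1 IH] /=; first by rewrite big_nil mul0r addr0 add0r.
by rewrite IH big_cat big_cons /=; ring.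
Qed.

Lemma br_linear (s1 s2 : seq g) : linear (fun x => br (s1 ++ x :: s2)).
Proof. by move=> c x y; rewrite (linf_multilinear hg). Qed.

Lemma pbr_linearx q1 q2 i p a : linear (fun x => pbr (q1 ++ (i, x, (p, a)) :: q2)).
Proof.
move=> c x y; rewrite pbr.unlock !map_cat /= !psign_cat /= !big_cons /=.
rewrite br_linear (@ptens_linearl K g n) scalerDr !scalerA.
by rewrite [c * _]mulrC.
Qed.

Lemma pbr_lineara q1 q2 i x p : linear (fun a => pbr (q1 ++ (i, x, (p, a)) :: q2)).
Proof.
move=> c a b; rewrite pbr.unlock !map_cat /= !psign_cat /= !big_cons /=.
rewrite !fprod_cat /= fmul_linearl fmul_linearr (@ptens_linearr K g n) scalerDr !scalerA.
by rewrite [c * _]mulrC.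
Qed.

Lemma pbr_swap q1 y z q2 : pure_ok y -> pure_ok z ->
  pbr (q1 ++ y :: z :: q2) =
  - ((-1 : K) ^ (totdeg y * totdeg z) *: pbr (q1 ++ z :: y :: q2)).
Proof.
case: y z => [[i x] [p a]] [[j x'] [r b]] [/= hx ha] [/= hx' hb].
rewrite pbr.unlock !map_cat /= /totdeg /=.
have /eqP := linf_antisym hg [seq y.1.2 | y <- q1] [seq y.1.2 | y <- q2] hx hx'.
rewrite addr_eq0 => /eqP ->.
rewrite !fprod_cat /= !fmulA -(fmulA _ a b) (fmulC ha hb) !(fmulZl, fmulZr) !fmulA.
rewrite (linN (@ptens_linearl K g n _)) (linZ (@ptens_linearl K g n _)).
rewrite (linZ (@ptens_linearr K g n _)) scalerN !scalerA.
set s1 := (X in X *: _); set s2 := (X in _ = - (X *: _)).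
suff -> : s1 = s2 by [].
(* On the left the exponent contains p j + i j + p r, on the right (i + p)(j + r) + r i; they differ
   by -2 r i. *)
rewrite /s1 /s2 -!signzD; apply: (@signz_eq K _ _ (- (r * i))).
by rewrite !psign_cat /= !big_cons /=; ring.
Qed.

Lemma fdeg_fbase (b : formB n) : fdeg #|b.2|%:Z (fbase K b).
Proof. exact: fdeg_fmon. Qed.

Lemma pure_of_ok u t : t \in texpand u -> pure_ok (pure_of t).
Proof. by move=> tu; split; [exact: texpand_hasdeg tu|exact: fdeg_fbase]. Qed.

Lemma tsign_psign (c : seq (int * g * formB n)) :
  tsign c = psign [seq pure_of t | t <- c].
Proof. by elim: c => //= t c ->; rewrite big_map. Qed.

Lemma tbrE us : us != [::] ->
  tbr us = @tbr0 K g n us + (if us is [:: u] then @tdiff K g n u else 0).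
Proof.
case: us => // u [|v us] _; last first.
  rewrite addr0 tbr0.unlock /tbr !map_cons 2!cartesian_cons.
  apply: eq_bigr => -[[i x] b] _; rewrite [LHS]cartesian_cons [RHS]cartesian_cons.
  apply: eq_bigr => t _; apply: eq_bigr => c _.
  by rewrite pbr.unlock ptens.unlock -tsign_psign -!map_comp.
rewrite tbr0.unlock tdiff.unlock /tbr !map_cons !cartesian_cons -big_split.
apply: eq_bigr => -[[i x] b] _; rewrite !cartesian_nil pbr.unlock ptens.unlock /=.
by rewrite big_nil mulr0 addr0 expr0z scale1r fmul1r.
Qed.

Lemma tbr0_slot us1 u us2 : tbr0 (us1 ++ u :: us2) =
  \sum_(c1 <- cartesian [seq texpand u | u <- us1]) \sum_(t <- texpand u)
    \sum_(c2 <- cartesian [seq texpand u | u <- us2])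
      @pbr K g n ([seq pure_of t | t <- c1] ++ pure_of t :: [seq pure_of t | t <- c2]).
Proof.
rewrite tbr0.unlock map_cat /= cartesian_cat; apply: eq_bigr => c1 _.
rewrite cartesian_cons; apply: eq_bigr => t _; apply: eq_bigr => c2 _.
by rewrite map_cat.
Qed.

Lemma tbr0_linear us1 us2 : linear (fun u => @tbr0 K g n (us1 ++ u :: us2)).
Proof.
move=> c u v; rewrite !tbr0_slot scaler_sumr -big_split; apply: eq_bigr => c1 _.
apply: (texpand_linear hg) => i b {}c x y.
rewrite scaler_sumr -big_split; apply: eq_bigr => c2 _; exact: pbr_linearx.
Qed.

Lemma tbr0_mem0 us : 0 \in us -> @tbr0 K g n us = 0.
Proof. by case/splitPr => us1 us2; exact: lin0 (tbr0_linear us1 us2). Qed.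

Lemma texpand_pure (W : lmodType K) (Th : pure g n -> W) y :
  (forall i x p, linear (fun a => Th (i, x, (p, a)))) ->
  (forall i p a, linear (fun x => Th (i, x, (p, a)))) ->
  pure_ok y -> \sum_(t <- texpand (ptens_of y)) Th (pure_of t) = Th y.
Proof.
case: y => [[i x] [p a]] l1 l2 [/= hx ha].
rewrite -(texpand_ptens hg (Th := fun i p x a => Th (i, x, (p, a))) _ _ hx ha) //.
by apply: eq_bigr => -[[j y] b] _.
Qed.

Lemma tbr0_pure q : (forall y, y \in q -> pure_ok y) -> tbr0 [seq ptens_of y | y <- q] = pbr q.
Proof.
move=> hq; suff : forall q1, \sum_(c <- cartesian [seq texpand u | u <- [seq ptens_of y | y <- q]])
    @pbr K g n (q1 ++ [seq pure_of t | t <- c]) = pbr (q1 ++ q).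
  by move/(_ [::]); rewrite tbr0.unlock.
elim: q hq => [|y q IH] hq q1; first by rewrite cartesian_nil.
rewrite !map_cons cartesian_cons.
pose Th z := \sum_(c <- cartesian [seq texpand u | u <- [seq ptens_of y | y <- q]])
    @pbr K g n (q1 ++ z :: [seq pure_of t | t <- c]).
rewrite -[LHS]/(\sum_(t <- texpand (ptens_of y)) Th (pure_of t)) texpand_pure.
- rewrite /Th -cat_rcons -IH; first by apply: eq_bigr => c _; rewrite cat_rcons.
  by move=> z zq; apply: hq; rewrite inE zq orbT.
- move=> i x p c a b; rewrite /Th scaler_sumr -big_split; apply: eq_bigr => d _.
  exact: pbr_lineara.
- move=> i p a c x x'; rewrite /Th scaler_sumr -big_split; apply: eq_bigr => d _.
  exact: pbr_linearx.
exact/hq/mem_head.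
Qed.

Lemma tbr0_swap us1 u v us2 e f : tdeg e u -> tdeg f v ->
  tbr0 (us1 ++ u :: v :: us2) =
  - ((-1 : K) ^ (e * f) *: @tbr0 K g n (us1 ++ v :: u :: us2)).
Proof.
move=> hu hv; rewrite !tbr0_slot scaler_sumr -sumrN; apply: eq_bigr => c1 _.
under eq_bigr do rewrite map_cons cartesian_cons.
under [in RHS]eq_bigr do rewrite map_cons cartesian_cons.
rewrite [in RHS]exchange_big scaler_sumr -sumrN /= big_seq [RHS]big_seq.
apply: eq_bigr => t tu; rewrite scaler_sumr -sumrN big_seq [RHS]big_seq.
apply: eq_bigr => t' tv; rewrite scaler_sumr -sumrN; apply: eq_bigr => c2 _.
rewrite (pbr_swap _ _ (pure_of_ok tu) (pure_of_ok tv)).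
have [e1 _ _] := texpand_tdeg hg hu tu; have [e2 _ _] := texpand_tdeg hg hv tv.
by rewrite /totdeg /= e1 e2 !subrK.
Qed.

End PureBracket.

(** * The form differential as a derivation of the brackets *)

Lemma cartesian_mem (A : eqType) (ss : seq (seq A)) c : c \in cartesian ss ->
  size c = size ss /\ forall x, x \in c -> exists2 s, s \in ss & x \in s.
Proof.
elim: ss c => [|s ss IH] c; first by rewrite inE => /eqP ->.
case/allpairsP => -[x c'] /= [xs /IH[e h] ->]; split; first by rewrite /= e.
move=> y; rewrite inE => /orP[/eqP->|/h[s' ss' ys']].
  by exists s; rewrite ?mem_head.
by exists s'; rewrite // inE ss' orbT.
Qed.

Lemma map_nth_enum (A B : Type) (f : A -> B) (x0 : A) (q : seq A) :
  [seq f (nth x0 q (i : 'I_(size q))) | i <- enum 'I_(size q)] = map f q.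
Proof.
rewrite (map_comp (fun j => f (nth x0 q j)) val) val_enum_ord.
by rewrite (map_comp f (nth x0 q)) -/(mkseq _ _) mkseq_nth.
Qed.

Section TensorDegree.
Variables (K : fieldType) (g : linfData K).
Hypothesis charK : [pchar K] =i pred0.
Hypothesis hg : isLinf g.
Variable n : nat.
Notation gforms := (btens g (formB n)).
Implicit Types (u v : gforms) (y : pure g n) (q : seq (pure g n)).

Lemma tdeg_lin m c u v : tdeg m u -> tdeg m v -> tdeg m (c *: u + v).
Proof. by move=> hu hv b; rewrite fcoef_lin; apply: hasdeg_lin. Qed.

Lemma tdeg0 m : tdeg m (0 : gforms).
Proof. by move=> b; rewrite monalg.mcoeff0; exact: hasdeg0. Qed.

Lemma tdegZ m c u : tdeg m u -> tdeg m (c *: u).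
Proof. by move=> hu; rewrite -[c *: u]addr0; apply: tdeg_lin => //; exact: tdeg0. Qed.

Lemma tdegD m u v : tdeg m u -> tdeg m v -> tdeg m (u + v).
Proof. by move=> hu hv; rewrite -[u]scale1r; exact: tdeg_lin. Qed.

Lemma tdegB m u v : tdeg m u -> tdeg m v -> tdeg m (u - v).
Proof. by move=> hu hv; rewrite -scaleN1r addrC; exact: tdeg_lin. Qed.

Lemma tdeg_sum m (I : Type) (r : seq I) (P : pred I) (F : I -> gforms) :
  (forall i, P i -> tdeg m (F i)) -> tdeg m (\sum_(i <- r | P i) F i).
Proof. by move=> h; apply: big_ind => //; [exact: tdeg0|exact: tdegD]. Qed.

Lemma tdeg_ptens i p x a : hasdeg i x -> fdeg p a -> tdeg (i + p) (ptens x a : gforms).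
Proof.
move=> hx ha b; rewrite fcoef_ptens.
have [->|/ha <-] := eqVneq (a b.2) 0; first by rewrite mcoeff0 scale0r; exact: hasdeg0.
by rewrite addrK; exact: hasdegZ.
Qed.

(** Up to sign the bracket of pure tensors is again pure; recording it with its degrees allows
    nested brackets to be computed by [tbr0_pure]. *)
Definition pbr_result q : pure g n :=
  (\sum_(y <- q) y.1.1 + 2 - (size q)%:Z, br [seq y.1.2 | y <- q],
   (\sum_(y <- q) y.2.1, fprod [seq y.2.2 | y <- q])).

Lemma pbrE q : pbr q = (-1 : K) ^ psign q *: ptens_of (pbr_result q).
Proof. by rewrite pbr.unlock. Qed.

Lemma pbr_result_ok q : q != [::] -> (forall y, y \in q -> pure_ok y) -> pure_ok (pbr_result q).
Proof.
move=> q0 hq; split => /=; last first.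
  elim: q hq {q0} => [|y q IH] hq /=; first by rewrite big_nil; exact: fdeg_fscal.
  rewrite big_cons; apply: fdegM; first by have [] := hq y (mem_head _ _).
  by apply: IH => z zq; apply: hq; rewrite inE zq orbT.
case: q q0 hq => // y0 q' _; set q := y0 :: q' => hq.
have := @linf_degree _ _ hg (size q) (fun i => (nth y0 q i).1.1) (fun i => (nth y0 q i).1.2).
rewrite (map_nth_enum (fun y : pure g n => y.1.2)) => h.
have -> : \sum_(y <- q) y.1.1 = \sum_(i < size q) (nth y0 q i).1.1 by rewrite (big_nth y0) big_mkord.
by apply: h => // i; have [] := hq _ (mem_nth y0 (ltn_ord i)).
Qed.

Lemma sum_totdeg1 q : (forall y, y \in q -> totdeg y = 1) ->
  \sum_(y <- q) y.1.1 + \sum_(y <- q) y.2.1 = (size q)%:Z.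
Proof.
move=> hq; rewrite -big_split /= (eq_big_seq (fun=> 1)) //.
by rewrite big_const_seq count_predT iter_addr_0 natz.
Qed.

(** With k entries of total degree 1 the bracket has degree k + (2 - k). *)
Lemma tdeg_tbr0 us : us != [::] -> (forall u, u \in us -> tdeg 1 u) -> tdeg 2 (@tbr0 K g n us).
Proof.
move=> us0 hus; rewrite tbr0.unlock big_seq; apply: tdeg_sum => c /cartesian_mem[sc hc].
set q := [seq pure_of t | t <- c].
have hq y : y \in q -> pure_ok y /\ totdeg y = 1.
  case/mapP => t /hc[s /mapP[u uus ->] ts] ->; split; first exact: pure_of_ok ts.
  by have [e _ _] := texpand_tdeg hg (hus _ uus) ts; rewrite /totdeg /= e subrK.
have [h1 h2] : pure_ok (pbr_result q).
  apply: pbr_result_ok; last by move=> y /hq[].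
  by rewrite -size_eq0 size_map sc size_map size_eq0.
have e : \sum_(y <- q) y.1.1 + \sum_(y <- q) y.2.1 = (size q)%:Z.
  by apply: sum_totdeg1 => y /hq[].
have e2 : \sum_(y <- q) y.1.1 + 2 - (size q)%:Z + \sum_(y <- q) y.2.1 = 2.
  by rewrite -e; ring.
by rewrite pbrE; apply: tdegZ; have := tdeg_ptens h1 h2; rewrite /= e2.
Qed.

(** The parity operator. In total degree m the sign (-1)^|x| in the differential of a tensor of x
    and a equals (-1)^m (-1)^|a|, so up to the constant (-1)^m the differential acts on the form
    factor alone ([tdiffE]). *)
Definition fsignop (a : Omega K n) : Omega K n :=
  [ffun S : {set 'I_n} => (-1 : K) ^+ #|S| *: a S].

Lemma fsignop_linear : linear fsignop.
Proof.
move=> c a b; apply/ffunP => S; rewrite !ffunE scalerDr !scalerA.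
by rewrite [c * _]mulrC.
Qed.

Lemma fsignop_deg k a : fdeg k a -> fsignop a = (-1 : K) ^ k *: a.
Proof.
move=> h; apply/ffunP => S; rewrite !ffunE.
by have [->|/h <-] := eqVneq (a S) 0; rewrite ?scaler0.
Qed.

Lemma tdiff_linear : linear (@tdiff K g n).
Proof.
move=> c u v; rewrite !tdiff.unlock; apply: (texpand_linear hg) => i b {}c x y.
by rewrite (@ptens_linearl K g n _) scalerDr !scalerA [c * _]mulrC.
Qed.

Definition dpure y : pure g n :=
  (y.1, (y.2.1 + 1, (-1 : K) ^ y.1.1 *: fdiff y.2.2)).

Lemma dpure_ok y : pure_ok y -> pure_ok (dpure y).
Proof. by case=> h1 h2; split=> //=; apply: fdegZ; exact: fdeg_fdiff. Qed.

Lemma tdiff_pure y : pure_ok y -> tdiff (ptens_of y) = ptens_of (dpure y).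
Proof.
move=> hy; rewrite tdiff.unlock.
pose Th z : gforms := ptens_of (dpure z).
have := @texpand_pure _ _ hg n _ Th y; rewrite /Th => <- //.
- apply: eq_bigr => -[[i x] b] _; rewrite /ptens_of /dpure /=.
  by rewrite (linZ (@ptens_linearr K g n _)).
- move=> i x p c a b; rewrite /ptens_of /dpure /= (@fdiff_linear K n) scalerDr.
  by rewrite scalerA mulrC -scalerA (@ptens_linearr K g n x).
move=> i p a c x x'; exact: (@ptens_linearl K g n _).
Qed.

Lemma tdiffE m u : tdeg m u -> tdiff u = (-1 : K) ^ m *: formmap (fun a => fdiff (fsignop a)) u.
Proof.
move=> hu; rewrite tdiff.unlock.
rewrite (texpand_homog hg (Psi := fun t => (-1 : K) ^ t.1.1 *: ptens t.1.2 (fdiff (fbase K t.2))) _ hu).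
  rewrite formmapE scaler_sumr; apply: eq_bigr => b _ /=.
  rewrite (fsignop_deg (@fdeg_fbase K n b)) (linZ (@fdiff_linear K n)).
  rewrite (linZ (@ptens_linearr K g n _)) scalerA -signzD.
  have e : (-1 : K) ^ (m - #|b.2|%:Z) = (-1) ^ (m + #|b.2|%:Z).
    by apply: (@signz_eq K _ _ (- #|b.2|%:Z)); ring.
  by rewrite e.
move=> i b c x y; rewrite (@ptens_linearl K g n _) scalerDr !scalerA.
by rewrite [c * _]mulrC.
Qed.

Lemma formmap_tdeg f k m (u : gforms) : linear f ->
  (forall p a, fdeg p a -> fdeg (p + k) (f a)) -> tdeg m u ->
  tdeg (m + k) (formmap f u : gforms).
Proof.
move=> lf hf hu; rewrite formmapE; apply: tdeg_sum => b _.
have := tdeg_ptens (hu b) (hf _ _ (@fdeg_fbase K n b)).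
by rewrite addrA subrK.
Qed.

Lemma tdiff_tdeg m u : tdeg m u -> tdeg (m + 1) (tdiff u).
Proof.
move=> hu; rewrite (tdiffE hu); apply: tdegZ; apply: formmap_tdeg => //.
  by move=> c a b; rewrite fsignop_linear (@fdiff_linear K n).
by move=> p a ha; apply: fdeg_fdiff; rewrite (fsignop_deg ha); exact: fdegZ.
Qed.

Lemma tdiff_sqr m u : tdeg m u -> tdiff (tdiff u) = 0.
Proof.
move=> hu; have h2 := tdiff_tdeg hu.
rewrite (tdiffE h2) (tdiffE hu) (linZ (@formmap_linear K g n n _)).
rewrite formmap_comp => [|c a b]; last by rewrite fsignop_linear (@fdiff_linear K n).
rewrite (eq_formmap (h := fun=> 0)) ?formmap0 ?scaler0 // => a.
have l1 : linear (fun a => fdiff (fsignop a)).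
  by move=> c b b'; rewrite fsignop_linear (@fdiff_linear K n).
have l2 : linear (fun a => fdiff (fsignop (fdiff (fsignop a)))) by exact: (lin_comp l1 l1).
rewrite (form_fmon a); apply: (etrans (lin_sum _ _ _ l2)); apply: big1 => S _.
have hS := @fdeg_fmon K n S (a S).
rewrite (fsignop_deg hS) (linZ (@fdiff_linear K n)) (linZ fsignop_linear).
by rewrite (fsignop_deg (fdeg_fdiff hS)) !(linZ (@fdiff_linear K n)) fdiff_sqr ?scaler0.
Qed.

Lemma fdiff_fprod_pure y0 q : (forall y, y \in q -> pure_ok y) ->
  fdiff (fprod [seq y.2.2 | y <- q]) = \sum_(i < size q)
    (-1 : K) ^ (\sum_(y <- take i q) y.2.1) *:
      fprod ([seq y.2.2 | y <- take i q] ++ fdiff (nth y0 q i).2.2 ::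
             [seq y.2.2 | y <- drop i.+1 q]).
Proof.
elim: q => [|y q IH] hq /=; first by rewrite big_ord0; exact: (@fdiff_fprod K n [::]).
have [_ ha] := hq y (mem_head _ _).
rewrite big_ord_recl /= big_nil expr0z scale1r drop0 (fdiffM _ ha); congr (_ + _).
rewrite IH => [|z zq]; last by apply: hq; rewrite inE zq orbT.
rewrite fmul_sumr scaler_sumr; apply: eq_bigr => i _.
by rewrite /bump /= add1n big_cons signzD fmulZr scalerA.
Qed.

Lemma tdiff_pbr y0 q : q != [::] -> (forall y, y \in q -> pure_ok y) ->
  (forall y, y \in q -> totdeg y = 1) ->
  (-1 : K) ^+ size q *: tdiff (pbr q) = \sum_(i < size q)
    (-1 : K) ^+ i *: pbr (take i q ++ dpure (nth y0 q i) :: drop i.+1 q).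
Proof.
move=> q0 hq tq; rewrite pbrE (linZ tdiff_linear) (tdiff_pure (pbr_result_ok q0 hq)).
rewrite /ptens_of /= (linZ (@ptens_linearr K g n _)) (fdiff_fprod_pure y0 hq).
rewrite (lin_sum _ _ _ (@ptens_linearr K g n _)) 2!scalerA scaler_sumr; apply: eq_bigr => i _.
rewrite (linZ (@ptens_linearr K g n _)) !scalerA pbr.unlock map_cat /= map_cat /=.
have iq : (i < size q)%N by [].
have eq : q = take i q ++ nth y0 q i :: drop i.+1 q by rewrite -drop_nth // cat_take_drop.
set q1 := take i q in eq *; set y := nth y0 q i in eq *; set q2 := drop i.+1 q in eq *.
have tq1 : forall z, z \in q1 -> totdeg z = 1.
  by move=> z zq; apply: tq; rewrite eq mem_cat zq.
have ty : totdeg y = 1 by apply: tq; rewrite eq mem_cat mem_head orbT.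
have sq1 : size q1 = i by rewrite size_take iq.
rewrite [in br _]eq map_cat /= !fprod_cat /= fmulZl !fmulZr.
rewrite (linZ (@ptens_linearr K g n _)) !scalerA.
set s1 := (X in X *: _ = _); set s2 := (X in _ = X *: _).
suff -> : s1 = s2 by [].
rewrite /s1 /s2 !exprnP -!signzD.
have := sum_totdeg1 tq1; rewrite sq1 => <-.
(* The position i has been rewritten as the sum of |x| + |a| over the first i entries; the exponents
   then differ only by the 2 in the degree 2 - k of the bracket. *)
apply: (@signz_eq K _ _ 1).
rewrite [in \sum_(y1 <- q) _]eq [in psign q]eq !psign_cat big_cat /= !big_cons /=.
by ring.
Qed.

(** Exchanging an entry of degree 1 with one of degree 2 has trivial Koszul sign, so each of the [i]
    exchanges contributes only the minus sign of antisymmetry. *)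
Lemma tbr0_move i m u v : tdeg 1 u -> tdeg 2 v ->
  tbr0 (nseq i u ++ v :: nseq m u) = (-1 : K) ^+ i *: @tbr0 K g n (v :: nseq (i + m) u).
Proof.
move=> hu hv; elim: i m => [|i IH] m; first by rewrite expr0 scale1r.
rewrite -[nseq i.+1 u]/(ncons i.+1 u [::]) -addn1.
have -> : ncons (i + 1) u [::] = nseq i u ++ [:: u] by rewrite -/(nseq _ _) nseqD.
rewrite -catA /= (tbr0_swap hg _ _ hu hv) -[v :: u :: _]/(v :: nseq m.+1 u) IH.
have -> : (-1 : K) ^ ((1 : int) * 2) = 1 by exact: (signz2 K 1).
by rewrite scale1r exprD expr1 mulrN1 scaleNr addn1 addSnnS.
Qed.

(** Moving [tdiff u] from position i to the front gives a second sign (-1)^i, which cancels the one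
    in [tdiff_pbr]; the m+1 positions therefore contribute equally. *)
Lemma tdiff_tbr0 m u : tdeg 1 u ->
  (-1 : K) ^+ m.+1 *: tdiff (tbr0 (nseq m.+1 u)) =
  m.+1%:R *: @tbr0 K g n (tdiff u :: nseq m u).
Proof.
move=> hu; pose T := texpand u.
have e1 : tdiff u = \sum_(t <- T) ptens_of (dpure (pure_of t)).
  rewrite tdiff.unlock; apply: eq_bigr => t _; rewrite /ptens_of /=.
  by rewrite (linZ (@ptens_linearr K g n _)).
have hd := tdiff_tdeg hu.
transitivity (\sum_(i < m.+1) (-1 : K) ^+ i *:
    @tbr0 K g n (nseq i u ++ tdiff u :: nseq (m - i) u)); last first.
  rewrite -[in RHS](card_ord m.+1) -sumr_const scaler_suml; apply: eq_bigr => i _.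
  rewrite (tbr0_move _ _ hu hd) scalerA -expr2 sqrr_sign subnKC // -ltnS; exact: ltn_ord.
have y0 : pure g n := (0, 0, (0, 0)).
have ok t : t \in T -> pure_ok (pure_of t) /\ totdeg (pure_of t) = 1.
  move=> tT; split; first exact: pure_of_ok tT.
  by have [e _ _] := texpand_tdeg hg hu tT; rewrite /totdeg /= e subrK.
rewrite [in LHS]tbr0.unlock (lin_sum _ _ _ tdiff_linear) scaler_sumr map_nseq -/T.
transitivity (\sum_(c <- cartesian (nseq m.+1 T)) \sum_(i < m.+1) (-1 : K) ^+ i *:
   pbr ([seq pure_of t | t <- take i c] ++ dpure (nth y0 [seq pure_of t | t <- c] i) ::
     [seq pure_of t | t <- drop i.+1 c])).
  rewrite big_seq [RHS]big_seq; apply: eq_bigr => c /cartesian_mem[sc hc].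
  have hc' t : t \in c -> t \in T by move=> /hc[s /nseqP[-> _]].
  set q := [seq pure_of t | t <- c].
  have sq : size q = m.+1 by rewrite size_map sc size_nseq.
  have q0 : q != [::] by rewrite -size_eq0 sq.
  have okq y : y \in q -> pure_ok y by case/mapP => t /hc'/ok[h _] ->.
  have tq y : y \in q -> totdeg y = 1 by case/mapP => t /hc'/ok[_ h] ->.
  have := tdiff_pbr y0 q0 okq tq; rewrite sq => ->.
  by apply: eq_bigr => i _; rewrite map_take map_drop.
rewrite exchange_big; apply: eq_bigr => i _; rewrite -scaler_sumr; apply: (congr1 ( *:%R _)).
have im : (i <= m)%N by rewrite -ltnS.
have -> : nseq m.+1 T = nseq i T ++ T :: nseq (m - i) T.
  by rewrite -[T :: _]/(nseq (m - i).+1 T) -nseqD addnS subnKC.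
rewrite cartesian_cat tbr0_slot !map_nseq -/T big_seq [RHS]big_seq.
apply: eq_bigr => c1 /cartesian_mem[sc1 _]; rewrite size_nseq in sc1.
pose Th z : gforms := \sum_(c2 <- cartesian (nseq (m - i) T))
   pbr ([seq pure_of t | t <- c1] ++ z :: [seq pure_of t | t <- c2]).
have l1 j x p : linear (fun a => Th (j, x, (p, a))).
  move=> c a b; rewrite /Th scaler_sumr -big_split; apply: eq_bigr => d _.
  exact: pbr_lineara.
have l2 j p a : linear (fun x => Th (j, x, (p, a))).
  move=> c x x'; rewrite /Th scaler_sumr -big_split; apply: eq_bigr => d _.
  exact: pbr_linearx.
have lT : expand_lin (fun t => Th (pure_of t)) by move=> j b c x y; exact: l2.
rewrite -[RHS]/(\sum_(t <- texpand (tdiff u)) Th (pure_of t)) e1.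
rewrite (lin_sum _ _ _ (texpand_linear hg lT)) cartesian_cons big_seq [RHS]big_seq.
apply: eq_bigr => t /ok[ht _].
rewrite (texpand_pure hg l1 l2 (dpure_ok ht)); apply: eq_bigr => c2 _.
have t1 : take i (c1 ++ t :: c2) = c1 by rewrite take_size_cat.
have t2 : drop i.+1 (c1 ++ t :: c2) = c2.
  by rewrite -cat_rcons drop_size_cat // size_rcons sc1.
have t3 : nth y0 [seq pure_of t | t <- c1 ++ t :: c2] i = pure_of t.
  by rewrite map_cat nth_cat size_map sc1 ltnn subnn.
by rewrite t1 t2 t3.
Qed.

End TensorDegree.

(** * The Jacobi identity for powers of an element of degree one *)

Lemma multilinear_nseq (K : fieldType) (V W : lmodType K) (M : seq V -> W) r (y : 'I_r -> V) m :
  (forall l1 l2, linear (fun u => M (l1 ++ u :: l2))) ->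
  M (nseq m (\sum_j y j)) =
    \sum_(c : {ffun 'I_m -> 'I_r}) M [seq y (c i) | i <- enum 'I_m].
Proof.
move=> lM; suff : forall p, M (p ++ nseq m (\sum_j y j)) =
    \sum_(c : {ffun 'I_m -> 'I_r}) M (p ++ [seq y (c i) | i <- enum 'I_m]).
  exact: (@^~ [::]).
elim: m => [|m IH] p.
  rewrite (big_pred1 [ffun i : 'I_0 => False_rect _ (notF (valP i))]) //.
    by rewrite (size0nil (size_enum_ord 0)).
  by move=> c; apply/esym/eqP/ffunP => -[].
rewrite /= (lin_sum _ _ _ (lM p _)).
pose h (jc : 'I_r * {ffun 'I_m -> 'I_r}) : {ffun 'I_m.+1 -> 'I_r} :=
  [ffun i => oapp jc.2 jc.1 (unlift ord0 i)].
pose h' (c : {ffun 'I_m.+1 -> 'I_r}) := (c ord0, [ffun i => c (lift ord0 i)]).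
have hK : cancel h h'.
  move=> [j c]; rewrite /h' /h ffunE unlift_none; congr (_, _).
  by apply/ffunP => i; rewrite !ffunE liftK.
have h'K : cancel h' h.
  move=> c; apply/ffunP => i; rewrite ffunE /=.
  by case: unliftP => [i' ->|->] //=; rewrite ffunE.
rewrite [RHS](reindex h); last by exists h' => x _; rewrite ?hK ?h'K.
rewrite -(pair_bigA _ (fun j c => M (p ++ [seq y (h (j, c) i) | i <- enum 'I_m.+1]))) /=.
apply: eq_bigr => j _; rewrite -cat_rcons IH; apply: eq_bigr => c _.
rewrite cat_rcons enum_ordSl /= ffunE unlift_none /=.
congr (M (_ ++ _ :: _)); rewrite -map_comp; apply: eq_map => i /=.
by rewrite ffunE liftK.
Qed.

Lemma unshuffleP n k (s : 'S_n) : reflect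
  (forall i j : 'I_n, (i < j)%N -> (j < k)%N || (k <= i)%N -> (s i < s j)%N) (unshuffle k s).
Proof.
apply: (iffP forallP) => [h i j ij c|h i].
  by have /forallP/(_ j)/implyP := h i; apply; rewrite ij.
by apply/forallP => j; apply/implyP => /andP[]; exact: h.
Qed.

(** An unshuffle is determined by the set of its first [k] values, and every [k]-subset arises by
    listing it, and then its complement, in increasing order. *)
Lemma card_unshuffle n k : (k <= n)%N -> #|[set s : 'S_n | unshuffle k s]| = 'C(n, k).
Proof.
move=> kn; pose L := [set i : 'I_n | (i < k)%N].
have cardL : #|L| = k.
  rewrite cardsE -sum1_card -[RHS]card_ord -[RHS]sum1_card (big_ord_widen _ (fun=> 1%N) kn).
  exact: eq_bigl.
have imL (s : 'S_n) (i : 'I_n) : (s i \in [set s j | j in L]) = (i < k)%N.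
  by rewrite mem_imset ?inE //; exact: perm_inj.
have srt (s : 'S_n) (P : pred 'I_n) : unshuffle k s ->
    (forall i j : 'I_n, P i -> P j -> (j < k)%N || (k <= i)%N) ->
    sorted (fun x y : 'I_n => (x < y)%N) [seq s i | i <- enum 'I_n & P i].
  move=> /unshuffleP us hP; rewrite sorted_map.
  apply: (@sub_in_sorted _ P (fun x y : 'I_n => (x < y)%N)).
  - by move=> i j Pi Pj ij; apply: us => //; exact: hP.
  - exact: filter_all.
  apply: (sorted_filter (@ltno_trans n)); exact: sorted_enum_ord.
pose f (s : 'S_n) : {set 'I_n} := [set s j | j in L].
have im : f @: [set s : 'S_n | unshuffle k s] =
    [set A : {set 'I_n} | (A \subset [set: 'I_n]) && (#|A| == k)].
  apply/setP => A; rewrite inE subsetT /=; apply/imsetP/eqP.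
    by move=> [s _ ->]; rewrite card_imset //; exact: perm_inj.
  move=> cA; pose l := enum A ++ enum (~: A).
  have sA : size (enum A) = k by rewrite -cardE.
  have sl : size l = n by rewrite size_cat -!cardE cardsC card_ord.
  have ul : uniq l.
    rewrite cat_uniq !enum_uniq andbT /=; apply/hasPn => i.
    by rewrite !mem_enum inE.
  have inj : injective (fun i : 'I_n => nth i l i).
    move=> i j; rewrite (set_nth_default i) ?sl // => /eqP.
    by rewrite nth_uniq ?sl // => /eqP/val_inj.
  exists (perm inj).
    rewrite inE; apply/unshuffleP => i j ij c; rewrite !permE (set_nth_default i) ?sl //.
    rewrite !nth_cat sA; case/orP: c => [jk|ki].
      rewrite jk (ltn_trans ij jk); apply: (sorted_ltn_nth (@ltno_trans n)) => //.
      - exact: sorted_enum_set.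
      - by rewrite inE sA (ltn_trans ij jk).
      - by rewrite inE sA.
    have kj := leq_ltn_trans ki ij.
    rewrite (ltnNge i k) ki (ltnNge j k) (ltnW kj) /=.
    have sz (x : 'I_n) : (k <= x)%N -> (x - k < size (enum (~: A)))%N.
      move=> kx; rewrite -cardE -(ltn_add2l #|A|) cardsC card_ord cA subnKC //.
    apply: (sorted_ltn_nth (@ltno_trans n)) => //; rewrite ?inE ?sz ?(ltnW kj) //.
      exact: sorted_enum_set.
    by rewrite ltn_sub2rE.
  apply/eqP; rewrite eq_sym eqEcard; apply/andP; split; last first.
    by rewrite card_imset ?cardL ?cA //; exact: perm_inj.
  apply/subsetP => x /imsetP[i]; rewrite inE => ik ->.
  rewrite permE nth_cat sA ik -mem_enum; apply: mem_nth; by rewrite sA.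
have inj_f : {in [set s : 'S_n | unshuffle k s] &, injective f}.
  move=> s s'; rewrite !inE => us us' e.
  pose P b (i : 'I_n) := (i < k)%N == b.
  have mem (t : 'S_n) b x : (x \in [seq t i | i <- enum 'I_n & P b i]) =
      ((x \in f t) == b).
    rewrite -{2}(permKV t x) /f imL; apply/mapP/eqP => [[i]|h].
      by rewrite mem_filter => /andP[/eqP <- _] ->; rewrite permK.
    by exists (t^-1 x)%g; rewrite ?permKV // mem_filter /P h eqxx mem_enum.
  have eqb b : [seq s i | i <- enum 'I_n & P b i] =
      [seq s' i | i <- enum 'I_n & P b i].
    apply: (irr_sorted_eq (@ltno_trans n)); first by move=> x; exact: ltnn.
    - apply: srt => // i j; rewrite /P; case: b => /eqP; case: ltnP => // ki _ /eqP.
        by move=> ->.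
      by rewrite orbT.
    - apply: srt => // i j; rewrite /P; case: b => /eqP; case: ltnP => // ki _ /eqP.
        by move=> ->.
      by rewrite orbT.
    by move=> x; rewrite !mem e.
  apply/permP => i; have /eq_in_map h := eqb (i < k)%N; apply: h.
  by rewrite mem_filter /P eqxx mem_enum.
by rewrite -(card_in_imset inj_f) im cards_draws cardsT card_ord.
Qed.

Section Jacobi.
Variables (K : fieldType) (g : linfData K).
Hypothesis charK : [pchar K] =i pred0.
Hypothesis hg : isLinf g.
Variable n : nat.
Notation gforms := (btens g (formB n)).
Implicit Types (u v : gforms) (y : pure g n) (q : seq (pure g n)).

Lemma texpand_pure_sum u : \sum_(t <- texpand u) (fsingle t.2 t.1.2 : gforms) = u.
Proof.
have lP : expand_lin (fun t : int * g * formB n => fsingle t.2 t.1.2 : gforms).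
  by move=> i b; exact: fsingle_linear.
apply: (tensor_lin_ext hg (h := id) (texpand_linear hg lP)) => //.
by move=> i b x hx; rewrite (texpand_fsingle hg b lP hx).
Qed.

Definition tbr0_nested k (us : seq gforms) : gforms :=
  tbr0 (tbr0 (take k us) :: drop k us).

Lemma tbr0_nested_linear k us1 us2 : linear (fun u => tbr0_nested k (us1 ++ u :: us2)).
Proof.
move=> c u v; rewrite /tbr0_nested !take_cat !drop_cat.
case: ltnP => h; first exact: (tbr0_linear hg (tbr0 (take k us1) :: drop k us1) us2).
case: (k - size us1)%N => [|d] /=.
  by rewrite !cats0; exact: (tbr0_linear hg [:: tbr0 us1] us2).
by rewrite (tbr0_linear hg us1) (tbr0_linear hg [::]).
Qed.

(** Nesting costs no further sign: the forms of the inner bracket pass the remaining vectors exactly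
    as they do in the ungrouped list. *)
Lemma tbr0_nested_pure k q : (0 < k <= size q)%N -> (forall y, y \in q -> pure_ok y) ->
  tbr0_nested k [seq ptens_of y | y <- q] =
  (-1 : K) ^ psign q *:
    ptens (br (br [seq y.1.2 | y <- take k q] :: [seq y.1.2 | y <- drop k q]))
      (fprod [seq y.2.2 | y <- q]).
Proof.
move=> /andP[k0 kq] hq; rewrite /tbr0_nested -map_take -map_drop.
have hq1 y : y \in take k q -> pure_ok y by move=> yq; apply: hq; exact: mem_take yq.
have hq2 y : y \in drop k q -> pure_ok y by move=> yq; apply: hq; exact: mem_drop yq.
have q0 : take k q != [::] by rewrite -size_eq0 size_takel // -lt0n.
rewrite (tbr0_pure hg hq1) pbrE (linZ (tbr0_linear hg [::] _)) /=.
have hq3 y : y \in pbr_result (take k q) :: drop k q -> pure_ok y.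
  by rewrite inE => /orP[/eqP->|/hq2//]; exact: pbr_result_ok.
rewrite -[tbr0 _]/(tbr0 [seq ptens_of y | y <- pbr_result (take k q) :: drop k q]).
rewrite (tbr0_pure hg hq3) pbr.unlock scalerA -signzD /=.
have e1 : psign q = psign (take k q) + ((\sum_(y <- take k q) y.2.1) *
    (\sum_(y <- drop k q) y.1.1) + psign (drop k q)).
  by rewrite -{1}(cat_take_drop k q) psign_cat; ring.
have e2 : fprod [seq y.2.2 | y <- q] =
    fmul (fprod [seq y.2.2 | y <- take k q]) (fprod [seq y.2.2 | y <- drop k q]).
  by rewrite -fprod_cat -map_cat cat_take_drop.
by rewrite e1 e2.
Qed.

Section Permuted.
Variables (m : nat) (q : 'I_m -> pure g n).
Hypothesis okq : forall i, pure_ok (q i).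
Hypothesis tq : forall i, totdeg (q i) = 1.

Definition sprod (l : seq 'I_m) : Omega K n :=
  (-1 : K) ^ psign [seq q i | i <- l] *: fprod [seq (q i).2.2 | i <- l].

(* On factors of total degree one, the Koszul sign of the forms, corrected by the sign
   of the bracket, is the antisymmetric Koszul sign of the coefficients. *)
Lemma sprod_swap l1 i j l2 : sprod (l1 ++ i :: j :: l2) =
  (-1 * (-1 : K) ^ ((q i).1.1 * (q j).1.1)) *: sprod (l1 ++ j :: i :: l2).
Proof.
have [_ hi] := okq i; have [_ hj] := okq j.
rewrite /sprod !map_cat !fprod_cat /= (fmulA (q i).2.2) (fmulC hi hj) fmulZl fmulZr -fmulA.
rewrite !scalerA mulN1r signzN1 -!signzD.
set s1 := (-1) ^ _; set s2 := (-1) ^ _; suff -> : s1 = s2 by [].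
have pi : (q i).2.1 = 1 - (q i).1.1 by rewrite -(tq i) /totdeg; ring.
have pj : (q j).2.1 = 1 - (q j).1.1 by rewrite -(tq j) /totdeg; ring.
rewrite /s1 /s2; apply: (@signz_eq K _ _ (- (q i).1.1)).
by rewrite !psign_cat /= !big_cons pi pj; ring.
Qed.

Lemma sprod_perm (s : 'S_m) :
  sprod [seq s i | i <- enum 'I_m] =
  ((-1) ^+ s * koszul K (fun i => (q i).1.1) s) *: sprod (enum 'I_m).
Proof.
rewrite (sortsign_perm (fun l1 i j l2 _ => sprod_swap l1 i j l2)).
rewrite (odd_perm_inversions K) /koszul -big_split.
set a := (X in X *: _ = _); set b := (X in _ = X *: _); suff -> : a = b by [].
by rewrite /a /b; apply: eq_bigr => i _; rewrite -big_split.
Qed.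

(** After reordering by [sprod_perm], the term of [s] is the corresponding signed term of the Jacobi
    identity of [g], tensored with the form [sprod (enum 'I_m)], which depends neither on [s] nor on
    [k]. *)
Lemma jacobi_pure : (0 < m)%N ->
  \sum_(1 <= k < m.+1) (-1 : K) ^+ k *: \sum_(s : 'S_m | unshuffle k s)
     tbr0_nested k [seq ptens_of (q (s i)) | i <- enum 'I_m] = 0.
Proof.
move=> m0; pose J k (s : 'S_m) := br (br [seq (q (s i)).1.2 | i <- take k (enum 'I_m)]
              :: [seq (q (s i)).1.2 | i <- drop k (enum 'I_m)]).
have e k (s : 'S_m) : (0 < k <= m)%N ->
    tbr0_nested k [seq ptens_of (q (s i)) | i <- enum 'I_m] =
    ptens (((-1) ^+ s * koszul K (fun i => (q i).1.1) s) *: J k s) (sprod (enum 'I_m)).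
  move=> km; pose Q := [seq q (s i) | i <- enum 'I_m].
  have okQ y : y \in Q -> pure_ok y by case/mapP => i _ ->.
  have sQ : size Q = m by rewrite size_map size_enum_ord.
  have km' : (0 < k <= size Q)%N by rewrite sQ.
  have := tbr0_nested_pure km' okQ; rewrite -map_comp => ->.
  rewrite -(linZ (@ptens_linearr K g n _)).
  have -> : (-1 : K) ^ psign Q *: fprod [seq y.2.2 | y <- Q] = sprod [seq s i | i <- enum 'I_m].
    by rewrite /sprod /Q -!map_comp.
  rewrite sprod_perm (linZ (@ptens_linearr K g n _)) -(linZ (@ptens_linearl K g n _)).
  by rewrite /J -!map_take -!map_drop -!map_comp.
pose S k := \sum_(s : 'S_m | unshuffle k s)
  ((-1) ^+ s * koszul K (fun i => (q i).1.1) s) *: J k s.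
transitivity (\sum_(1 <= k < m.+1) ptens ((-1 : K) ^+ k *: S k) (sprod (enum 'I_m))).
  apply: eq_big_nat => k; rewrite ltnS => km.
  rewrite (linZ (@ptens_linearl K g n _)); apply: (congr1 ( *:%R _)).
  rewrite (lin_sum _ _ _ (@ptens_linearl K g n _)); apply: eq_bigr => s _; exact: e.
rewrite -(lin_sum _ _ _ (@ptens_linearl K g n _)).
have -> := linf_jacobi hg (d := fun i => (q i).1.1) (x := fun i => (q i).1.2) m0.
  exact: lin0 (@ptens_linearl K g n _).
by move=> i; case: (okq i).
Qed.

End Permuted.

(** Expanding [u] into pure tensors turns its power into a sum over index functions. Summed over
    these, all unshuffles for a given [k] contribute equally, which gives a binomial coefficient;
    division by m! leaves 1/(k! (m-k)!). *)
Lemma jacobi_power u m : tdeg 1 u -> (0 < m)%N ->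
  \sum_(1 <= k < m.+1) ((-1) ^+ k * (k`!%:R * (m - k)`!%:R)^-1 : K) *:
    tbr0_nested k (nseq m u) = 0.
Proof.
move=> hu m0; pose T := texpand u; pose r := size T.
pose t0 : int * g * formB n := (0, 0, (0%MM, set0)).
pose y (j : 'I_r) := pure_of (nth t0 T j).
have oky j : pure_ok (y j) by exact: pure_of_ok (mem_nth _ (ltn_ord j)).
have ty j : totdeg (y j) = 1.
  have [e _ _] := texpand_tdeg hg hu (mem_nth t0 (ltn_ord j)).
  by rewrite /totdeg /y /= e subrK.
have uE : u = \sum_j ptens_of (y j).
  rewrite -{1}(texpand_pure_sum u) (big_nth t0) big_mkord; apply: eq_bigr => j _.
  by rewrite /ptens_of /= ptens_fbase.
pose X k := tbr0_nested k (nseq m u).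
pose M k (c : {ffun 'I_m -> 'I_r}) := tbr0_nested k [seq ptens_of (y (c i)) | i <- enum 'I_m].
have XE k : X k = \sum_c M k c.
  by rewrite /X {1}uE; apply: multilinear_nseq => l1 l2; exact: tbr0_nested_linear.
(* Precomposition with [s] is a bijection of the index functions. *)
have shift k (s : 'S_m) : X k = \sum_(c : {ffun 'I_m -> 'I_r}) M k [ffun i => c (s i)].
  rewrite XE (reindex (fun c : {ffun 'I_m -> 'I_r} => [ffun i => c (s i)])) //.
  exists (fun c : {ffun 'I_m -> 'I_r} => [ffun i => c (s^-1 i)%g]) => c _;
    by apply/ffunP => i; rewrite !ffunE ?permKV ?permK.
have sumX : \sum_(1 <= k < m.+1) (-1 : K) ^+ k *: ('C(m, k)%:R *: X k) = 0.
  transitivity (\sum_(1 <= k < m.+1) \sum_(c : {ffun 'I_m -> 'I_r}) (-1 : K) ^+ k *: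
      \sum_(s : 'S_m | unshuffle k s) M k [ffun i => c (s i)]).
    apply: eq_big_nat => k; rewrite ltnS => /andP[_ km].
    rewrite -scaler_sumr exchange_big; apply: (congr1 ( *:%R _)).
    transitivity (\sum_(s : 'S_m | unshuffle k s) X k).
      rewrite sumr_const -(card_unshuffle km) scaler_nat cardsE; by [].
    by apply: eq_bigr => s _; exact: shift.
  rewrite exchange_big; apply: big1 => c _.
  rewrite -[RHS](jacobi_pure (fun i => oky (c i)) (fun i => ty (c i)) m0).
  apply: eq_bigr => k _; apply: (congr1 ( *:%R _)); apply: eq_bigr => s _.
  rewrite /M; congr (tbr0_nested k _); apply: eq_map => i; by rewrite ffunE.
have fact0 j : j`!%:R != 0 :> K by rewrite (natK_neq0 charK) ?fact_gt0.
transitivity ((m`!%:R : K)^-1 *: \sum_(1 <= k < m.+1) (-1 : K) ^+ k *: ('C(m, k)%:R *: X k)).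
  rewrite scaler_sumr; apply: eq_big_nat => k; rewrite ltnS => /andP[_ km].
  rewrite -/(X k) !scalerA; set a := (X in X *: _ = _); set b := (X in _ = X *: _).
  suff -> : a = b by [].
  have h : ('C(m, k)%:R : K) * (k`!%:R * (m - k)`!%:R) = m`!%:R.
    by rewrite -!natrM bin_fact.
  have C0 : ('C(m, k)%:R : K) != 0 by rewrite (natK_neq0 charK) ?bin_gt0.
  rewrite /a /b -h [in RHS]invfM; move: (_ * _)^-1 => z.
  by rewrite [RHS]mulrC !mulrA mulfV // mul1r mulrC.
by rewrite sumX scaler0.
Qed.

End Jacobi.

(** * The lower central filtration and nilpotency *)

Section Filtration.
Variables (K : fieldType) (g : linfData K).
Hypothesis hg : isLinf g.

(* The terms of [lcf] need not be decreasing; [lcs k] is the span of those of index at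
   least [k]. *)
Inductive lcs (k : nat) : g -> Prop :=
| lcs_lcf j x : (k <= j)%N -> lcf j x -> lcs k x
| lcs_lin c x y : lcs k x -> lcs k y -> lcs k (c *: x + y).

Lemma lcs0 k : lcs k 0.
Proof. by apply: (@lcs_lcf _ k.+2); [lia|exact: lcf0]. Qed.

Lemma lcs_le k k' x : (k' <= k)%N -> lcs k x -> lcs k' x.
Proof.
move=> le; elim=> {x} [j x kj lx|c x y _ hx _ hy]; last exact: lcs_lin.
exact: lcs_lcf (leq_trans le kj) lx.
Qed.

Lemma lcsZ k c x : lcs k x -> lcs k (c *: x).
Proof. by move=> h; rewrite -[c *: x]addr0; apply: lcs_lin => //; exact: lcs0. Qed.

Lemma lcs1 x : lcs 1 x.
Proof. exact: (lcs_lcf (leqnn 1) (lcf1 x)). Qed.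

Lemma lcf_pos j (x : g) : lcf j x -> (0 < j)%N.
Proof.
case=> // [k i y k1 i0 _|i i1|i c y z i1 _ _]; try by lia.
by case: k i y k1 i0 => // k i y _ i0; rewrite big_ord_recl addn_gt0 i0.
Qed.

(** [x] keeps its level and each other entry is counted in level 1. The condition on the sizes
    ensures that the bracket has at least two entries, as [lcf_br] demands. *)
Lemma lcs_br k s1 x s2 : (0 < size s1 + size s2)%N -> lcs k x ->
  lcs (k + (size s1 + size s2)) (br (s1 ++ x :: s2)).
Proof.
move=> s0; elim=> {x} [j x kj lx|c x y _ IHx _ IHy]; last first.
  by rewrite (linf_multilinear hg); exact: lcs_lin.
pose s := s1 ++ x :: s2.
have ss : size s = (size s1 + size s2).+1 by rewrite size_cat /= addnS.
pose lev (p : 'I_(size s)) := if (p : nat) == size s1 then j else 1%N.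
have p0 : (size s1 < size s)%N by rewrite ss ltnS leq_addr.
apply: (@lcs_lcf _ (\sum_(p < size s) lev p)).
  rewrite (bigD1 (Ordinal p0)) //= /lev eqxx leq_add //.
  rewrite (eq_bigr (fun=> 1%N)) => [|p np]; last by rewrite ifN.
  by rewrite sum1_card cardC1 card_ord ss.
have -> : br (s1 ++ x :: s2) = br [seq nth 0 s (p : 'I_(size s)) | p <- enum 'I_(size s)].
  by have := map_nth_enum id 0 s; rewrite map_id => ->.
apply: lcf_br.
- by rewrite ss ltnS.
- by move=> p; rewrite /lev; case: ifP => // _; exact: lcf_pos lx.
move=> p; rewrite /lev; case: eqP => [->|_]; last exact: lcf1.
by rewrite nth_cat ltnn subnn.
Qed.

(** Vanishing of all late terms passes to their span. Adding 2 to the index makes the bound exceed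
    1, so that the truncated Maurer-Cartan sum contains its linear term. *)
Lemma nilpotent_lcs : nilpotent g -> exists2 N, (1 < N)%N & forall x, lcs N x -> x = 0.
Proof.
case=> N hN; exists N.+2 => // x; elim=> {x} [j x Nj lx|c x y _ -> _ ->].
  by apply: (hN j x) => //; lia.
by rewrite scaler0 addr0.
Qed.

Section TensorFiltration.
Variable n : nat.
Notation gforms := (btens g (formB n)).
Implicit Types (u v : gforms).

Definition tfil k u := forall b, lcs k (fcoef u b).

Lemma tfil_lin k c u v : tfil k u -> tfil k v -> tfil k (c *: u + v).
Proof. by move=> hu hv b; rewrite fcoef_lin; exact: lcs_lin. Qed.

Lemma tfil0 k : tfil k 0.
Proof. by move=> b; rewrite monalg.mcoeff0; exact: lcs0. Qed.

Lemma tfilZ k c u : tfil k u -> tfil k (c *: u).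
Proof. by move=> h; rewrite -[c *: u]addr0; apply: tfil_lin => //; exact: tfil0. Qed.

Lemma tfilD k u v : tfil k u -> tfil k v -> tfil k (u + v).
Proof. by move=> hu hv; rewrite -[u]scale1r; exact: tfil_lin. Qed.

Lemma tfilN k u : tfil k u -> tfil k (- u).
Proof. by rewrite -scaleN1r; exact: tfilZ. Qed.

Lemma tfil_sum k (I : Type) (r : seq I) (P : pred I) (F : I -> gforms) :
  (forall i, P i -> tfil k (F i)) -> tfil k (\sum_(i <- r | P i) F i).
Proof. by move=> h; apply: big_ind => //; [exact: tfil0|exact: tfilD]. Qed.

Lemma tfil1 u : tfil 1 u.
Proof. by move=> b; exact: lcs1. Qed.

Lemma tfil_ptens k x a : lcs k x -> tfil k (ptens x a : gforms).
Proof. by move=> h b; rewrite fcoef_ptens; exact: lcsZ. Qed.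

Lemma tfil_formmap m k (f : Omega K n -> Omega K m) u : tfil k u ->
  forall b, lcs k (fcoef (formmap f u : btens g (formB m)) b).
Proof.
move=> h b; rewrite formmapE /lext (lin_sum _ _ _ (@fcoef_linear K _ g b)).
apply: (big_ind (lcs k)); first exact: lcs0.
  by move=> x y hx hy; rewrite -[x]scale1r; exact: lcs_lin.
by move=> i _; rewrite fcoef_ptens; apply: lcsZ.
Qed.

Lemma tfil_tbr0 m k us1 u us2 : tdeg m u -> tfil k u -> (0 < size us1 + size us2)%N ->
  tfil (k + (size us1 + size us2)) (tbr0 (us1 ++ u :: us2)).
Proof.
move=> du fu s0; rewrite tbr0_slot big_seq; apply: tfil_sum => c1 /cartesian_mem[s1 _].
rewrite big_seq; apply: tfil_sum => t /(texpand_tdeg hg du)[_ e _].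
rewrite big_seq; apply: tfil_sum => c2 /cartesian_mem[s2 _].
rewrite size_map in s1; rewrite size_map in s2.
rewrite pbr.unlock; apply: tfilZ; apply: tfil_ptens; rewrite map_cat /= e.
have := @lcs_br k [seq y.1.2 | y <- [seq pure_of t | t <- c1]] (fcoef u t.2)
  [seq y.1.2 | y <- [seq pure_of t | t <- c2]].
by rewrite !size_map s1 s2; apply.
Qed.

Lemma tfil_tbr0_cons m k u us : tdeg m u -> tfil k u -> us != [::] ->
  tfil k.+1 (tbr0 (u :: us)).
Proof.
move=> du fu; rewrite -size_eq0 -lt0n => s0.
have h := tfil_tbr0 (us1 := [::]) (us2 := us) du fu s0.
by move=> b; apply: lcs_le (h b); rewrite /= add0n -addn1 leq_add2l.
Qed.

Lemma tfil_zero N u : (forall x, lcs N x -> x = 0) -> tfil N u -> u = 0.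
Proof. by move=> hN h; apply: btensP => b; rewrite (hN _ (h b)) monalg.mcoeff0. Qed.

Lemma tbr0_long N us : (forall x, lcs N x -> x = 0) -> (forall u, u \in us -> tdeg 1 u) ->
  (1 < size us)%N -> (N <= size us)%N -> tbr0 us = 0 :> gforms.
Proof.
case: us => [//|u us] hN hus; rewrite /= ltnS => s0 Ns.
have := tfil_tbr0 (us1 := [::]) (us2 := us) (hus u (mem_head _ _)) (@tfil1 u) s0.
move=> h; apply: (tfil_zero hN) => b; apply: lcs_le (h b).
by rewrite add0n add1n.
Qed.

End TensorFiltration.
End Filtration.

(** * Curvature and the Bianchi identity *)

Lemma big_nat_extend (W : nmodType) (F : nat -> W) a b c : (b <= c)%N ->
  (forall l, (b <= l)%N -> F l = 0) -> \sum_(a <= l < c) F l = \sum_(a <= l < b) F l.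
Proof.
move=> bc h; rewrite [RHS](big_nat_widen _ _ _ _ _ bc) [RHS]big_mkcond.
by apply: eq_bigr => l _; case: ltnP => //; exact: h.
Qed.

Lemma sum_nat_delta (W : nmodType) (F : nat -> W) a b i : (a <= i < b)%N ->
  \sum_(a <= k < b) (if k == i then F k else 0) = F i.
Proof. by move=> h; rewrite -big_mkcond big_nat1_eq h. Qed.

(** The assumption confines both sums to the square k, m < N, and the antidiagonals k + m = j that
    meet it have j < 2N. *)
Lemma sum_antidiagonals (W : nmodType) (A : nat -> nat -> W) N : (0 < N)%N ->
  (forall k m, (0 < k)%N -> (N <= k)%N || (N <= m)%N -> A k m = 0) ->
  \sum_(1 <= j < N + N) \sum_(1 <= k < j.+1) A k (j - k)%N =
  \sum_(0 <= m < N) \sum_(1 <= k < N) A k m.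
Proof.
move=> N0 hA; rewrite [RHS]exchange_big.
transitivity (\sum_(1 <= j < N + N) \sum_(1 <= k < N + N)
    if (k < j.+1)%N then A k (j - k)%N else 0).
  apply: eq_big_nat => j /andP[_ jN]; rewrite (big_nat_widen _ _ _ _ _ jN) big_mkcond.
  exact: eq_bigr.
rewrite [LHS]exchange_big; transitivity (\sum_(1 <= k < N + N) \sum_(0 <= m < N) A k m).
  apply: eq_big_nat => k /andP[k0 kN].
  rewrite (big_cat_nat k0 (ltnW kN)) /= big_nat big1 ?add0r; last first.
    by move=> j /andP[_ jk]; case: ifP => //; lia.
  transitivity (\sum_(0 + k <= j < N + N) A k (j - k)%N).
    by rewrite add0n; apply: eq_big_nat => j /andP[kj _]; case: ifP => //; lia.
  rewrite big_addn; under eq_bigr do rewrite addnK.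
  have [Nk|lt] := leqP N k.
    by rewrite !big1 // => m _; apply: hA; rewrite ?Nk.
  apply: big_nat_extend => [|m Nm]; first by lia.
  by apply: hA; rewrite ?Nm ?orbT.
apply: big_nat_extend => [|k Nk]; first by lia.
by apply: big1 => m _; apply: hA; rewrite ?Nk //; exact: leq_trans Nk.
Qed.

Section Curvature.
Variables (K : fieldType) (g : linfData K).
Hypothesis charK : [pchar K] =i pred0.
Hypothesis hg : isLinf g.
Variable N : nat.
Hypothesis N1 : (1 < N)%N.
Hypothesis hN : forall x : g, lcs N x -> x = 0.
Variable n : nat.
Notation gforms := (btens g (formB n)).
Implicit Types (u v : gforms).

Definition tquad u : gforms := \sum_(2 <= l < N) (l`!%:R : K)^-1 *: tbr0 (nseq l u).

Definition curv u : gforms := tdiff u + tbr0 [:: u] + tquad u.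

Definition tbr_pow u k : gforms := tbr0 (nseq k u) + (if k == 1%N then tdiff u else 0).

Lemma tbr_powE u k : (0 < k)%N -> tbr (nseq k u) = tbr_pow u k.
Proof.
by case: k => // k _; rewrite tbrE // /tbr_pow; case: k.
Qed.

Lemma tbr_pow_tdeg u k : (0 < k)%N -> tdeg 1 u -> tdeg 2 (tbr_pow u k).
Proof.
move=> k0 hu; apply: (tdegD hg).
  apply: (tdeg_tbr0 hg); first by case: k k0.
  by move=> v /nseqP[-> _].
by case: eqP => _; [exact: (tdiff_tdeg hg hu)|exact: (tdeg0 hg)].
Qed.

Lemma tbr_pow0 u k : tdeg 1 u -> (N <= k)%N -> tbr_pow u k = 0.
Proof.
move=> hu Nk; rewrite /tbr_pow gtn_eqF ?addr0; last exact: leq_trans Nk.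
apply: (tbr0_long hg hN); rewrite ?size_nseq //; last exact: leq_trans Nk.
by move=> v /nseqP[-> _].
Qed.

Lemma curvE u : curv u = \sum_(1 <= k < N) (k`!%:R : K)^-1 *: tbr_pow u k.
Proof.
have e : tquad u = \sum_(2 <= k < N) (k`!%:R : K)^-1 *: tbr_pow u k.
  by apply: eq_big_nat => k /andP[k2 _]; rewrite /tbr_pow (gtn_eqF k2) addr0.
by rewrite (big_ltn N1) (factS 0) fact0 invr1 scale1r -e /curv /tbr_pow eqxx (addrC (tdiff u)).
Qed.

Lemma curv_tdeg u : tdeg 1 u -> tdeg 2 (curv u).
Proof.
move=> hu; rewrite curvE big_nat; apply: (tdeg_sum hg) => k /andP[k0 _].
by apply: (tdegZ hg); exact: tbr_pow_tdeg.
Qed.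

(** [MC] truncates its series at an unspecified index, [curv] at the fixed [N]; both sums are
    extended to the larger index by zero terms. *)
Lemma MC_curv u : @MC K (tensLinf g n) u <-> tdeg 1 u /\ curv u = 0.
Proof.
pose F l := (l`!%:R : K)^-1 *: tbr (nseq l u).
have FE M : \sum_(1 <= l < M) F l = \sum_(1 <= l < M) (l`!%:R : K)^-1 *: tbr_pow u l.
  by apply: eq_big_nat => l /andP[l0 _]; rewrite /F tbr_powE.
split=> [[/(tdegP hg) hu [M [hM s0]]]|[hu c0]]; split=> //.
- rewrite curvE -FE -(@big_nat_extend _ _ 1 N (maxn M N)) ?leq_maxr //; last first.
    by move=> l Nl; rewrite /F tbr_powE ?tbr_pow0 ?scaler0 //; apply: leq_trans Nl; lia.
  rewrite (@big_nat_extend _ _ 1 M) ?leq_maxl //.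
  by move=> l Ml; rewrite /F (_ : tbr _ = 0) ?scaler0 //; exact: hM.
- exact/(tdegP hg).
have c1 : \sum_(1 <= l < N) F l = 0 by rewrite FE -curvE.
exists N; split; last exact: c1.
move=> l Nl; apply: (etrans (tbr_powE u _) (tbr_pow0 hu Nl)); exact: leq_trans (ltnW N1) Nl.
Qed.

(** The weighted Jacobi identities of all lengths, summed. [out m z] is the full bracket of [z] with
    [m] copies of [u], form differential included, and [A k m] is the term with [k] inner and [m]
    outer copies. For fixed j = k + m the terms free of the form differential cancel by
    [jacobi_power]; the two that contain it, [du, u, ..., u] and d[u, ..., u], cancel by
    [tdiff_tbr0]. *)
Lemma bianchi u : tdeg 1 u ->
  tdiff (curv u) + tbr0 [:: curv u] +
    \sum_(1 <= m < N) ((-1) ^+ m * (m`!%:R)^-1 : K) *: tbr0 (curv u :: nseq m u) = 0.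
Proof.
move=> hu; pose out m z : gforms := tbr0 (z :: nseq m u) + (if m == 0%N then tdiff z else 0).
have out_lin m : linear (out m).
  move=> c z z'; rewrite /out (tbr0_linear hg [::]) scalerDr addrACA; congr (_ + _).
  by case: ifP => _; rewrite ?(tdiff_linear hg) // scaler0 addr0.
pose A k m : gforms := ((-1) ^+ m * (k`!%:R * m`!%:R)^-1 : K) *: out m (tbr_pow u k).
have A0 k m : (0 < k)%N -> (N <= k)%N || (N <= m)%N -> A k m = 0.
  move=> k0 /orP[Nk|Nm]; rewrite /A; first by rewrite tbr_pow0 // (lin0 (out_lin m)) scaler0.
  have m0 : (0 < m)%N by apply: leq_trans Nm; exact: ltnW.
  have z0 : tbr0 (tbr_pow u k :: nseq m u) = 0 :> gforms.
    have s0 : (0 < size (nseq m u))%N by rewrite size_nseq.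
    have h := tfil_tbr0 hg (us1 := [::]) (tbr_pow_tdeg k0 hu) (@tfil1 _ _ _ _) s0.
    apply: (tfil_zero hN) => b; apply: lcs_le (h b).
    by rewrite /= size_nseq; lia.
  by rewrite /out gtn_eqF // addr0 z0 scaler0.
have key j : (0 < j)%N -> \sum_(1 <= k < j.+1) A k (j - k)%N = 0.
  move=> j0; pose B k : gforms := ((-1) ^+ k * (k`!%:R * (j - k)`!%:R)^-1 : K) *:
     out (j - k)%N (tbr_pow u k).
  have AB k : (k <= j)%N -> A k (j - k)%N = (-1 : K) ^+ j *: B k.
    move=> kj; have e : (-1 : K) ^+ (j - k) = (-1) ^+ j * (-1) ^+ k.
      by rewrite -{2}(subnK kj) exprD -mulrA -expr2 sqrr_sign mulr1.
    by rewrite /A /B e scalerA -mulrA.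
  rewrite (eq_big_nat _ _ (F2 := fun k => (-1 : K) ^+ j *: B k)); last first.
    by move=> k /andP[_ kj]; rewrite AB.
  suff B0 : \sum_(1 <= k < j.+1) B k = 0 by rewrite -scaler_sumr B0 scaler0.
  have outE k : (0 < k <= j)%N -> out (j - k)%N (tbr_pow u k) =
      tbr0_nested k (nseq j u) + ((if k == 1%N then tbr0 (tdiff u :: nseq j.-1 u) else 0)
       + (if k == j then tdiff (tbr0 (nseq j u)) else 0)).
    move=> /andP[k0 kj]; rewrite /tbr_pow (linD (out_lin _)) /tbr0_nested take_nseq //.
    have -> : out (j - k)%N (if k == 1%N then tdiff u else 0) =
        if k == 1%N then tbr0 (tdiff u :: nseq j.-1 u) else 0.
      case: eqP => [->|_]; last exact: (lin0 (out_lin _)).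
      (* Only for [j] = 1 is there a second summand, and it is d(du). *)
      by rewrite /out (tdiff_sqr charK hg hu) subn1 if_same addr0.
    have -> : out (j - k)%N (tbr0 (nseq k u)) = tbr0 (tbr0 (nseq k u) :: nseq (j - k) u) +
        (if k == j then tdiff (tbr0 (nseq j u)) else 0).
      rewrite /out (_ : ((j - k)%N == 0%N) = (k == j)); last by rewrite subn_eq0 eqn_leq kj.
      by case: (k =P j) => [->|].
    by rewrite drop_nseq -addrA [X in _ + X]addrC.
  pose co k : K := (-1) ^+ k * (k`!%:R * (j - k)`!%:R)^-1.
  transitivity (\sum_(1 <= k < j.+1) (co k *: tbr0_nested k (nseq j u) +
     ((if k == 1%N then co k *: tbr0 (tdiff u :: nseq j.-1 u) else 0) +
      (if k == j then co k *: tdiff (tbr0 (nseq j u)) else 0)))).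
    apply: eq_big_nat => k; rewrite ltnS => kj.
    rewrite /B (outE k kj) -/(co k) !scalerDr.
    by case: (k == 1%N); case: (k == j); rewrite ?scaler0.
  rewrite !big_split /= (jacobi_power charK hg hu j0) add0r.
  have s1 : \sum_(1 <= k < j.+1) (if k == 1%N then co k *: tbr0 (tdiff u :: nseq j.-1 u) else 0)
      = co 1%N *: tbr0 (tdiff u :: nseq j.-1 u).
    by apply: (sum_nat_delta (fun k => co k *: tbr0 (tdiff u :: nseq j.-1 u))); rewrite ltnS.
  have s2 : \sum_(1 <= k < j.+1) (if k == j then co k *: tdiff (tbr0 (nseq j u)) else 0)
      = co j *: tdiff (tbr0 (nseq j u)).
    by apply: (sum_nat_delta (fun k => co k *: tdiff (tbr0 (nseq j u)))); rewrite j0 ltnSn.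
  apply: (etrans (congr2 +%R s1 s2)).
  have e := tdiff_tbr0 hg j.-1 hu; rewrite (prednK j0) in e.
  have ec : co j = (j`!%:R : K)^-1 * (-1) ^+ j by rewrite /co subnn fact0 mulr1 mulrC.
  have e2 : co j *: tdiff (tbr0 (nseq j u)) =
      ((j`!%:R : K)^-1 * j%:R) *: tbr0 (tdiff u :: nseq j.-1 u).
    apply: (etrans (congr1 (fun x => x *: tdiff (tbr0 (nseq j u))) ec)).
    apply: (etrans (esym (scalerA _ _ _))); apply: (etrans (congr1 ( *:%R _) e)).
    exact: scalerA.
  (* The contribution -1/(j-1)! of inner length 1 meets j/j! from inner length j. *)
  have e1 : co 1%N + (j`!%:R : K)^-1 * j%:R = 0.
    rewrite /co expr1 (factS 0) fact0 mul1r mulN1r subn1.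
    have -> : (j`!%:R : K) = j%:R * (j.-1)`!%:R by rewrite -natrM -{2}(prednK j0) -factS prednK.
    by rewrite invfM mulrAC mulVf ?mul1r ?addNr ?(natK_neq0 charK).
  apply: (etrans (congr1 (+%R _) e2)); apply: (etrans (esym (scalerDl _ _ _))).
  by rewrite e1 scale0r.
have N0 : (0 < N)%N by exact: ltnW.
have e0 : \sum_(0 <= m < N) \sum_(1 <= k < N) A k m = 0.
  rewrite -(sum_antidiagonals N0 A0) big_nat; apply: big1 => j /andP[j0 _]; exact: key.
rewrite -[RHS]e0 [RHS](big_ltn N0); congr +%R.
  transitivity (out 0%N (curv u)); first by rewrite /out addrC.
  rewrite curvE (lin_sum _ _ _ (out_lin 0%N)); apply: eq_bigr => k _.
  by rewrite (linZ (out_lin 0%N)) /A fact0 mulr1 mul1r.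
apply: eq_big_nat => m /andP[m0 _].
transitivity (((-1) ^+ m * (m`!%:R)^-1 : K) *: out m (curv u)).
  by rewrite /out (gtn_eqF m0) addr0.
rewrite curvE (lin_sum _ _ _ (out_lin m)) scaler_sumr; apply: eq_bigr => k _.
by rewrite (linZ (out_lin m)) /A scalerA invfM -mulrA [(k`!%:R)^-1 * _]mulrC.
Qed.

End Curvature.

(** * Naturality of brackets and curvature under maps of forms *)

Section Functoriality.
Variables (K : fieldType) (g : linfData K).
Hypothesis charK : [pchar K] =i pred0.
Hypothesis hg : isLinf g.
Notation gforms n := (btens g (formB n)).

Lemma tbr0_single n i x (a : Omega K n) : hasdeg i x ->
  tbr0 [:: ptens x a] = ptens (br [:: x]) a :> gforms n.
Proof.
move=> hx; apply: (tens_lin_ext (f := fun a => tbr0 [:: ptens x a])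
  (h := fun a => ptens (br [:: x]) a)).
- by move=> c b b'; rewrite (@ptens_linearr K g n x) (tbr0_linear hg [::] [::]).
- exact: ptens_linearr.
move=> b; have ok y : y \in [:: pure_of (i, x, b)] -> pure_ok y.
  by rewrite inE => /eqP ->; split => //=; exact: fdeg_fbase.
have e := tbr0_pure hg ok; apply: (etrans e).
rewrite pbr.unlock /= big_nil mulr0 addr0 expr0z scale1r fmul1r.
by [].
Qed.

(** The unary bracket acts on coefficients and [f] on forms, neither with a Koszul sign, so they
    commute strictly whatever the degree of [f]. *)
Lemma formmap_tbr0_single n k (f : Omega K n -> Omega K k) (u : gforms n) : linear f ->
  formmap f (tbr0 [:: u]) = tbr0 [:: formmap f u] :> gforms k.
Proof.
move=> lf; apply: (tensor_lin_ext hg (f := fun u => formmap f (tbr0 [:: u]))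
  (h := fun u => tbr0 [:: formmap f u])).
- by move=> c v w; rewrite (tbr0_linear hg [::] [::]) (@formmap_linear K g n k f).
- by move=> c v w; rewrite (@formmap_linear K g n k f) (tbr0_linear hg [::] [::]).
move=> i b x hx; rewrite -ptens_fbase (tbr0_single _ hx) !formmap_ptens //.
by rewrite (tbr0_single _ hx).
Qed.

Lemma fsignop_sqr n (a : Omega K n) : fsignop (fsignop a) = a.
Proof. by apply/ffunP => S; rewrite !ffunE scalerA -expr2 sqrr_sign scale1r. Qed.

Lemma fsignop_odd n (f : Omega K n -> Omega K n) e (a : Omega K n) : linear f ->
  (forall p a, fdeg p a -> fdeg (p + e) (f a)) -> (-1 : K) ^ e = -1 ->
  f (fsignop a) = - fsignop (f a).
Proof.
move=> lf df he.
have l1 : linear (fun a => f (fsignop a)) by exact: (lin_comp lf (@fsignop_linear K n)).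
have l2 : linear (fun a => - fsignop (f a)).
  by move=> c b b'; rewrite lf fsignop_linear opprD scalerN.
rewrite (form_fmon a); apply: (etrans (lin_sum _ _ _ l1)); apply/esym.
apply: (etrans (lin_sum _ _ _ l2)); apply: eq_bigr => S _.
have hS := @fdeg_fmon K n S (a S).
rewrite (fsignop_deg hS) (linZ lf) (fsignop_deg (df _ _ hS)) signzD he.
by rewrite mulrN1 scaleNr opprK.
Qed.

Section Pull.
Variables (k n : nat) (f : 'I_k.+1 -> 'I_n.+1).
Notation F := (formmap (fpull f) : gforms n -> gforms k).

Definition pull_pure (y : pure g n) : pure g k := (y.1, (y.2.1, fpull f y.2.2)).

Lemma F_ptens x a : F (ptens x a) = ptens x (fpull f a).
Proof. by rewrite formmap_ptens //; exact: fpull_linear. Qed.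

Lemma F_pbr q : F (pbr q) = pbr [seq pull_pure y | y <- q].
Proof.
rewrite !pbr.unlock (linZ (@formmap_linear K g n k _)) F_ptens (fpull_fprod charK) -!map_comp.
suff -> : psign [seq pull_pure y | y <- q] = psign q by [].
by elim: q => //= y q ->; rewrite big_map.
Qed.

Lemma texpand_pull (W : lmodType K) (Th : pure g k -> W) (u : gforms n) :
  (forall i x p, linear (fun a => Th (i, x, (p, a)))) ->
  (forall i p a, linear (fun x => Th (i, x, (p, a)))) ->
  \sum_(t <- texpand (F u)) Th (pure_of t) = \sum_(t <- texpand u) Th (pull_pure (pure_of t)).
Proof.
move=> l1 l2.
have e1 : expand_lin (fun t => Th (@pure_of K g k t)) by move=> i b c x y; exact: l2.
have e2 : expand_lin (fun t => Th (pull_pure (pure_of t))) by move=> i b c x y; exact: l2.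
apply: (tensor_lin_ext hg (f := fun u => \sum_(t <- texpand (F u)) Th (pure_of t))
  (h := fun u => \sum_(t <- texpand u) Th (pull_pure (pure_of t)))).
- by move=> c v w; rewrite (@formmap_linear K g n k _); exact: (texpand_linear hg e1).
- exact: (texpand_linear hg e2).
move=> i b x hx; rewrite (texpand_fsingle hg b e2 hx) -ptens_fbase F_ptens.
have ok : pure_ok (pull_pure (pure_of (i, x, b))).
  by split => //=; apply: fdeg_fpull; exact: fdeg_fbase.
exact: (texpand_pure hg l1 l2 ok).
Qed.

Lemma F_tbr0 us : F (tbr0 us) = tbr0 [seq F u | u <- us].
Proof.
rewrite [in LHS]tbr0.unlock (lin_sum _ _ _ (@formmap_linear K g n k _)).
suff : forall q, \sum_(c <- cartesian [seq texpand u | u <- us])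
    pbr (q ++ [seq pull_pure (pure_of t) | t <- c]) =
    \sum_(c <- cartesian [seq texpand u | u <- [seq F u | u <- us]])
    pbr (q ++ [seq pure_of t | t <- c]).
  move/(_ [::]); rewrite /= tbr0.unlock => <-; apply: eq_bigr => c _.
  by rewrite F_pbr -map_comp.
elim: us => [|u us IH] q; first by rewrite !cartesian_nil.
rewrite !map_cons !cartesian_cons.
pose Th z : gforms k := \sum_(c <- cartesian [seq texpand u | u <- [seq F u | u <- us]])
    pbr (q ++ z :: [seq pure_of t | t <- c]).
apply/esym; rewrite -[LHS]/(\sum_(t <- texpand (F u)) Th (pure_of t)) texpand_pull.
- apply: eq_bigr => t _; rewrite /Th.
  have := IH (rcons q (pull_pure (pure_of t))); rewrite /= => e.
  transitivity (\sum_(c <- cartesian [seq texpand u | u <- [seq F u | u <- us]])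
    pbr (rcons q (pull_pure (pure_of t)) ++ [seq pure_of t | t <- c])).
    by apply: eq_bigr => c _; rewrite cat_rcons.
  by rewrite -e; apply: eq_bigr => c _; rewrite cat_rcons.
- move=> i x p c a b; rewrite /Th scaler_sumr -big_split; apply: eq_bigr => d _.
  exact: pbr_lineara.
move=> i p a c x x'; rewrite /Th scaler_sumr -big_split; apply: eq_bigr => d _.
exact: pbr_linearx.
Qed.

Lemma F_tdiff u : F (tdiff u) = tdiff (F u).
Proof.
apply: (tensor_lin_ext hg (f := fun u => F (tdiff u)) (h := fun u => tdiff (F u))).
- by move=> c v w; rewrite (tdiff_linear hg) (@formmap_linear K g n k _).
- by move=> c v w; rewrite (@formmap_linear K g n k _) (tdiff_linear hg).
move=> i b x hx; rewrite -ptens_fbase F_ptens.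
have ok : pure_ok (pure_of (i, x, b)) by split => //=; exact: fdeg_fbase.
have ok' : pure_ok (pull_pure (pure_of (i, x, b))).
  by split => //=; apply: fdeg_fpull; exact: fdeg_fbase.
have := tdiff_pure hg ok; rewrite {1}/ptens_of /= => ->.
have := tdiff_pure hg ok'; rewrite {1}/ptens_of /= => ->.
rewrite /ptens_of F_ptens /= (linZ (@fpull_linear K k n f)) (fpull_fdiff charK).
by [].
Qed.

Lemma F_tdeg m (u : gforms n) : tdeg m u -> tdeg m (F u).
Proof.
move=> hu; rewrite formmapE; apply: (tdeg_sum hg) => b _.
have := tdeg_ptens hg (hu b) (fdeg_fpull (f := f) (@fdeg_fbase K n b)).
by rewrite subrK.
Qed.

Variable N : nat.

Lemma F_tquad u : F (tquad N u) = tquad N (F u).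
Proof.
rewrite /tquad (lin_sum _ _ _ (@formmap_linear K g n k _)); apply: eq_bigr => l _.
by rewrite (linZ (@formmap_linear K g n k _)) F_tbr0 map_nseq.
Qed.

Lemma F_curv u : F (curv N u) = curv N (F u).
Proof.
by rewrite /curv !(linD (@formmap_linear K g n k _)) F_tdiff F_tbr0 F_tquad.
Qed.

End Pull.

Lemma fpull_fsignop k n (f : 'I_k.+1 -> 'I_n.+1) (a : Omega K n) :
  fpull f (fsignop a) = fsignop (fpull f a).
Proof.
have l1 := lin_comp (@fpull_linear K k n f) (@fsignop_linear K n).
have l2 := lin_comp (@fsignop_linear K k) (@fpull_linear K k n f).
rewrite (form_fmon a); apply: (etrans (lin_sum _ _ _ l1)); apply/esym.
apply: (etrans (lin_sum _ _ _ l2)); apply: eq_bigr => S _ /=.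
have hS := @fdeg_fmon K n S (a S).
by rewrite (fsignop_deg hS) (linZ (@fpull_linear K k n f)) (fsignop_deg (fdeg_fpull hS)).
Qed.

End Functoriality.

(** * The fixed-point equation attached to a homotopy *)

Lemma subr_sub (V : zmodType) (a x y : V) : (a - x) - (a - y) = - (x - y).
Proof. by rewrite [- (a - y)]opprB addrC addrA subrK opprB. Qed.

Section FixedPoint.
Variables (K : fieldType) (g : linfData K).
Hypothesis charK : [pchar K] =i pred0.
Hypothesis hg : isLinf g.
Variable N : nat.
Hypothesis N1 : (1 < N)%N.
Hypothesis hN : forall x : g, lcs N x -> x = 0.
Variable n : nat.
Notation gforms := (btens g (formB n)).
Implicit Types (u v A : gforms).

Lemma tquad_tdeg u : tdeg 1 u -> tdeg 2 (tquad N u).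
Proof.
move=> hu; rewrite /tquad big_nat; apply: (tdeg_sum hg) => l /andP[l2 _].
apply: (tdegZ hg); apply: (tdeg_tbr0 hg); first by case: l l2.
by move=> v /nseqP[-> _].
Qed.

(** The copies of [u] are replaced by [v] one at a time; every intermediate term is a bracket with
    one entry [u - v] and at least one further entry, which raises the level. *)
Lemma tfil_tbr0_sub k u v l us : tdeg 1 u -> tdeg 1 v -> tfil k (u - v) ->
  (1 < size us + l)%N -> tfil k.+1 (tbr0 (us ++ nseq l u) - tbr0 (us ++ nseq l v)).
Proof.
move=> hu hv huv; elim: l us => [|l IH] us h.
  by rewrite /= subrr; exact: tfil0.
have e : tbr0 (us ++ nseq l.+1 u) - tbr0 (us ++ nseq l.+1 v) =
    tbr0 (us ++ (u - v) :: nseq l u) +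
      (tbr0 (rcons us v ++ nseq l u) - tbr0 (rcons us v ++ nseq l v)).
  by rewrite (linB (tbr0_linear hg us _)) !cat_rcons addrA subrK.
rewrite e; apply: tfilD; last by apply: IH; rewrite size_rcons addSnnS.
have s0 : (0 < size us + size (nseq l u))%N by rewrite size_nseq; lia.
have f := tfil_tbr0 hg (tdegB hg hu hv) huv s0.
by move=> b; apply: lcs_le (f b); lia.
Qed.

Lemma tfil_tquad_sub k u v : tdeg 1 u -> tdeg 1 v -> tfil k (u - v) ->
  tfil k.+1 (tquad N u - tquad N v).
Proof.
move=> hu hv huv; rewrite /tquad -sumrB big_nat; apply: tfil_sum => l /andP[l2 _].
by rewrite -scalerBr; apply: tfilZ; exact: (tfil_tbr0_sub (us := [::]) hu hv huv).
Qed.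

Variable h : Omega K n -> Omega K n.
Hypothesis h_lin : linear h.
Hypothesis h_deg : forall k a, fdeg k a -> fdeg (k - 1) (h a).

(** The action of h on tensors, with the parity twist that undoes the one in [tdiffE]: in degree
    one, [hop] after [tdiff] is the plain action of h d ([hop_tdiff]). *)
Definition hop u : gforms := formmap (fun a => h (fsignop a)) u.
Definition hres (a : Omega K n) : Omega K n := a - fdiff (h a) - h (fdiff a).

Let hs_lin : linear (fun a => h (fsignop a)).
Proof. exact: (lin_comp h_lin (@fsignop_linear K n)). Qed.

Let fd_lin := @fdiff_linear K n.
Let sg_lin := @fsignop_linear K n.

Lemma hop_linear : linear hop.
Proof. exact: formmap_linear. Qed.

Lemma hop_tdeg m u : tdeg m u -> tdeg (m - 1) (hop u).
Proof.
move=> hu; apply: (formmap_tdeg hg) => // p a ha.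
by rewrite (fsignop_deg ha); apply: h_deg; exact: fdegZ.
Qed.

Lemma hop_tfil k u : tfil k u -> tfil k (hop u).
Proof. by move=> f b; exact: tfil_formmap. Qed.

Lemma h_fsignop a : h (fsignop a) = - fsignop (h a).
Proof.
apply: (@fsignop_odd K n h (-1) a h_lin); first by move=> p b; exact: h_deg.
by rewrite exprN1 invrN1.
Qed.

Lemma fdiff_fsignop (a : Omega K n) : fdiff (fsignop a) = - fsignop (fdiff a).
Proof.
apply: (@fsignop_odd K n (@fdiff K n) 1 a fd_lin); last exact: expr1z.
by move=> p b; exact: fdeg_fdiff.
Qed.

Lemma hopE u : hop u = - formmap (@fsignop K n) (formmap h u).
Proof.
rewrite /hop (eq_formmap (h := fun a => -1 *: fsignop (h a))); last first.
  by move=> a; rewrite h_fsignop scaleN1r.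
by rewrite formmapZ scaleN1r formmap_comp.
Qed.

Lemma formmap_hop u : formmap h u = - formmap (@fsignop K n) (hop u).
Proof.
rewrite hopE (linN (@formmap_linear K g n n _)) opprK formmap_comp //.
by rewrite (eq_formmap (formmap h u) (@fsignop_sqr K n)) formmap_id.
Qed.

Lemma hop_tdiff m u : tdeg m u ->
  hop (tdiff u) = - ((-1 : K) ^ m *: formmap (fun a => h (fdiff a)) u).
Proof.
move=> hu; rewrite (tdiffE hg hu) (linZ hop_linear) -scalerN; apply: (congr1 ( *:%R _)).
rewrite /hop formmap_comp // -scaleN1r -formmapZ; apply: eq_formmap => a.
by rewrite fdiff_fsignop (linN sg_lin) fsignop_sqr (linN h_lin) scaleN1r.
Qed.

(** The unary bracket need not raise the filtration, so it has to disappear exactly; it does because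
    it commutes with [hop]. *)
Lemma hop_tbr0 u : formmap h u = 0 -> hop (tbr0 [:: u]) = 0.
Proof.
move=> hu; have h0 : hop u = 0 by rewrite hopE hu (lin0 (@formmap_linear K g n n _)) oppr0.
apply: (etrans (formmap_tbr0_single hg u hs_lin)).
by rewrite -/(hop u) h0; apply: (tbr0_mem0 hg); exact: mem_head.
Qed.

Lemma hres_decomp u : formmap h u = 0 ->
  u = formmap hres u + formmap (fun a => h (fdiff a)) u.
Proof.
move=> hu; rewrite -formmapD (eq_formmap (h := fun a => a + -1 *: fdiff (h a))); last first.
  by move=> a; rewrite /hres subrK scaleN1r.
rewrite formmapD formmapZ -(formmap_comp h u fd_lin) hu.
by rewrite (lin0 (@formmap_linear K g n n _)) scaler0 addr0 formmap_id.
Qed.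

(* Apply [hop] to the Maurer-Cartan equation: the linear terms give [u - formmap hres u]. *)
Lemma MC_fixpoint u : tdeg 1 u -> curv N u = 0 -> formmap h u = 0 ->
  u = formmap hres u - hop (tquad N u).
Proof.
move=> hu c0 h0; rewrite {1}(hres_decomp h0); apply: (congr1 (+%R _)).
have := congr1 hop c0; rewrite /curv !(linD hop_linear) (hop_tbr0 h0) addr0 (lin0 hop_linear).
rewrite (hop_tdiff hu) expr1z scaleN1r opprK => /eqP; rewrite addr_eq0 => /eqP.
by [].
Qed.

Lemma fixpoint_unique A u v : tdeg 1 u -> tdeg 1 v ->
  u = A - hop (tquad N u) -> v = A - hop (tquad N v) -> u = v.
Proof.
move=> hu hv eu ev; have f k : tfil k.+1 (u - v).
  elim: k => [|k IH]; first exact: tfil1.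
  have e : u - v = - hop (tquad N u - tquad N v).
    apply: (etrans (congr2 (fun a b => a - b) eu ev)); apply: (etrans (subr_sub _ _ _)).
    exact: congr1 (esym (linB hop_linear _ _)).
  by rewrite e; apply: tfilN; apply: hop_tfil; exact: tfil_tquad_sub.
have := f N.-1; rewrite prednK; last exact: ltnW.
by move/(tfil_zero hN)/eqP; rewrite subr_eq0 => /eqP.
Qed.

(** Iteration from [A]: the r-th difference lies in level r + 1 of the filtration, so the sequence
    is stationary from index N - 1 on. *)
Lemma fixpoint_exists A : tdeg 1 A -> exists2 u, tdeg 1 u & u = A - hop (tquad N u).
Proof.
move=> hA; pose Psi u := A - hop (tquad N u); pose al r := iter r Psi A.
have dP u : tdeg 1 u -> tdeg 1 (Psi u).
  by move=> hu; apply: (tdegB hg hA); have := hop_tdeg (tquad_tdeg hu).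
have da r : tdeg 1 (al r) by elim: r => //= r IH; exact: dP.
have f r : tfil r.+1 (al r.+1 - al r).
  elim: r => [|r IH]; first exact: tfil1.
  have e : al r.+2 - al r.+1 = - hop (tquad N (al r.+1) - tquad N (al r)).
    apply: (etrans (subr_sub _ _ _)); exact: congr1 (esym (linB hop_linear _ _)).
  by rewrite e; apply: tfilN; apply: hop_tfil; apply: tfil_tquad_sub.
exists (al N.-1) => //.
have t : tfil N (al N.-1.+1 - al N.-1) by rewrite -{1}(prednK (ltnW N1)); exact: f.
by move/(tfil_zero hN)/eqP: t; rewrite subr_eq0 => /eqP e; exact: esym.
Qed.

Hypothesis hh : forall a, h (h a) = 0.
Hypothesis hdh : forall a, h (fdiff (h a)) = h a.

Lemma h_hres a : h (hres a) = 0.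
Proof. by rewrite /hres !(linB h_lin) hdh hh subrr subr0. Qed.

Lemma fixpoint_contr A u : formmap h A = 0 -> u = A - hop (tquad N u) -> formmap h u = 0.
Proof.
move=> hA ->; rewrite (linB (@formmap_linear K g n n _)) hA /hop formmap_comp // sub0r.
by rewrite (eq_formmap (h := fun=> 0)) ?formmap0 ?oppr0 // => a; rewrite hh.
Qed.

(* The curvature [F] satisfies [F = h S(F)] by the Bianchi identity, where [S] raises the
   lower central filtration. *)
Lemma fixpoint_MC A u : tdeg 1 u -> u = A - hop (tquad N u) ->
  formmap h A = 0 -> formmap hres u = A -> formmap hres (curv N u) = 0 -> curv N u = 0.
Proof.
move=> hu eu hA rA rF; set F := curv N u.
have h0 := fixpoint_contr hA eu.
(* Comparing u = Ru + h d u with u = A - h Q(u), where Ru = A, shows that [hop] kills du + Q(u); it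
   kills [u] because h u = 0. *)
have hopF : hop F = 0.
  have e := hres_decomp h0; rewrite rA {1}eu in e; have {e} := @addrI _ A _ _ e.
  have := hop_tdiff hu; rewrite expr1z scaleN1r opprK => <- e.
  by rewrite /F /curv !(linD hop_linear) (hop_tbr0 h0) addr0 -e addNr.
have hF : formmap h F = 0.
  by rewrite formmap_hop hopF (lin0 (@formmap_linear K g n n _)) oppr0.
have dF : tdeg 2 F := curv_tdeg hg N1 hu.
pose S := \sum_(1 <= m < N) ((-1) ^+ m * (m`!%:R)^-1 : K) *: tbr0 (F :: nseq m u).
have FS : F = hop S.
  have eF : F = formmap (fun a => h (fdiff a)) F.
    by rewrite {1}(hres_decomp hF) rF add0r.
  have := congr1 hop (bianchi charK hg N1 hN hu); rewrite -/F -/S !(linD hop_linear).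
  rewrite (hop_tbr0 hF) addr0 (lin0 hop_linear) (hop_tdiff dF) -eF.
  rewrite (_ : (-1 : K) ^ (2 : int) = 1) ?scale1r; last exact: (signz2 K 1).
  by move/eqP; rewrite addrC subr_eq0 => /eqP.
have f k : tfil k.+1 F.
  elim: k => [|k IH]; first exact: tfil1.
  rewrite FS; apply: hop_tfil; rewrite /S big_nat; apply: tfil_sum => m /andP[m0 _].
  by apply: tfilZ; apply: (tfil_tbr0_cons hg dF IH); case: m m0.
have := f N.-1; rewrite prednK; last exact: ltnW.
exact: (tfil_zero hN).
Qed.

End FixedPoint.

(** * Extending compatible faces of a horn to a simplex *)

Lemma pairwise_rev (T : Type) (r : rel T) (l : seq T) :
  pairwise r (rev l) = pairwise (fun x y => r y x) l.
Proof. by elim: l => //= x l IH; rewrite rev_cons pairwise_rcons all_rev IH. Qed.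

Section HornExtension.
Variables (X : nat -> zmodType)
  (act : forall k n, ('I_k.+1 -> 'I_n.+1) -> X n -> X k).
Hypothesis actD : forall k n (f : 'I_k.+1 -> 'I_n.+1), {morph act f : x y / x + y}.
Hypothesis act_comp : forall l k n (f : 'I_k.+1 -> 'I_n.+1) (h : 'I_l.+1 -> 'I_k.+1) x,
  act h (act f x) = act (fun p => f (h p)) x.
Hypothesis eq_act : forall k n (f h : 'I_k.+1 -> 'I_n.+1) x, f =1 h -> act f x = act h x.
Hypothesis act_id : forall n x, act (fun p : 'I_n.+1 => p) x = x.

Variables (m : nat) (i : 'I_m.+2).
Implicit Types (j k : 'I_m.+2).

Definition horn_target j : nat := if (j < i)%N then j.+1 else j.-1.

(* The degeneracy that merges [j] with its neighbour in the direction of [i]. *)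
Definition collapse j (q : 'I_m.+2) : 'I_m.+1 :=
  inord (if (j < i)%N then q - (j < q) else q - (j <= q))%N.

(* In this order [horn_target j] is never a vertex treated before [j], so that a correction
   along [collapse j] preserves the faces that are already prescribed. *)
Definition horn_order : seq 'I_m.+2 :=
  [seq j : 'I_m.+2 <- enum 'I_m.+2 | (j < i)%N] ++ rev [seq j : 'I_m.+2 <- enum 'I_m.+2 | (i < j)%N].

Lemma mem_horn_order j : (j \in horn_order) = (j != i).
Proof.
rewrite /horn_order mem_cat mem_rev.
rewrite (mem_filter (fun j : 'I_m.+2 => (j < i)%N)) (mem_filter (fun j : 'I_m.+2 => (i < j)%N)).
by rewrite mem_enum !andbT -neq_ltn -val_eqE.
Qed.

Lemma horn_order_pairwise : pairwise (fun k j => horn_target j != k) horn_order.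
Proof.
have h : pairwise (fun a b : 'I_m.+2 => (a < b)%N) (enum 'I_m.+2).
  by rewrite -(sorted_pairwise (@ltno_trans _)); exact: sorted_enum_ord.
rewrite /horn_order pairwise_cat; apply/and3P; split.
- apply/allrelP => k j; rewrite mem_rev !mem_filter => /andP[ki _] /andP[ij _].
  by rewrite /horn_target ltnNge (ltnW ij) /=; lia.
- have := pairwise_filter (fun j : 'I_m.+2 => (j < i)%N) h.
  apply: (sub_in_pairwise (P := fun j : 'I_m.+2 => (j < i)%N)); last exact: filter_all.
  move=> k j _ hj kj; have {}hj : (j < i)%N := hj.
  have {}kj : (k < j)%N := kj.
  by rewrite /horn_target hj; lia.
- rewrite pairwise_rev.
  have := pairwise_filter (fun j : 'I_m.+2 => (i < j)%N) h.
  apply: (sub_in_pairwise (P := fun j : 'I_m.+2 => (i < j)%N)); last exact: filter_all.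
  move=> k j hk _ jk; have {}hk : (i < k)%N := hk.
  have {}jk : (k < j)%N := jk.
  by rewrite /horn_target; case: ltnP; lia.
Qed.

Lemma collapse_homo j : j != i -> {homo collapse j : p q / (p <= q)%N}.
Proof.
move=> ji p q pq; rewrite /collapse.
have hp := ltn_ord p; have hq := ltn_ord q; have hi := ltn_ord i; have hj := ltn_ord j.
have {}ji : (j != i :> nat)%N by [].
by case: ltnP => ij; rewrite !inordK; lia.
Qed.

Lemma collapse_lift j (p : 'I_m.+1) : j != i -> collapse j (lift j p) = p.
Proof.
move=> ji; apply: val_inj; rewrite /collapse /= /bump.
have hp := ltn_ord p; have hi := ltn_ord i; have hj := ltn_ord j.
have {}ji : (j != i :> nat)%N by [].
by case: ltnP => ij; rewrite !inordK; lia.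
Qed.

Lemma lift_collapse j (q : 'I_m.+2) : j != i ->
  lift j (collapse j q) = (if q == j then horn_target j else q) :> nat.
Proof.
move=> ji; rewrite /collapse /= /bump /horn_target.
have hp := ltn_ord q; have hi := ltn_ord i; have hj := ltn_ord j.
have {}ji : (j != i :> nat)%N by [].
case: (eqVneq q j) => [->|qj]; last have {}qj : (q != j :> nat)%N by [].
  by case: ltnP => ij; rewrite !inordK; lia.
by case: ltnP => ij; rewrite !inordK; lia.
Qed.

(** The argument by which simplicial groups satisfy the Kan condition: [w] is corrected on one face
    at a time by a degenerate element. The family [X] is abstract because the construction serves
    twice, for tensors to extend a horn and for forms, with zero data, to project onto those
    vanishing on the horn. *)
Definition horn_extend (phi : 'I_m.+2 -> X m) (w : X m.+1) : X m.+1 :=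
  foldl (fun w j => w + act (collapse j) (phi j - act (lift j) w)) w horn_order.

(** Agreement on overlaps is tested on m-simplices, possibly degenerate, that lie in both faces.
    Overlaps occur in this shape in [horn_extendE], and dimension m - 1, absent for m = 0, is
    avoided. *)
Definition horn_compatible (phi : 'I_m.+2 -> X m) := forall j k (t t' : 'I_m.+1 -> 'I_m.+1),
  j != i -> k != i -> {homo t : p q / (p <= q)%N} -> {homo t' : p q / (p <= q)%N} ->
  (forall p, lift j (t p) = lift k (t' p)) -> act t (phi j) = act t' (phi k).

Lemma lift_factor l (f : 'I_l.+1 -> 'I_m.+2) k :
  {homo f : p q / (p <= q)%N} -> (forall q, f q != k) ->
  exists2 t : 'I_l.+1 -> 'I_m.+1, {homo t : p q / (p <= q)%N} & forall q, lift k (t q) = f q.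
Proof.
move=> hf fk; exists (fun q => inord (unbump k (f q))) => [p q /hf|p].
  have := fk p; have := fk q; have := ltn_ord (f p); have := ltn_ord (f q).
  have hk := ltn_ord k; rewrite -!val_eqE /unbump /= => *.
  by rewrite !inordK; lia.
apply: val_inj; have := fk p; have := ltn_ord (f p).
have hk := ltn_ord k; rewrite -!val_eqE /= /bump /unbump /= => *.
by rewrite !inordK; lia.
Qed.

Lemma act_sub a b (f : 'I_a.+1 -> 'I_b.+1) : {morph act f : x y / x - y}.
Proof.
move=> x y; apply: (addIr (act f y)); rewrite -actD !subrK; reflexivity.
Qed.

(** On a face [j] treated earlier, the correction for [k] is pulled back along [collapse k] after
    [lift j]. The corresponding simplex of face [k] also lies in face [j], where [w'] is already
    right, so by compatibility the correction restricts to zero. *)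
Lemma horn_extendE phi w j : horn_compatible phi -> j != i ->
  act (lift j) (horn_extend phi w) = phi j.
Proof.
move=> hphi; rewrite -mem_horn_order /horn_extend.
have := horn_order_pairwise; have := mem_horn_order; move: horn_order => L memL pL.
have {}memL k : k \in L -> k != i by rewrite memL.
elim/last_ind: L memL pL j => // L k IH memL; rewrite pairwise_rcons => /andP[/allP Lk pL] j.
rewrite mem_rcons inE foldl_rcons; set w' := foldl _ _ _.
have ki : k != i by apply: memL; rewrite mem_rcons mem_head.
have {}IH j' : j' \in L -> act (lift j') w' = phi j'.
  by apply: IH => // k' k'L; apply: memL; rewrite mem_rcons inE k'L orbT.
rewrite actD act_comp; case: (eqVneq j k) => [->|jk] /= jL.
  have e p : collapse k (lift k p) = p by rewrite collapse_lift.
  by rewrite (eq_act _ e) act_id addrC subrK.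
rewrite (IH _ jL) act_sub act_comp; set f := fun p => lift k _.
have hf : {homo f : p q / (p <= q)%N}.
  move=> p q pq; have h : (collapse k (lift j p) <= collapse k (lift j q))%N.
    by apply: collapse_homo => //; rewrite leq_bump2.
  by rewrite /f leq_bump2.
(* The vertex [j] could only be hit as the target with which [k] is merged, which the chosen order
   excludes. *)
have fj p : f p != j.
  apply/eqP => e; have := lift_collapse (lift j p) ki; rewrite -[lift k _]/(f p) e.
  case: eqVneq => _ e'; first by have := Lk _ jL; rewrite -e' eqxx.
  by case/eqP: (neq_lift j p); apply: val_inj.
have [t ht tE] := lift_factor hf fj.
have hk : {homo (fun p => collapse k (lift j p)) : p q / (p <= q)%N}.
  by move=> p q pq; apply: collapse_homo => //; rewrite leq_bump2.
rewrite (hphi k j _ t ki _ hk ht); last by move=> p; rewrite tE.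
  rewrite -(IH _ jL) act_comp (eq_act w' tE) subrr addr0; reflexivity.
by apply: memL; rewrite mem_rcons inE jL orbT.
Qed.

(** Every correction is zero. Together with [horn_extendE] this makes the extension of zero data a
    projection onto the elements vanishing on the horn. *)
Lemma horn_extend_id w : (forall j, j != i -> act (lift j) w = 0) ->
  horn_extend (fun=> 0) w = w.
Proof.
move=> h; have act0 a b (f : 'I_a.+1 -> 'I_b.+1) : act f 0 = 0.
  by rewrite -[X in act f X](subrr 0) act_sub subrr.
rewrite /horn_extend; have : forall j, j \in horn_order -> j != i by move=> j; rewrite mem_horn_order.
elim: horn_order => //= j L IH hL.
rewrite h; last by apply: hL; exact: mem_head.
rewrite subrr act0 addr0; apply: IH => k kL; apply: hL; rewrite inE kL orbT; reflexivity.
Qed.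

End HornExtension.

(** * Existence and uniqueness of fillers *)

Lemma lin_correction (K : fieldType) (U V : lmodType K) (f : V -> U) (h : U -> V) :
  linear f -> linear h -> linear (fun w => w + f (0 - h w)).
Proof.
move=> lf lh c a b; rewrite !sub0r !(linN lf) lh lf.
by rewrite scalerBr opprD addrACA.
Qed.

Lemma lin_residue (K : fieldType) (U : lmodType K) (d h : U -> U) :
  linear d -> linear h -> linear (fun a => a - d (h a) - h (d a)).
Proof.
move=> ld lh c a b; rewrite ld !lh ld !scalerBr !opprD.
by rewrite [RHS]addrACA; congr (_ + _); rewrite addrACA.
Qed.

Section Horns.
Variables (K : fieldType) (g : linfData K).
Hypothesis charK : [pchar K] =i pred0.
Hypothesis hg : isLinf g.
Notation gforms n := (btens g (formB n)).

Definition gpull k n (f : 'I_k.+1 -> 'I_n.+1) : gforms n -> gforms k := formmap (fpull f).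

Lemma gpull_linear k n (f : 'I_k.+1 -> 'I_n.+1) : linear (gpull f).
Proof. exact: formmap_linear. Qed.

Lemma gpull_add k n (f : 'I_k.+1 -> 'I_n.+1) : {morph gpull f : x y / x + y}.
Proof. exact: linD (gpull_linear f). Qed.

Lemma fpull_add k n (f : 'I_k.+1 -> 'I_n.+1) : {morph @fpull K k n f : x y / x + y}.
Proof. exact: linD (@fpull_linear K k n f). Qed.

Lemma gpull_comp l k n (f : 'I_k.+1 -> 'I_n.+1) (h : 'I_l.+1 -> 'I_k.+1) u :
  gpull h (gpull f u) = gpull (fun p => f (h p)) u.
Proof.
apply: (etrans (formmap_comp _ _ (@fpull_linear K l k h))).
by apply: eq_formmap => a; exact: fpull_comp.
Qed.

Lemma eq_gpull k n (f h : 'I_k.+1 -> 'I_n.+1) u : f =1 h -> gpull f u = gpull h u.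
Proof. by move=> e; apply: eq_formmap => a; exact: eq_fpull. Qed.

Lemma gpull_id n (u : gforms n) : gpull (fun p => p) u = u.
Proof. by apply: (etrans _ (formmap_id u)); apply: eq_formmap => a; exact: fpull_id. Qed.

Variables (m : nat) (i : 'I_m.+2).

Notation fextend := (@horn_extend (fun n => Omega K n) (@fpull K) m i).
Notation gextend := (@horn_extend (fun n => gforms n) gpull m i).

Lemma foldl_correction_linear (L : seq 'I_m.+2) : linear (fun a : Omega K m.+1 =>
  foldl (fun w j => w + fpull (collapse i j) (0 - fpull (lift j) w)) a L).
Proof.
elim: L => [|j L IH]; first by move=> c a b.
have st := lin_correction (@fpull_linear K _ _ (collapse i j)) (@fpull_linear K _ _ (lift j)).
exact: (lin_comp IH st).
Qed.

(** Zero data are compatible, so extending them changes a form just enough to make it vanish on the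
    horn, where the homotopy formula of [horn_contr] applies. *)
Lemma form_project_vanish a : @horn_vanish K m i (fextend (fun=> 0) a).
Proof.
move=> j ji; apply: (@horn_extendE (fun n => Omega K n) (@fpull K) fpull_add _ _ _
  m i (fun=> 0) a j _ ji).
- by move=> l k n f h x; exact: fpull_comp.
- by move=> k n f h x e; exact: eq_fpull.
- by move=> n x; exact: fpull_id.
by move=> j1 j2 t t' _ _ _ _ _; rewrite !(lin0 (@fpull_linear K _ _ _)).
Qed.

Lemma formmap_correction j (u : gforms m.+1) :
  formmap (fun w => w + fpull (collapse i j) (0 - fpull (lift j) w)) u =
  u + gpull (collapse i j) (0 - gpull (lift j) u).
Proof.
rewrite formmapD formmap_id; apply: (congr1 (+%R u)).
rewrite -(formmap_comp (fun w => 0 - fpull (lift j) w) u (@fpull_linear K _ _ _)).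
apply: (congr1 (gpull (collapse i j))); rewrite sub0r.
apply: (etrans (eq_formmap (h := fun w => (-1) *: fpull (lift j) w) u _)).
  by move=> w; rewrite sub0r scaleN1r.
by rewrite formmapZ scaleN1r.
Qed.

Lemma formmap_project u : formmap (fextend (fun=> 0)) u = gextend (fun=> 0) u.
Proof.
rewrite /horn_extend; elim: (horn_order i) u => [|j L IH] u /=; first exact: formmap_id.
rewrite -(formmap_correction j u) -IH.
exact: esym (formmap_comp _ u (foldl_correction_linear L)).
Qed.

Variable s : forall n, Omega K n -> Omega K n.
Hypothesis hs : gauge s.
Notation hc := (horn_contr s i).

Let hc_lin := horn_contr_linear hs i.
Let hc_deg k a := @horn_contr_deg K s hs m i k a.

Lemma hres_deg k a : fdeg k a -> fdeg k (hres hc a).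
Proof.
have degB (x y : Omega K m.+1) : fdeg k x -> fdeg k y -> fdeg k (x - y).
  by move=> dx dy; rewrite -scaleN1r; apply: fdegD => //; exact: fdegZ.
move=> da; apply: (degB); first apply: (degB) => //.
  by have := fdeg_fdiff (hc_deg da); rewrite subrK.
by have := hc_deg (fdeg_fdiff da); rewrite addrK.
Qed.

Lemma hres_face j a : j != i -> fpull (lift j) (hres hc a) = hres (@s m) (fpull (lift j) a).
Proof.
move=> ji; have hf := @horn_contr_face K charK s hs m i j.
have l := @fpull_linear K _ _ (lift j).
have e1 : fpull (lift j) (fdiff (hc a)) = fdiff (s (fpull (lift j) a)).
  by apply: (etrans (fpull_fdiff charK (lift j) (hc a))); exact: congr1 (hf a ji).
have e2 : fpull (lift j) (hc (fdiff a)) = s (fdiff (fpull (lift j) a)).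
  apply: (etrans (hf (fdiff a) ji)).
  exact: congr1 (fpull_fdiff charK (lift j) a).
rewrite /hres -e1 -e2; apply: (etrans (linB l _ _)).
rewrite (linB l a (fdiff (hc a))); reflexivity.
Qed.

Lemma gpull_hres j u : j != i ->
  gpull (lift j) (formmap (hres hc) u) = formmap (hres (@s m)) (gpull (lift j) u).
Proof.
move=> ji; apply: (etrans (formmap_comp _ _ (@fpull_linear K _ _ _))).
apply: (etrans (eq_formmap _ (fun a => hres_face a ji))); apply: esym.
apply: formmap_comp; exact: (lin_residue (@fdiff_linear K m) (@gauge_linear K s hs m)).
Qed.

Lemma gpull_hop j u : j != i ->
  gpull (lift j) (hop hc u) = hop (@s m) (gpull (lift j) u).
Proof.
move=> ji; apply: (etrans (formmap_comp _ _ (@fpull_linear K _ _ _))).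
apply: (etrans (eq_formmap (h := fun a => s (fsignop (fpull (lift j) a))) _ _)).
  by move=> a; rewrite (horn_contr_face charK hs _ ji) fpull_fsignop.
exact: esym (formmap_comp (fpull (lift j)) u
  (lin_comp (@gauge_linear K s hs m) (@fsignop_linear K m))).
Qed.

(** The homotopy formula concerns forms, whereas vanishing is assumed of the tensor as a whole. By
    [formmap_project] such a tensor is fixed by the projection acting on its form factors, and on
    projected forms [hres hc] is zero. *)
Lemma hres_vanish u : (forall j, j != i -> gpull (lift j) u = 0) -> formmap (hres hc) u = 0.
Proof.
move=> hu; have e : formmap (fextend (fun=> 0)) u = u.
  rewrite formmap_project.
  exact: (@horn_extend_id (fun n => gforms n) gpull gpull_add m i u hu).
rewrite -e formmap_comp; last exact: (lin_residue (@fdiff_linear K _) hc_lin).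
apply: (etrans (eq_formmap (h := fun=> 0) u _)); last exact: formmap0.
move=> a; have e' := horn_contr_homotopy charK hs (form_project_vanish a).
by rewrite /hres -addrA -opprD -e' subrr.
Qed.

Lemma hres_eq_faces u v : (forall j, j != i -> gpull (lift j) u = gpull (lift j) v) ->
  formmap (hres hc) u = formmap (hres hc) v.
Proof.
move=> e; apply/eqP; rewrite -subr_eq0 -(linB (@formmap_linear K g _ _ (hres hc))).
apply/eqP; apply: hres_vanish => j ji.
by rewrite (linB (gpull_linear (lift j))) (e _ ji) subrr.
Qed.

Variable N : nat.
Hypothesis N1 : (1 < N)%N.
Hypothesis hN : forall x : g, lcs N x -> x = 0.

Lemma horn_filler_unique u v : tdeg 1 u -> tdeg 1 v -> curv N u = 0 -> curv N v = 0 ->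
  formmap hc u = 0 -> formmap hc v = 0 ->
  (forall j, j != i -> gpull (lift j) u = gpull (lift j) v) -> u = v.
Proof.
move=> du dv cu cv hu hv /hres_eq_faces e.
have eu := MC_fixpoint hg hc_lin hc_deg du cu hu.
have ev := MC_fixpoint hg hc_lin hc_deg dv cv hv.
rewrite -e in ev; exact: (fixpoint_unique hg N1 hN du dv eu ev).
Qed.

Lemma gextend_tdeg (phi : 'I_m.+2 -> gforms m) w :
  (forall j, j != i -> tdeg 1 (phi j)) -> tdeg 1 w -> tdeg 1 (gextend phi w).
Proof.
rewrite /horn_extend => hphi; have : {subset horn_order i <= predC1 i}.
  by move=> j; rewrite mem_horn_order.
elim: (horn_order i) w => [|j L IH] w hL hw //=.
apply: IH; first by move=> k kL; apply: hL; rewrite inE kL orbT.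
apply: (tdegD hg hw); apply: (F_tdeg hg); apply: (tdegB hg); last exact: (F_tdeg hg).
by apply: hphi; have := hL j (mem_head _ _).
Qed.

Lemma horn_filler_exists (phi : 'I_m.+2 -> gforms m) :
  @horn_compatible (fun n => gforms n) gpull m i phi ->
  (forall j, j != i -> [/\ tdeg 1 (phi j), curv N (phi j) = 0 & formmap (@s m) (phi j) = 0]) ->
  exists u, [/\ tdeg 1 u, curv N u = 0, formmap hc u = 0 &
    forall j, j != i -> gpull (lift j) u = phi j].
Proof.
move=> cphi hphi; pose E := gextend phi 0.
have dE : tdeg 1 E.
  apply: gextend_tdeg; last exact: (tdeg0 hg).
  by move=> j /hphi[].
have fE j : j != i -> gpull (lift j) E = phi j.
  move=> ji; apply: (@horn_extendE (fun n => gforms n) gpull gpull_add _ _ _ m i phi 0 j cphi ji).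
  - by move=> l k n f h x; exact: gpull_comp.
  - by move=> k n f h x; exact: eq_gpull.
  by move=> n x; exact: gpull_id.
pose A := formmap (hres hc) E.
have hA : formmap hc A = 0.
  rewrite /A formmap_comp //.
  apply: (etrans (eq_formmap (h := fun=> 0) E _)); last exact: formmap0.
  exact: (h_hres hc_lin (horn_contr_sqr charK hs i) (horn_contr_diff charK hs i)).
have dA : tdeg 1 A.
  rewrite -[1 : int]addr0; apply: (formmap_tdeg hg) dE => [|p a ha].
    exact: (lin_residue (@fdiff_linear K m.+1) hc_lin).
  rewrite addr0; exact: hres_deg.
have [u du eu] := fixpoint_exists hg N1 hN hc_lin hc_deg dA.
have hu := fixpoint_contr hc_lin (horn_contr_sqr charK hs i) hA eu.
have fu j : j != i -> gpull (lift j) u = phi j.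
  move=> ji; have [dj cj sj] := hphi _ ji.
  (* The prescribed face satisfies the same kind of equation with [s] in place of [horn_contr], so
     uniqueness in dimension [m] identifies it with the face of [u]. *)
  have ej := MC_fixpoint hg (@gauge_linear K s hs m) (fun k a => @gauge_deg K s hs m k a) dj cj sj.
  have du' : tdeg 1 (gpull (lift j) u) by exact: (F_tdeg hg).
  apply: (fixpoint_unique hg N1 hN du' dj _ ej).
  have := congr1 (gpull (lift j)) eu; rewrite (linB (gpull_linear (lift j))).
  rewrite (gpull_hop _ ji) /A (gpull_hres _ ji) (fE _ ji).
  by rewrite [gpull (lift j) (tquad N u)](F_tquad charK hg).
exists u; split=> //.
have rA : formmap (hres hc) u = A by apply: hres_eq_faces => j ji; rewrite fu // fE.
apply: (fixpoint_MC charK hg N1 hN hc_lin hc_deg (horn_contr_sqr charK hs i) du eu hA rA).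
apply: hres_vanish => j ji; apply: (etrans (F_curv charK hg (lift j) N u)).
have [_ cj _] := hphi _ ji; rewrite -cj -(fu _ ji); reflexivity.
Qed.

End Horns.

(** * The groupoid structure on gamma *)

Section Gamma.
Variables (K : fieldType) (charK : [pchar K] =i pred0).
Variables (s : forall n : nat, Omega K n -> Omega K n) (hs : gauge s).
Variables (g : linfData K) (hg : isLinf g).
Variable N : nat.
Hypothesis N1 : (1 < N)%N.
Hypothesis hN : forall x : g, lcs N x -> x = 0.
Notation gforms n := (btens g (formB n)).
Notation gamma := (gamma s g).

Lemma sact_gamma k n (f : {ffun 'I_k.+1 -> 'I_n.+1}) (u : gforms n) :
  sact gamma f u = gpull f u.
Proof. by rewrite /gpull formmap.unlock. Qed.

Lemma smem_gamma n (u : gforms n) :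
  smem gamma u <-> [/\ tdeg 1 u, curv N u = 0 & formmap (@s n) u = 0].
Proof.
rewrite formmap.unlock; split=> [[/(MC_curv hg N1 hN)[du cu] su]|[du cu su]]; split=> //.
by apply/(MC_curv hg N1 hN).
Qed.

Lemma monotone_homo k n (f : {ffun 'I_k.+1 -> 'I_n.+1}) :
  monotone f <-> {homo f : p q / (p <= q)%N}.
Proof.
split=> [/forallP h p q pq|h]; first by have /forallP/(_ q)/implyP := h p; apply.
by apply/forallP => p; apply/forallP => q; apply/implyP; exact: h.
Qed.

Lemma smem_gpull k n (f : 'I_k.+1 -> 'I_n.+1) (u : gforms n) :
  {homo f : p q / (p <= q)%N} -> smem gamma u -> smem gamma (gpull f u : gamma k).
Proof.
move=> hf /smem_gamma[du cu su]; apply/smem_gamma; split.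
- exact: (F_tdeg hg f du).
- apply: (etrans (esym (F_curv charK hg f N u))); rewrite cu; exact: lin0 (gpull_linear f).
apply: (etrans (formmap_comp _ _ (@gauge_linear K s hs k))).
apply: (etrans (eq_formmap (h := fun a => fpull f (s a)) u _)).
  by move=> a; exact: (gauge_fpull hs a hf).
rewrite -(formmap_comp (@s n) u (@fpull_linear K _ _ f)) su; exact: lin0 (gpull_linear f).
Qed.

Lemma gamma_sset : isSSet gamma.
Proof.
split=> [k n f u /monotone_homo hf hu|n u _|l k n f h u _ _ _].
- rewrite sact_gamma; exact: smem_gpull.
- rewrite sact_gamma; apply: etrans (gpull_id u); apply: eq_gpull => p; exact: ffunE.
rewrite !sact_gamma; apply: (etrans _ (esym (gpull_comp charK f h u))).
by apply: eq_gpull => p; exact: ffunE.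
Qed.

(** Forms pulled back from dimension k < n have degree at most k, so their integrals over the
    n-simplex vanish. *)
Lemma degenerate_thin n (u : gamma n) : degenerate u -> gammaThin u.
Proof.
case=> k [f [y [kn /monotone_homo hf _ hy ->]]]; rewrite sact_gamma; split.
  exact: smem_gpull.
rewrite /gpull teval_formmap; last exact: fI_linear.
rewrite /teval big1 // => b _; have h := @fdeg_fpull K n k f _ _ (@fdeg_fbase K k b).
have le : (#|b.2| <= k)%N by have := max_card (mem b.2); rewrite card_ord.
by rewrite (fI_deg _ h) ?scale0r // eqz_nat ltn_eqF // (leq_ltn_trans le kn).
Qed.

(** In an element of total degree 1 the coefficient of an n-form has degree 1 - n, which is at most
    -l when n > l. *)
Lemma thin_above_degree l n (u : gamma n) :
  (forall (i : int) (x : g), i <= - l%:Z -> hasdeg i x -> x = 0) ->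
  (l < n)%N -> smem gamma u -> gammaThin u.
Proof.
move=> hl ln hu; split=> //; have [du _ _] := (smem_gamma u).1 hu.
rewrite /teval big1 // => b _; have [e|ne] := eqVneq #|b.2| n.
  by rewrite (hl _ _ _ (du b)) ?scaler0 // e; lia.
by rewrite (fI_deg _ (@fdeg_fbase K n b)) ?scale0r // eqz_nat.
Qed.

(** On the point all forms have degree 0, so a Maurer-Cartan element has coefficients of degree 1,
    and these are zero. *)
Lemma gamma_reduced :
  (forall (i : int) (x : g), 0 < i -> hasdeg i x -> x = 0) -> exists! u : gamma 0%N, smem gamma u.
Proof.
move=> hl; exists 0; split=> [|u /smem_gamma[du _ _]]; last first.
  apply/esym; apply: btensP => b; rewrite monalg.mcoeff0; apply: (hl _ _ _ (du b)).
  by have := max_card (mem b.2); rewrite card_ord leqn0 => /eqP ->.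
apply/smem_gamma; split; first exact: (tdeg0 hg).
- rewrite /curv (lin0 (@tdiff_linear K g hg 0%N)) (tbr0_mem0 hg) ?mem_head // !add0r /tquad.
  rewrite big_nat big1 // => l /andP[l2 _]; rewrite (tbr0_mem0 hg) ?scaler0 //.
  by rewrite mem_nseq eqxx andbT; lia.
exact: lin0 (@formmap_linear K g _ _ _).
Qed.

Section Horn.
Variables (m : nat) (i : 'I_m.+2).

(** If h u = 0, integrating over the [i]-th face annihilates the [s]-part and isolates the integral
    of [u], which is therefore zero; then h u reduces to s u. *)
Lemma horn_contr_kernel (u : gforms m.+1) : formmap (horn_contr s i) u = 0 <->
  formmap (@s _) u = 0 /\ teval (fI (fun j : 'I_m.+2 => j)) u = 0.
Proof.
have e : formmap (horn_contr s i) u = formmap (@s _) u +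
    ptens (teval (fI (fun j : 'I_m.+2 => j)) u) ((-1) ^+ i *: whitney K (lift i)).
  by rewrite -formmap_scale -formmapD; apply: eq_formmap => a; exact: horn_contrE.
split=> [h0|[hu0 tu0]]; last first.
  by rewrite e hu0 tu0 (lin0 (ptens_linearl _)) addr0.
have t0 : teval (fI (fun j : 'I_m.+2 => j)) u = 0.
  pose I' : Omega K m.+1 -> K^o := fun a => (-1) ^+ i *: (fI (lift i) a : K^o).
  have lI : linear I'.
    by move=> c a b; rewrite /I' (@fI_linear K _ _ (lift i)) scalerDr !scalerA mulrC.
  have <- : teval (fun a => I' (horn_contr s i a)) u = teval (fI (fun j : 'I_m.+2 => j)) u.
    by apply: eq_teval => a; exact: (fI_face_horn_contr charK hs i a).
  by rewrite -(teval_formmap (horn_contr s i) u lI) h0; exact: lin0 (teval_linear _).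
split=> //; move: e; rewrite h0 t0 (lin0 (ptens_linearl _)) addr0.
by move=> <-.
Qed.

Lemma gammaThin_contr (u : gforms m.+1) : gammaThin (u : gamma m.+1) <->
  [/\ tdeg 1 u, curv N u = 0 & formmap (horn_contr s i) u = 0].
Proof.
split=> [[/smem_gamma[du cu su] tu]|[du cu /horn_contr_kernel[su tu]]].
  by split=> //; apply/horn_contr_kernel.
by split=> //; apply/smem_gamma.
Qed.

Definition ffun_lift (j : 'I_m.+2) : {ffun 'I_m.+1 -> 'I_m.+2} := [ffun p => lift j p].

Lemma inHorn_lift j : j != i -> inHorn i (ffun_lift j).
Proof.
move=> ji; apply/andP; split.
  by apply/monotone_homo => p q; rewrite !ffunE; exact: homo_lift.
apply/existsP; exists j; rewrite ji; apply/codomP => -[p]; rewrite ffunE => /eqP.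
by rewrite (negPf (neq_lift j p)).
Qed.

Lemma inHorn_factor k (f : {ffun 'I_k.+1 -> 'I_m.+2}) : inHorn i f ->
  exists j (t : {ffun 'I_k.+1 -> 'I_m.+1}),
    [/\ j != i, monotone t & f = fcompose (ffun_lift j) t].
Proof.
case/andP => /monotone_homo hf /existsP[j /andP[ji jf]].
have fj q : f q != j by apply: contraNneq jf => <-; exact: codom_f.
have [t ht e] := lift_factor hf fj.
exists j, [ffun q => t q]; split=> //.
  by apply/monotone_homo => p q; rewrite !ffunE; exact: ht.
by apply/ffunP => q; rewrite !ffunE e.
Qed.

Variable phi : horn gamma i.

(** The values of a horn depend on proofs of [inHorn]; this removes the dependency. The value 0 is
    reached only for [j] = [i], whose face is not in the horn. *)
Definition horn_face j : gforms m :=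
  match boolP (inHorn i (ffun_lift j)) with
  | AltTrue h => phi _ _ h
  | AltFalse _ => 0
  end.

Lemma horn_faceE j (h : inHorn i (ffun_lift j)) : horn_face j = phi _ _ h.
Proof.
rewrite /horn_face; case: {-}_ / boolP => h'; last by case/negP: h'.
by rewrite (bool_irrelevance h' h).
Qed.

Lemma eq_hmap k (f f' : {ffun 'I_k.+1 -> 'I_m.+2}) (h : inHorn i f) (h' : inHorn i f') :
  f = f' -> phi _ _ h = phi _ _ h'.
Proof. by move=> e; case: _ / e h' => h'; rewrite (bool_irrelevance h h'). Qed.

Lemma inHorn_face j k (t : {ffun 'I_k.+1 -> 'I_m.+1}) : j != i -> monotone t ->
  inHorn i (fcompose (ffun_lift j) t).
Proof.
move=> ji /monotone_homo ht; apply/andP; split.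
  by apply/monotone_homo => p q pq; rewrite !ffunE; apply: homo_lift; exact: ht.
apply/existsP; exists j; rewrite ji; apply/codomP => -[p]; rewrite !ffunE => /eqP.
by rewrite (negPf (neq_lift j _)).
Qed.

Lemma gpull_horn_face j k (t : {ffun 'I_k.+1 -> 'I_m.+1})
    (h : inHorn i (fcompose (ffun_lift j) t)) : j != i -> monotone t ->
  gpull t (horn_face j) = phi _ _ h.
Proof.
move=> ji mt; rewrite (horn_faceE (inHorn_lift ji)).
rewrite (horn_nat phi (inHorn_lift ji) h mt) sact_gamma; reflexivity.
Qed.

(** Both sides are the value of the horn at one and the same simplex, reached through face [j] or
    through face [k]. *)
Lemma horn_face_compatible :
  @horn_compatible (fun n => gforms n) (@gpull K g) m i horn_face.
Proof.
move=> j k t t' ji ki ht ht' e.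
have mono (r : 'I_m.+1 -> 'I_m.+1) : {homo r : p q / (p <= q)%N} -> monotone [ffun p => r p].
  by move=> hr; apply/monotone_homo => p q; rewrite !ffunE; exact: hr.
have act (r : 'I_m.+1 -> 'I_m.+1) (u : gforms m) : gpull r u = gpull [ffun p => r p] u.
  by apply: eq_gpull => p; rewrite ffunE.
rewrite (act t) (act t') (gpull_horn_face (inHorn_face ji (mono _ ht)) ji (mono _ ht)).
rewrite (gpull_horn_face (inHorn_face ki (mono _ ht')) ki (mono _ ht')).
by apply: eq_hmap; apply/ffunP => p; rewrite !ffunE.
Qed.

Lemma horn_face_mem j : j != i ->
  [/\ tdeg 1 (horn_face j), curv N (horn_face j) = 0 & formmap (@s m) (horn_face j) = 0].
Proof.
move=> ji; rewrite (horn_faceE (inHorn_lift ji)); apply/smem_gamma; exact: horn_mem.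
Qed.

(** Every simplex of the horn factors through one of its faces [lift j], so naturality reduces the
    filling condition to these. *)
Lemma fills_faces (u : gforms m.+1) : fills phi (u : gamma m.+1) <->
  forall j, j != i -> gpull (lift j) u = horn_face j.
Proof.
have face j : gpull (ffun_lift j) u = gpull (lift j) u.
  by apply: eq_gpull => p; exact: ffunE.
split=> [h j ji|h k f hf].
  by rewrite -face (horn_faceE (inHorn_lift ji)) -(h _ _ (inHorn_lift ji)) sact_gamma.
have [j [t [ji mt e]]] := inHorn_factor hf; have h' := inHorn_face ji mt.
rewrite (eq_hmap hf h' e) -(gpull_horn_face h' ji mt) -(h _ ji) -face sact_gamma e.
rewrite (gpull_comp charK); apply: eq_gpull => p; exact: ffunE.
Qed.

Lemma thin_filler : exists! u : gamma m.+1, gammaThin u /\ fills phi u.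
Proof.
have [u [du cu hu fu]] := horn_filler_exists charK hg hs N1 hN horn_face_compatible horn_face_mem.
exists u; split.
  by split; [apply/gammaThin_contr|apply/fills_faces].
move=> v [/gammaThin_contr[dv cv hv] /fills_faces fv].
apply: (horn_filler_unique charK hg hs N1 hN du dv cu cv hu hv) => j ji.
by rewrite fu // fv.
Qed.

End Horn.

Lemma gamma_groupoid : isInftyGroupoid (@gammaThin K s g).
Proof.
split; first exact: gamma_sset.
- by move=> n u _ [].
- by move=> n u _; exact: degenerate_thin.
by case=> [//|m] i phi _; exact: thin_filler.
Qed.

End Gamma.

Theorem theorem5p4 (K : fieldType) (charK : [pchar K] =i pred0)
    (s : forall n : nat, Omega K n -> Omega K n) (hs : gauge s)
    (g : linfData K) (hg : isLinf g) (hnil : nilpotent g) :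
  [/\ isInftyGroupoid (@gammaThin K s g),
      forall l : nat,
        (forall (i : int) (x : g), i <= - l%:Z -> hasdeg i x -> x = 0) ->
        isLGroupoid l (@gammaThin K s g)
    & forall l : nat,
        (forall (i : int) (x : g),
           (i <= - l%:Z) || (0 < i) -> hasdeg i x -> x = 0) ->
        isLGroup l (@gammaThin K s g)].
Proof.
have [N N1 hN] := nilpotent_lcs hnil.
have inf := gamma_groupoid charK hs hg N1 hN.
have gpd l : (forall (i : int) (x : g), i <= - l%:Z -> hasdeg i x -> x = 0) ->
    isLGroupoid l (@gammaThin K s g).
  move=> hl; split=> // n u _ ln hu.
  exact: (thin_above_degree hg N1 hN hl ln hu).
split=> // l hl; split.
  by apply: gpd => i x il; apply: hl; rewrite il.
by apply: (gamma_reduced s hg N1 hN) => i x i0; apply: hl; rewrite i0 orbT.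
Qed.
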